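(* Let $\alpha\ge 2$, $\beta>0$, $b>0$, and let $V:\mathbb{R}\to\mathbb{R}$ be given by $V(x)=b|x|^{\alpha}+w(x)$ for all $x\in\mathbb{R}$, where $w:\mathbb{R}\to\mathbb{R}$ is a continuous convex function such that $w(x)=o(|x|^{\alpha})$ as $x\to\pm\infty$. Let $p\in\mathbb{N}$, $p>\alpha$. For $(\lambda_1,\dots,\lambda_N)\in\mathbb{R}^N$ set $m_{p,N}=\frac1N\sum_{i=1}^N\lambda_i^p$. Then, under $\mathbb{P}^N_{V,\beta}$, the sequence $(m_{p,N})_{N\ge1}$ satisfies a large deviations principle with speed $N^{1+\frac{\alpha}{p}}$ and good rate function $J_p$, where, if $p$ is even, $$J_p(x)=\begin{cases} b\left(x-\langle\sigma_\beta^V,x^p\rangle\right)^{\frac{\alpha}{p}} & \text{if } x\ge\langle\sigma_\beta^V,x^p\rangle,\\ +\infty&\text{otherwise,}\end{cases}$$ and, if $p$ is odd, $J_p(x)=b\left|x-\langle\sigma_\beta^V,x^p\rangle\right|^{\frac{\alpha}{p}}$ for all $x\in\mathbb{R}$.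
   Context: The $\beta$-ensemble with potential $V$ is the probability measure on $\mathbb{R}^N$ $$d\mathbb{P}^N_{V,\beta}=\frac{1}{Z^N_{V,\beta}}\prod_{i<j}|\lambda_i-\lambda_j|^{\beta}e^{-N\sum_{i=1}^NV(\lambda_i)}\prod_{i=1}^Nd\lambda_i,$$ with $Z^N_{V,\beta}$ the normalizing constant. The equilibrium measure $\sigma_\beta^V$ is the unique (compactly supported) minimizer of the good rate function of the large deviations principle, with speed $N^2$ and for the weak topology, satisfied by the empirical measure $L_N=\frac1N\sum_{i=1}^N\delta_{\lambda_i}$ under $\mathbb{P}^N_{V,\beta}$; equivalently it is the unique probability measure on $\mathbb{R}$ minimizing $\mu\mapsto\int V\,d\mu-\frac{\beta}{2}\iint\log|x-y|\,d\mu(x)d\mu(y)$. The notation $\langle\sigma_\beta^V,x^p\rangle$ stands for the $p$-th moment $\int x^p\,d\sigma_\beta^V(x)$. A sequence of random variables $(Z_N)$ in a topological space $\mathcal{X}$ with Borel $\sigma$-field satisfies a large deviations principle (LDP) with speed $\upsilon(N)\uparrow+\infty$ and rate function $J:\mathcal{X}\to[0,+\infty]$ if $J$ is lower semicontinuous and for every Borel set $B$, $-\inf_{B^\circ}J\le\liminf_N\frac1{\upsilon(N)}\log\mathbb{P}(Z_N\in B)\le\limsup_N\frac1{\upsilon(N)}\log\mathbb{P}(Z_N\in B)\le-\inf_{\overline B}J$. The rate function $J$ is good if all its level sets $\{J\le t\}$, $t\in[0,+\infty)$, are compact. *)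

(* Defs.v *)
From HB Require Import structures.
From mathcomp Require Import all_boot all_order all_algebra.
From mathcomp Require Import all_classical all_reals all_analysis.

Set Implicit Arguments.
Unset Strict Implicit.
Unset Printing Implicit Defensive.

Import Order.TTheory GRing.Theory Num.Theory.
Import numFieldNormedType.Exports.

Local Open Scope classical_set_scope.
Local Open Scope ring_scope.

(* Needed for the Landau notations at infinity. *)
Canonical pinfty_nbhs_filter_on (R : numFieldType) :=
  FilterType (pinfty_nbhs R) proper_pinfty_nbhs.
Canonical ninfty_nbhs_filter_on (R : numFieldType) :=
  FilterType (ninfty_nbhs R) proper_ninfty_nbhs.

Section LargeDeviations.
Context {R : realType} {X : topologicalType}.
Local Open Scope ereal_scope.

Definition speed (v : nat -> R) : Prop :=
  nondecreasing_seq v /\ v @ \oo --> +oo%R.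

Definition rate_function (J : X -> \bar R) : Prop :=
  (forall x, 0 <= J x) /\ lower_semicontinuous J.

Definition good (J : X -> \bar R) : Prop :=
  forall t : R, (0 <= t)%R -> compact [set x | J x <= t%:E].

(* [P N] is the law on the [N]-th sample space, so that [P N (Z N @^-1` B)] is
   the probability that [Z N] belongs to [B]. Note that [lne 0 = -oo]. *)
Definition satisfies_LDP (T : nat -> Type) (P : forall N, set (T N) -> \bar R)
    (Z : forall N, T N -> X) (v : nat -> R) (J : X -> \bar R) : Prop :=
  let u (B : set X) := fun N => (v N)^-1%:E * lne (P N (Z N @^-1` B)) in
  [/\ speed v, rate_function J &
   forall B : set X, <<s open >> B ->
   [/\ - ereal_inf (J @` B°) <= limn_einf (u B),
       limn_einf (u B) <= limn_esup (u B) &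
       limn_esup (u B) <= - ereal_inf (J @` closure B)]].

End LargeDeviations.

Section PowerMeasure.
Context {d} {T : measurableType d} {R : realType}.
Variable m : {sigma_finite_measure set T -> \bar R}.
Local Open Scope ereal_scope.

Definition cons_pair n (z : T * n.-tuple T) : n.+1.-tuple T :=
  [tuple of z.1 :: z.2].

Lemma measurable_cons_pair n : measurable_fun setT (@cons_pair n).
Proof. exact: measurable_cons. Qed.

Section cons_measure.
Variables (n : nat) (mu : {sigma_finite_measure set (n.-tuple T) -> \bar R}).

Definition cons_measure : set (n.+1.-tuple T) -> \bar R :=
  pushforward (m \x mu) (@cons_pair n).

Let cons_measure0 : cons_measure set0 = 0.
Proof. by apply: measure0; exact: measurable_cons_pair. Qed.

Let cons_measure_ge0 A : 0 <= cons_measure A.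
Proof. by apply: measure_ge0; exact: measurable_cons_pair. Qed.

Let cons_measure_sigma_additive : semi_sigma_additive cons_measure.
Proof.
by apply: measure_semi_sigma_additive; exact: measurable_cons_pair.
Qed.

HB.instance Definition _ := isMeasure.Build _ _ _ cons_measure
  cons_measure0 cons_measure_ge0 cons_measure_sigma_additive.

Lemma cons_measure_sigma_finite : sigma_finite setT cons_measure.
Proof.
have [F FT Foo] := sigma_finiteT m.
have [G GT Goo] := sigma_finiteT mu.
pose h (t : n.+1.-tuple T) := (thead t, [tuple of behead t]).
have mh : measurable_fun setT h.
  apply/measurable_fun_pairP; split; first exact: measurable_tnth.
  exact: measurable_behead.
have hK : cancel (@cons_pair n) h.
  by move=> [x t]; congr (_, _); apply/val_inj.
have [k kK] : exists k : nat -> nat * nat, forall u, exists i, k i = u.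
  exists (fun i => odflt (0, 0)%N (unpickle i)) => u.
  by exists (pickle u); rewrite pickleK.
exists (fun i => h @^-1` (F (k i).1 `*` G (k i).2)).
  apply/seteqP; split => // t _.
  have [i _ Fi] : (\bigcup_i F i) (h t).1 by rewrite -FT.
  have [j _ Gj] : (\bigcup_i G i) (h t).2 by rewrite -GT.
  by have [l kl] := kK (i, j); exists l => //; rewrite kl.
move=> i; have [mF Fi] := Foo (k i).1; have [mG Gi] := Goo (k i).2; split.
  by rewrite -[X in measurable X]setTI; apply: mh => //; exact: measurableX.
rewrite /cons_measure /pushforward -comp_preimage.
rewrite (_ : h \o _ = id); last by apply/funext => z /=; rewrite hK.
by rewrite preimage_id product_measure1E// lte_mul_pinfty// ge0_fin_numE.
Qed.

HB.instance Definition _ :=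
  Measure_isSigmaFinite.Build _ _ _ cons_measure cons_measure_sigma_finite.

End cons_measure.

Fixpoint power_measure n : {sigma_finite_measure set (n.-tuple T) -> \bar R} :=
  match n with
  | 0 => \d_ ([tuple] : 0.-tuple T)
  | n'.+1 => cons_measure (power_measure n')
  end.

End PowerMeasure.

Section BetaEnsemble.
Context {R : realType}.
Variables (V : R -> R) (beta : R).

Definition beta_weight N (l : N.-tuple (measurableTypeR R)) : R :=
  (\prod_(i < N) \prod_(j < N | (i < j)%N) `|tnth l i - tnth l j| `^ beta) *
  expR (- N%:R * \sum_(i < N) V (tnth l i)).

Local Open Scope ereal_scope.

Definition partition_function N : \bar R :=
  \int[power_measure lebesgue_measure N]_l (beta_weight l)%:E.

Definition beta_ensemble N (A : set (N.-tuple (measurableTypeR R))) : \bar R :=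
  (\int[power_measure lebesgue_measure N]_(l in A) (beta_weight l)%:E) / partition_function N.

(* When [\int V dmu = +oo] the second term may be infinite as well; the
   difference is then read as [+oo]. *)
Definition energy (mu : probability (measurableTypeR R) R) : \bar R :=
  let potential := \int[mu]_x (V x)%:E in
  if potential == +oo then +oo
  else potential -
    (beta / 2)%:E * \int[mu \x mu]_z lne `|z.1 - z.2|%:E.

Definition minimizes_energy (mu : probability (measurableTypeR R) R) : Prop :=
  forall nu, energy mu <= energy nu.

(* Uniqueness is on Borel sets: a [probability] is a total set function, with
   unconstrained values on the non measurable sets. *)
Definition equilibrium_measure (sigma : probability (measurableTypeR R) R) : Prop :=
  minimizes_energy sigma /\
  forall mu, minimizes_energy mu -> forall A, measurable A -> mu A = sigma A.

End BetaEnsemble.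

Section Moments.
Context {R : realType}.

Definition empirical_moment (p N : nat) (l : N.-tuple (measurableTypeR R)) : R :=
  N%:R^-1 * \sum_(i < N) tnth l i ^+ p.

Definition moment (mu : probability (measurableTypeR R) R) (p : nat) : R :=
  \int[mu]_x (x ^+ p).

Definition moment_rate (b alpha : R) (p : nat) (m x : R) : \bar R :=
  if odd p then (b * `|x - m| `^ (alpha / p%:R))%:E
  else if m <= x then (b * (x - m) `^ (alpha / p%:R))%:E
  else +oo%E.

End Moments.

(* Main.v *)
Require Import Defs.
From HB Require Import structures.
From mathcomp Require Import all_boot all_order all_algebra.
From mathcomp Require Import all_classical all_reals all_analysis.
From mathcomp Require Import measurable_realfun.
From mathcomp Require Import ring lra.

Set Implicit Arguments.
Unset Strict Implicit.
Unset Printing Implicit Defensive.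

Import Order.TTheory GRing.Theory Num.Theory.
Import numFieldNormedType.Exports.

Local Open Scope classical_set_scope.
Local Open Scope ring_scope.

(** Two effects live on different scales. The bulk of a configuration is rigid: moving the empirical
    measure away from sigma costs exp(-c N^2), which is out of reach at the speed N^(1 + alpha/p)
    since alpha < p. A deviation s of the moment is therefore produced by distant particles, which
    must satisfy sum |x|^p >= N s and pay about N b sum |x|^alpha. As alpha/p < 1, the function
    t^(alpha/p) is subadditive, so the cheapest choice is a single particle at distance (N s)^(1/p),
    of cost b s^(alpha/p) N^(1 + alpha/p). For even p such particles only increase the moment: a
    deficit is a bulk deviation, of infinite rate.

    Normalisation. [exists_confinement] writes V = [Vt] + beta [clog] - c1 with [Vt] continuous,
    nonnegative and growing faster than linearly. The terms [clog] are given to the kernel, and [Lk]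
    = clog x + clog y - log|x - y| is nonnegative. By [energyE], sigma minimises the energy [eng]
    built from [Vt] and [Lk].

    Rigidity. [trisum] interpolates -log, up to a constant, by a positive combination of triangular
    kernels. Each of them is the autocorrelation of an interval, hence positive definite, with an
    explicit remainder: the squared L^2 distance [gap2] between window masses ([trisum_psd]). The
    double sum over the particles is expanded around sigma, and the linear term is controlled by the
    first-order condition [Euler_Lagrange] in the form [effective_potential]. This bounds the
    density by the exponential of -N^2 (minimal energy + const [gap2] - eta), up to lower order
    terms ([weight_le_gap]). Jensen's inequality against a smoothing of sigma gives the matching
    lower bound on the partition function ([partition_function_ge]). Since [gap2] controls the
    moments of the particles in a compact set, [truncated_moment_concentration] follows.

    Upper bound. Given the other particles, the integral of exp(N b' |x|^alpha) over the far
    positions of one particle is bounded independently of the others, for any b' < b. Treating the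
    particles one at a time yields [integral_outer_weights]; Markov's inequality and subadditivity
    then yield [outer_moment_tail], and [moment_deviation] combines it with the rigidity.

    Lower bound. [move_particle] sends one particle of a typical configuration to the required
    distance, at the cost computed above ([moment_lower_bound]). [moment_LDP] assembles the two
    bounds. *)

(** * Jensen's inequality for exp(-h) *)

Section Jensen.
Context d (T : measurableType d) {R : realType}.
Local Open Scope ereal_scope.

Lemma measurable_expeRN (h : T -> \bar R) :
  measurable_fun [set: T] h -> (forall x, 0 <= h x) ->
  measurable_fun [set: T] (fun x => expeR (- h x)).
Proof.
move=> mh h0.
have -> : (fun x => expeR (- h x)) = (fun x =>
    if h x == +oo then 0 else (expR (- fine (h x)))%:E).
  by apply/funext => x; case: (h x) (h0 x).
apply: measurable_fun_ifT => //.
- apply: (measurable_fun_bool true).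
  have -> : setT `&` (fun x => h x == +oo) @^-1` [set true] = setT `&` h @^-1` [set +oo].
    by apply/seteqP; split => x /= [_ /eqP].
  by apply: mh => //; exact: emeasurable_set1.
- apply/measurable_EFinP/measurableT_comp => //.
  by apply: measurable_funN; exact: measurableT_comp.
Qed.

(* With [H := \int h], this is the integral of
   [e^(-h) + e^(-H) h >= e^(-H) (1 + H)]. *)
Lemma jensen_expeRN (P : probability T R) (h : T -> \bar R) :
  measurable_fun [set: T] h -> (forall x, 0 <= h x) ->
  expeR (- \int[P]_x h x) <= \int[P]_x expeR (- h x).
Proof.
move=> mh h0.
have H0 : 0 <= \int[P]_x h x by exact: integral_ge0.
have e0 x : 0 <= expeR (- h x) by exact: expeR_ge0.
(* If the integral of h is infinite, the left-hand side is 0. *)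
case E : (\int[P]_x h x) H0 => [H| |] //= H0; last exact: integral_ge0.
have mE := measurable_expeRN mh h0.
have K : (expR (- H) * (1 + H))%:E <=
    \int[P]_x expeR (- h x) + (expR (- H))%:E * \int[P]_x h x.
  rewrite -ge0_integralZl_EFin ?expR_ge0// -ge0_integralD//; last 2 first.
  - by move=> x _; rewrite mule_ge0// lee_fin expR_ge0.
  - exact: measurable_funeM.
  rewrite -[leLHS]mule1 -(@probability_setT _ _ _ P) -integral_cst//.
  apply: ge0_le_integral => //=.
  - by move=> x _; rewrite lee_fin mulr_ge0 ?expR_ge0 ?addr_ge0 // -lee_fin.
  - by apply: emeasurable_funD => //; exact: measurable_funeM.
  - move=> x _; move: (h0 x); case: (h x) => [r| |] //= r0; last first.
      by rewrite mulry gtr0_sg ?expR_gt0// mul1e leey.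
    rewrite -EFinM -EFinD lee_fin.
    have -> : (expR (- r) = expR (- H) * expR (H - r))%R.
      by rewrite -expRD addrA addNr add0r.
    rewrite -mulrDr ler_wpM2l ?expR_ge0//.
    by have := expR_ge1Dx (H - r); lra.
move: K; rewrite E -EFinM mulrDr mulr1 EFinD leeD2rE// lee_fin.
Qed.

End Jensen.

(** * Translations and iterated integrals over tuples *)

Section Translation.
Context {R : realType}.
Local Open Scope ereal_scope.
Notation mR := (measurableTypeR R).
Notation leb := (@lebesgue_measure R).

Lemma measurable_shift (x : R) : measurable_fun [set: mR] (fun z : mR => (x + z)%R : mR).
Proof. by apply: (@measurable_funD _ mR R _ (cst x) id). Qed.

(** The image of Lebesgue measure under a shift gives half-open intervals their length, and this
    determines it. *)
Lemma ge0_integral_shift (x : R) (g : mR -> \bar R) :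
  measurable_fun [set: mR] g -> (forall z, 0 <= g z) ->
  \int[leb]_z g (x + z)%R = \int[leb]_z g z.
Proof.
move=> mg g0.
have <- : \int[pushforward leb (fun z : mR => (x + z)%R : mR)]_z g z =
    \int[leb]_z g (x + z)%R.
  by rewrite ge0_integral_pushforward//; exact: measurable_shift.
have mx := measurable_shift x.
apply: eq_measure_integral => A mA _; apply/esym.
pose m : {measure set mR -> \bar R} := pushforward leb (fun z : mR => (x + z)%R : mR).
suff H : forall X, ocitv X -> leb X = m mx X by exact: (lebesgue_measure_unique H mA).
move=> _ [[a b]] /= _ <-.
rewrite /pushforward.
have -> : (fun z : mR => (x + z)%R : mR) @^-1` `]a, b]%classic =
          `](a - x)%R, (b - x)%R]%classic.
  by apply/seteqP; split => z /=; rewrite !in_itv/= ?ltrBlDl ?lerBrDl.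
by rewrite !lebesgue_measure_itv/= !lte_fin ltrD2r; case: ifP => // _; rewrite -!EFinB; congr (_%:E); ring.
Qed.

End Translation.

Section TupleIntegral.
Context {R : realType}.
Local Open Scope ereal_scope.
Notation mR := (measurableTypeR R).
Notation leb := (@lebesgue_measure R).
Notation pow := (power_measure leb).

Definition upd N (l : N.-tuple mR) (i : 'I_N) (x : mR) : N.-tuple mR :=
  [tuple if j == i then x else tnth l j | j < N].

Lemma tnth_upd N (l : N.-tuple mR) i x j :
  tnth (upd l i x) j = if j == i then x else tnth l j.
Proof. by rewrite tnth_mktuple. Qed.

Lemma upd_cons0 N (x0 x : mR) (l : N.-tuple mR) :
  upd (cons_pair (x0, l)) ord0 x = cons_pair (x, l).
Proof.
apply: eq_from_tnth => j; rewrite tnth_upd; case: (unliftP ord0 j) => [k|] ->.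
  by rewrite eq_sym (negbTE (neq_lift _ _)) !tnthS.
by rewrite eqxx tnth0.
Qed.

Lemma upd_consS N (x0 x : mR) (l : N.-tuple mR) i :
  upd (cons_pair (x0, l)) (lift ord0 i) x = cons_pair (x0, upd l i x).
Proof.
apply: eq_from_tnth => j; rewrite tnth_upd; case: (unliftP ord0 j) => [k|] ->.
  by rewrite !tnthS tnth_upd (inj_eq (@lift_inj _ _)).
by rewrite (negbTE (neq_lift _ _)) !tnth0.
Qed.

Lemma measurable_upd N (l : N.-tuple mR) i :
  measurable_fun [set: mR] (upd l i).
Proof.
apply/measurable_fun_tnthP => j.
have -> : tnth (T:=mR) ^~ j \o upd l i = fun x => if j == i then x else tnth l j.
  by apply/funext => x /=; rewrite tnth_upd.
by case: (j == i); [exact: measurable_id|exact: measurable_cst].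
Qed.

Lemma measurable_cons_l N (x : mR) :
  measurable_fun [set: N.-tuple mR] (fun l => cons_pair (x, l)).
Proof. by apply: measurable_cons; [exact: measurable_cst|exact: measurable_id]. Qed.

Lemma measurable_cons_r N (l : N.-tuple mR) :
  measurable_fun [set: mR] (fun x => cons_pair (x, l)).
Proof. by apply: measurable_cons; [exact: measurable_id|exact: measurable_cst]. Qed.

Lemma integral_pow0 (F : 0.-tuple mR -> \bar R) :
  \int[pow 0%N]_l F l = F [tuple].
Proof.
rewrite (_ : F = cst (F [tuple])); last first.
  by apply/funext => l; rewrite tuple0.
rewrite [LHS]integral_dirac//. by rewrite diracT mul1e.
Qed.

Section step.
Variables (N : nat) (F : N.+1.-tuple mR -> \bar R).
Hypotheses (mF : measurable_fun [set: N.+1.-tuple mR] F) (F0 : forall l, 0 <= F l).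

Let mFc : measurable_fun [set: mR * N.-tuple mR] (F \o @cons_pair _ mR N).
Proof. by apply: measurableT_comp => //; exact: measurable_cons_pair. Qed.

Let powS : \int[pow N.+1]_l F l = \int[leb \x pow N]_z F (cons_pair z).
Proof.
rewrite [LHS](@ge0_integral_pushforward _ _ _ _ _ _ (@measurable_cons_pair _ mR N))//.
Qed.

Lemma integral_powSl : \int[pow N.+1]_l F l = \int[pow N]_l \int[leb]_x F (cons_pair (x, l)).
Proof. rewrite powS. by have /= := @fubini_tonelli2 _ _ _ _ _ leb (pow N) _ mFc (fun z => F0 _). Qed.

Lemma integral_powSr : \int[pow N.+1]_l F l = \int[leb]_x \int[pow N]_l F (cons_pair (x, l)).
Proof. rewrite powS. by have /= := @fubini_tonelli1 _ _ _ _ _ leb (pow N) _ mFc (fun z => F0 _). Qed.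

Lemma measurable_powSl :
  measurable_fun [set: N.-tuple mR] (fun l => \int[leb]_x F (cons_pair (x, l))).
Proof. exact: (@measurable_fun_fubini_tonelli_G _ _ _ _ _ leb _ mFc (fun z => F0 _)). Qed.

Lemma measurable_powSr :
  measurable_fun [set: mR] (fun x => \int[pow N]_l F (cons_pair (x, l))).
Proof. exact: (@measurable_fun_fubini_tonelli_F _ _ _ _ _ (pow N) _ mFc (fun z => F0 _)). Qed.

End step.

(** By Tonelli, comparing the integrals in one coordinate with the others frozen is enough. The
    induction peels off coordinate 0 until it is the chosen one. All the one-particle arguments on
    the ensemble go through this lemma. *)
Lemma le_integral_coord N (i : 'I_N) (F G : N.-tuple mR -> \bar R) :
  measurable_fun [set: N.-tuple mR] F -> measurable_fun [set: N.-tuple mR] G ->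
  (forall l, 0 <= F l) -> (forall l, 0 <= G l) ->
  (forall l, \int[leb]_x F (upd l i x) <= \int[leb]_x G (upd l i x)) ->
  \int[pow N]_l F l <= \int[pow N]_l G l.
Proof.
elim: N i F G => [[]//|N IH] i F G mF mG F0 G0 FG.
case: (unliftP ord0 i) => [k|] ik.
- rewrite !integral_powSr//; apply: ge0_le_integral => //.
  + by move=> x _; exact: integral_ge0.
  + exact: measurable_powSr.
  + exact: measurable_powSr.
  move=> x _; apply: (IH k) => //.
  + by apply: measurableT_comp => //; exact: measurable_cons_l.
  + by apply: measurableT_comp => //; exact: measurable_cons_l.
  move=> l; have := FG (cons_pair (x, l)).
  rewrite ik; under eq_integral do rewrite upd_consS.
  by under [in leRHS]eq_integral do rewrite upd_consS.
- rewrite !integral_powSl//; apply: ge0_le_integral => //.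
  + by move=> x _; exact: integral_ge0.
  + exact: measurable_powSl.
  + exact: measurable_powSl.
  move=> l _; have := FG (cons_pair (0%R : mR, l)).
  rewrite ik; under eq_integral do rewrite upd_cons0.
  by under [in leRHS]eq_integral do rewrite upd_cons0.
Qed.

Lemma integral_pow_prod N (h : mR -> R) : measurable_fun [set: mR] h ->
  (forall x, (0 <= h x)%R) ->
  \int[pow N]_l (\prod_(i < N) h (tnth l i))%:E = (\int[leb]_x (h x)%:E) ^+ N.
Proof.
move=> mh h0; elim: N => [|N IH].
  by rewrite integral_pow0 big_ord0.
have mp n : measurable_fun [set: n.-tuple mR] (fun l : n.-tuple mR => (\prod_(i < n) h (tnth l i))%:E).
  apply/measurable_EFinP; apply: measurable_prod => i _.
  by apply: measurableT_comp => //; exact: measurable_tnth.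
rewrite (integral_powSr (mp _)); last by move=> l; rewrite lee_fin prodr_ge0.
have E x : \int[pow N]_l (\prod_(i < N.+1) h (tnth (cons_pair (x, l)) i))%:E =
    (h x)%:E * (\int[leb]_x (h x)%:E) ^+ N.
  rewrite -IH -ge0_integralZl//; last 3 first.
  - exact: mp.
  - by move=> l _; rewrite lee_fin prodr_ge0.
  - by rewrite lee_fin.
  apply: eq_integral => l _; rewrite big_ord_recl tnth0 EFinM.
  by under eq_bigr do rewrite tnthS.
transitivity (\int[leb]_x ((h x)%:E * (\int[leb]_x (h x)%:E) ^+ N)).
  by apply: eq_integral => x _; exact: E.
rewrite ge0_integralZr// ?expeS//.
- by apply/measurable_EFinP.
- by move=> x _; rewrite lee_fin.
- by apply: expe_ge0; apply: integral_ge0 => x _; rewrite lee_fin.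
Qed.

End TupleIntegral.

(** * The nonnegative logarithmic kernel and its averages over short intervals *)

Section LogKernel.
Context {R : realType}.
Local Open Scope ereal_scope.
Notation mR := (measurableTypeR R).
Notation leb := (@lebesgue_measure R).
Implicit Types x y : R.

Lemma integral_uniform_cst (e : R) (e0 : (0 < e)%R) (c : \bar R) :
  \int[uniform_prob e0]_s c = c.
Proof.
rewrite -[RHS]mule1 -(@probability_setT _ _ _ (uniform_prob e0)).
exact: integral_cst.
Qed.

(** The share of the growth of log|x - y| charged to each variable, as |x - y| <= (1 + |x|)(1 +
    |y|). *)
Definition clog x : R := ln (1 + `|x|)%R.

Lemma clog_ge0 x : (0 <= clog x)%R.
Proof. by rewrite ln_ge0// lerDl. Qed.

Lemma clog_le_norm x : (clog x <= `|x|)%R.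
Proof. by apply: le_ln1Dx; rewrite (lt_le_trans _ (normr_ge0 x))// ltrN10. Qed.

Lemma expR_clog x : expR (clog x) = (1 + `|x|)%R.
Proof. by rewrite lnK// posrE ltr_pwDl. Qed.

Lemma measurable_clog : measurable_fun [set: mR] (clog : mR -> R).
Proof.
apply: (measurableT_comp (@measurable_ln R)).
by apply: measurable_funD => //; exact: normr_measurable.
Qed.

Lemma le_clogD x s : (0 <= s)%R -> (clog (x + s) <= clog x + s)%R.
Proof.
move=> s0; rewrite -ler_expR expRD !expR_clog.
have := expR_ge1Dx s; have := normr_ge0 x => x0 es.
apply: (@le_trans _ _ ((1 + `|x|) * (1 + s))%R); last by rewrite ler_wpM2l// addr_ge0.
have := ler_normD x s; rewrite (ger0_norm s0); nra.
Qed.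

(* [log(1+|x|) + log(1+|y|) - log|x-y|], which is nonnegative: all the energies
   below are then integrals of nonnegative functions. *)
Definition Lk x y : \bar R :=
  if x == y then +oo else (clog x + clog y - ln `|x - y|)%:E.

Lemma LkC x y : Lk x y = Lk y x.
Proof. by rewrite /Lk eq_sym distrC [(clog x + _)%R]addrC. Qed.

Lemma norm_sub_le_clog x y : (`|x - y| <= expR (clog x + clog y))%R.
Proof.
rewrite expRD !expR_clog.
have := ler_normB x y; have := normr_ge0 x; have := normr_ge0 y; nra.
Qed.

Lemma Lk_ge0 x y : 0 <= Lk x y.
Proof.
rewrite /Lk; case: eqVneq => // xy; rewrite lee_fin subr_ge0.
rewrite -ler_expR lnK ?norm_sub_le_clog//.
by rewrite posrE normr_gt0 subr_eq0.
Qed.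

Lemma Lk_ge x y (e : R) : (0 < e)%R -> (`|x - y| <= e)%R ->
  (clog x + clog y - ln e)%:E <= Lk x y.
Proof.
move=> e0 xye; rewrite /Lk; case: eqVneq => [//|xy]; first by rewrite leey.
rewrite lee_fin lerD2l lerN2 ler_ln ?posrE//.
by rewrite normr_gt0 subr_eq0.
Qed.

Lemma measurable_Lk : measurable_fun [set: mR * mR] (fun z : mR * mR => Lk z.1 z.2).
Proof.
apply: measurable_fun_ifT => //=.
  by apply: (@measurable_fun_eqr _ (mR * mR)%type R).
apply/measurable_EFinP.
apply: measurable_funB.
  apply: measurable_funD.
    exact: (measurableT_comp measurable_clog measurable_fst).
  exact: (measurableT_comp measurable_clog measurable_snd).
apply: (measurableT_comp (@measurable_ln R)).
apply: (measurableT_comp (@normr_measurable R setT)).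
by apply: measurable_funB.
Qed.

Lemma measurable_Lk_comp d (T : measurableType d) (f g : T -> mR) :
  measurable_fun [set: T] f -> measurable_fun [set: T] g ->
  measurable_fun [set: T] (fun t => Lk (f t) (g t)).
Proof.
move=> mf mg.
have mfg : measurable_fun [set: T] (fun t => (f t, g t) : mR * mR).
  by apply/measurable_fun_pairP.
exact: (measurableT_comp measurable_Lk mfg).
Qed.

(** On the diagonal [Lk] is infinite and [expeR] of its opposite is 0, which is also the value of |x
    - y|^b there because b > 0. *)
Lemma powR_Lk (b : R) x y : (0 < b)%R ->
  (`|x - y| `^ b)%:E = (expR (b * (clog x + clog y)))%:E * expeR (- (b%:E * Lk x y)).
Proof.
move=> b0; rewrite /Lk; case: eqVneq => [->|xy].
  by rewrite subrr normr0 powR0 ?gt_eqF// gt0_muley ?lte_fin//= mule0.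
have xy0 : (0 < `|x - y|)%R by rewrite normr_gt0 subr_eq0.
rewrite /= -EFinM -expRD /powR gt_eqF//; congr (expR _)%:E; ring.
Qed.

Lemma powR_le_clog (b : R) x y : (0 < b)%R ->
  (`|x - y| `^ b <= expR (b * (clog x + clog y)))%R.
Proof.
move=> b0; rewrite mulrC expRM.
apply: ge0_ler_powR (norm_sub_le_clog x y); rewrite ?nnegrE ?expR_ge0//.
exact: ltW.
Qed.

Lemma le_integral_uniform (e : R) (e0 : (0 < e)%R) (f g : mR -> \bar R) :
  measurable_fun [set: mR] f -> measurable_fun [set: mR] g ->
  (forall s, 0 <= f s) -> (forall s, 0 <= g s) ->
  (forall s, (0 <= s <= e)%R -> f s <= g s) ->
  \int[uniform_prob e0]_s f s <= \int[uniform_prob e0]_s g s.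
Proof.
move=> mf mg f0 g0 fg; rewrite !integral_uniform//.
apply: lee_wpmul2l; first by rewrite lee_fin invr_ge0 subr0 ltW.
apply: ge0_le_integral => //; do ?exact: measurable_funTS.
Qed.

Section dyadic.
Variables (e c : R) (e0 : (0 < e)%R).

(** Counts the intervals of centre c and radii e 2^(-k) that contain s. It dominates log(e / |s -
    c|), with value +oo at c, and its integral is a geometric series of sum 4 e: this is how the
    logarithmic singularity gets integrated. *)
Definition dyadic_count (s : mR) : \bar R :=
  \sum_(0 <= k <oo)
    (\1_(`](c - e * 2^-1 ^+ k)%R, (c + e * 2^-1 ^+ k)%R[%classic : set mR) s)%:E.

Lemma dyadic_count_ge0 s : 0 <= dyadic_count s.
Proof. by apply: nneseries_ge0 => k _ _; rewrite lee_fin. Qed.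

Lemma measurable_dyadic_count : measurable_fun [set: mR] dyadic_count.
Proof.
apply: ge0_emeasurable_sum => [k s _ _|k _]; first by rewrite lee_fin.
by apply/measurable_EFinP.
Qed.

Lemma integral_dyadic_count : \int[leb]_s dyadic_count s = (4 * e)%:E.
Proof.
rewrite integral_nneseries//; last by move=> k; exact/measurable_EFinP.
transitivity (\sum_(0 <= k <oo) ((4 * e) / (2 ^ (k + 1))%:R)%:E); last first.
  apply/cvg_lim => //; have := @cvg_geometric_eseries_half R (4 * e)%R 0.
  by rewrite expr0 divr1.
apply: eq_eseriesr => k _; rewrite integral_indic// setIT.
have ek : (0 < e * 2^-1 ^+ k)%R by rewrite mulr_gt0// exprn_gt0.
etransitivity; first exact: lebesgue_measure_itv.
rewrite /= lte_fin ltrD2l gtrN//; rewrite -EFinB; congr (_%:E).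
rewrite natrX exprD invfM exprVn expr1; field.
by rewrite expf_neq0.
Qed.

Lemma le_dyadic_count s (n : nat) :
  (forall k, (k < n)%N -> (`|s - c| < e * 2^-1 ^+ k)%R) ->
  n%:R%:E <= dyadic_count s.
Proof.
move=> H.
apply: (@le_trans _ _ (\sum_(0 <= k < n) (1 : \bar R))).
  by rewrite sumEFin lee_fin sumr_const_nat subn0.
apply: (@le_trans _ _ (\sum_(0 <= k < n)
    (\1_(`](c - e * 2^-1 ^+ k)%R, (c + e * 2^-1 ^+ k)%R[%classic : set mR) s)%:E)).
  rewrite big_nat [leRHS]big_nat; apply: lee_sum => k kn.
  by rewrite indicE mem_set//= in_itv/= -ltr_distl; exact: H.
by apply: nneseries_lim_ge => k _ _; rewrite lee_fin.
Qed.

(** Let n be the least index with e 2^(-n) <= |s - c|. The first n intervals contain s, and e / |s -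
    c| <= 2^n <= exp(n). *)
Lemma ln_le_dyadic_count s : s != c -> (ln e - ln `|s - c|)%:E <= dyadic_count s.
Proof.
move=> sc; have nt0 : (0 < `|s - c|)%R by rewrite normr_gt0 subr_eq0.
have [n0 n0P] : exists n, (e * 2^-1 ^+ n <= `|s - c|)%R.
  have : (fun n => 2^-1 ^+ n : R)%R @ \oo --> (0 : R)%R.
    by apply: cvg_expr; rewrite ger0_norm ?invr_ge0// invf_lt1// ltr1n.
  move/cvgr0Pnorm_lt => /(_ (`|s - c| / e)%R); rewrite divr_gt0// => /(_ isT).
  move=> [n _ /(_ n (leqnn n))] H.
  exists n; rewrite mulrC -ler_pdivlMr//; apply: le_trans (ltW H).
  exact: ler_norm.
case: (ex_minnP (ex_intro (fun n => e * 2^-1 ^+ n <= `|s - c|)%R n0 n0P)) => n nP nmin.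
apply: le_trans (@le_dyadic_count _ n _); last first.
  by move=> k kn; rewrite ltNge; apply/negP => /nmin; rewrite leqNgt kn.
rewrite lee_fin lerBlDr -lerBlDl -ler_expR lnK ?posrE//; apply: le_trans nP.
rewrite expRD lnK ?posrE// ler_pM2l//.
have -> : (expR (- n%:R) = (expR (- 1)) ^+ n :> R)%R.
  by rewrite -expRM_natl mulrN mulr1.
apply: lerXn2r; rewrite ?nnegrE ?expR_ge0 ?invr_ge0//.
rewrite expRN lef_pV2 ?posrE ?expR_gt0//.
by have := expR_ge1Dx (1 : R); lra.
Qed.

Lemma dyadic_count_center : dyadic_count c = +oo.
Proof.
apply/eqyP => A A0.
have [n An] : exists n : nat, (A <= n%:R)%R.
  by exists (Num.bound `|A|%R); apply: ltW (le_lt_trans (ler_norm A) (archi_boundP _)).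
apply: (le_trans (y := n%:R%:E)); first by rewrite lee_fin.
by apply: le_dyadic_count => k _; rewrite subrr normr0 mulr_gt0// exprn_gt0.
Qed.

End dyadic.

(* [C1 - C2 log e] bounds the average of the kernel over intervals of length e. *)
Lemma uniform_Lk_near (e : R) (e0 : (0 < e)%R) x y : (e <= 1)%R ->
  \int[uniform_prob e0]_s Lk (x + s)%R y <= (clog x + clog y + e + 4 - ln e)%:E.
Proof.
move=> e1.
have lne0 : (ln e <= 0)%R by exact: ln_le0.
have mL : measurable_fun [set: mR] (fun s : mR => Lk (x + s)%R y).
  by apply: measurable_Lk_comp => //; exact: measurable_shift.
have K0 : (0 <= clog x + clog y + e - ln e)%R.
  by rewrite subr_ge0 (le_trans lne0)// !addr_ge0 ?clog_ge0// ltW.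
have mD := @measurable_dyadic_count e (y - x).
apply: (@le_trans _ _ (\int[uniform_prob e0]_s
    ((clog x + clog y + e - ln e)%:E + dyadic_count e (y - x) s))).
  apply: le_integral_uniform => //.
  - by apply: emeasurable_funD => //; exact: measurable_cst.
  - by move=> s; exact: Lk_ge0.
  - by move=> s; rewrite adde_ge0 ?lee_fin// dyadic_count_ge0.
  move=> s /andP[s0 se].
  have [->|sxy] := eqVneq s (y - x)%R.
    by rewrite dyadic_count_center// addey ?leey.
  rewrite /Lk; case: eqVneq => [xsy|_].
    by move: sxy; rewrite -xsy addrAC subrr add0r eqxx.
  apply: le_trans (leeD2l _ (ln_le_dyadic_count e0 sxy)).
  rewrite -EFinD lee_fin.
  have -> : (s - (y - x) = x + s - y)%R by ring.
  by have := le_clogD x s0; lra.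
rewrite ge0_integralD//; try by move=> s _; exact: dyadic_count_ge0.
rewrite integral_uniform_cst.
rewrite (_ : (clog x + clog y + e + 4 - ln e)%R = (clog x + clog y + e - ln e + 4)%R); last by ring.
rewrite [leRHS]EFinD; apply: leeD2l.
rewrite integral_uniform//; last by move=> s; exact: dyadic_count_ge0.
rewrite subr0 lee_pdivrMl// -EFinM [(e * 4)%R]mulrC -(integral_dyadic_count (y - x) e0).
apply: ge0_subset_integral => //.
by move=> s _; exact: dyadic_count_ge0.
Qed.

(** A shift of x by at most |x - y| / M lowers log|x - y| by at most 2 / M, because 1 - 1/M >=
    exp(-2/M) when M >= 2. The term e is the change of [clog]. *)
Lemma uniform_Lk_far (e M : R) (e0 : (0 < e)%R) x y :
  (2 <= M)%R -> (M * e <= `|x - y|)%R ->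
  \int[uniform_prob e0]_s Lk (x + s)%R y <=
    (clog x + clog y - ln `|x - y| + e + 2 / M)%:E.
Proof.
move=> M2 Mxy.
have M0 : (0 < M)%R by lra.
have xy0 : (0 < `|x - y|)%R by apply: lt_le_trans Mxy; rewrite mulr_gt0.
have mL : measurable_fun [set: mR] (fun s : mR => Lk (x + s)%R y).
  by apply: measurable_Lk_comp => //; exact: measurable_shift.
have K s : (0 <= s <= e)%R -> Lk (x + s)%R y <=
    (clog x + clog y - ln `|x - y| + e + 2 / M)%:E.
  move=> /andP[s0 se].
  have h : (`|x - y| * expR (- (2 / M)) <= `|x + s - y|)%R.
    apply: (@le_trans _ _ (`|x - y| * (1 - M^-1))%R).
      have v0 : (0 < M^-1)%R by rewrite invr_gt0.
      have v1 : (M^-1 <= 2^-1)%R by rewrite lef_pV2 ?posrE.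
      have v2 : (0 < 1 - M^-1)%R by move: (M^-1)%R v0 v1 => v v0 v1; lra.
      apply: ler_wpM2l => //; rewrite expRN -[leRHS]invrK lef_pV2 ?posrE ?expR_gt0 ?invr_gt0//.
      apply: le_trans (expR_ge1Dx _).
      rewrite -[leLHS]mul1r ler_pdivrMr//.
      by move: (M^-1)%R v0 v1 {v2} => v v0 v1; nra.
    rewrite mulrBr mulr1.
    have : (e <= `|x - y| * M^-1)%R by rewrite ler_pdivlMr// mulrC.
    have -> : (x + s - y = (x - y) + s)%R by ring.
    have := ler_normB (x - y + s)%R s.
    have -> : (x - y + s - s = x - y)%R by ring.
    by rewrite (ger0_norm s0); lra.
  have h0 : (0 < `|x + s - y|)%R.
    by apply: lt_le_trans h; rewrite mulr_gt0 ?expR_gt0.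
  rewrite /Lk; case: eqVneq => [xsy|_].
    by move: h0; rewrite xsy subrr normr0 ltxx.
  rewrite lee_fin.
  have : (ln `|x - y| - 2 / M <= ln `|x + s - y|)%R.
    rewrite -ler_expR lnK ?posrE// expRD lnK ?posrE//.
  by have := le_clogD x s0; lra.
have K0 : 0 <= (clog x + clog y - ln `|x - y| + e + 2 / M)%:E.
  by apply: le_trans (K 0%R _); [exact: Lk_ge0|rewrite lexx ltW].
rewrite -[leRHS](integral_uniform_cst e0).
apply: le_integral_uniform => //.
by move=> s; exact: Lk_ge0.
Qed.

(** Averaging costs O(1) only within distance M e of y. The indicator is meant to be integrated
    against sigma, which gives little mass to short intervals. *)
Lemma uniform_Lk (e M : R) (e0 : (0 < e)%R) x y : (e <= 1)%R -> (2 <= M)%R ->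
  \int[uniform_prob e0]_s Lk (x + s)%R y <=
  Lk x y + (e + 2 / M + (4 + ln M) * \1_[set z | (`|z - y| < M * e)%R] x)%:E.
Proof.
move=> e1 M2.
have M0 : (0 < M)%R by lra.
have lnM0 : (0 <= ln M)%R by rewrite ln_ge0//; lra.
have [xy|xy] := ltP `|x - y|%R (M * e)%R.
  rewrite indicE mem_set//= mulr1.
  apply: le_trans (uniform_Lk_near _ _ _ e1) _.
  apply: le_trans (leeD2r _ (Lk_ge _ (ltW xy))); last by rewrite mulr_gt0.
  rewrite -EFinD lee_fin lnM ?posrE//.
  have : (0 <= 2 / M)%R by rewrite divr_ge0// ltW.
  by lra.
rewrite indicE memNset/= ?mulr0 ?addr0; last by rewrite ltNge xy.
apply: le_trans (uniform_Lk_far _ M2 xy) _.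
have xy0 : (0 < `|x - y|)%R by apply: lt_le_trans xy; rewrite mulr_gt0.
rewrite /Lk; case: eqVneq => [xsy|_].
  by move: xy0; rewrite xsy subrr normr0 ltxx.
by rewrite -EFinD lee_fin addrA.
Qed.

(** The growth of log|s - y| in y is compensated by [clog y], so the uniform law on [0, 1] has a
    bounded potential and is a convenient competitor of sigma. The constant is 2 + 1 + 4, reached in
    the case |y| < 2. *)
Lemma uniform01_Lk (y : R) : \int[uniform_prob (@ltr01 R)]_s Lk s y <= 7%:E.
Proof.
rewrite (eq_integral (fun s : mR => Lk (0 + s)%R y)); last by move=> s _; rewrite add0r.
have clog0 : clog 0 = 0%R by rewrite /clog normr0 addr0 ln1.
have [y2|y2] := ltP `|y|%R 2%R.
  apply: le_trans (uniform_Lk_near _ _ _ _) _ => //.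
  rewrite clog0 ln1 lee_fin; have := clog_le_norm y; lra.
apply: le_trans (uniform_Lk_far (M := 2%R) _ _ _) _ => //.
  by rewrite mulr1 sub0r normrN.
rewrite clog0 sub0r normrN lee_fin divff// add0r.
have : (clog y - ln `|y| <= 1)%R; last by lra.
rewrite /clog -ln_div ?posrE; [|lra..].
by rewrite -ler_expR lnK ?posrE ?divr_gt0 ?ler_pdivrMr; have := expR_ge1Dx (1 : R); nra.
Qed.

End LogKernel.

(** * The energy in terms of the nonnegative kernel *)

Lemma integral_probability_cst d (T : measurableType d) (R : realType)
  (P : probability T R) (c : \bar R) : (\int[P]_x c = c)%E.
Proof.
rewrite -[RHS]mule1 -(@probability_setT _ _ _ P).
exact: integral_cst.
Qed.

Section IntegralSub.
Context d (T : measurableType d) {R : realType} (m : {measure set T -> \bar R}).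
Local Open Scope ereal_scope.

(** Integrability of h alone makes the subtraction legitimate, even where f or its integral is +oo:
    the negative part of f - h is at most h. *)
Lemma ge0_integralB_fin (f h : T -> \bar R) :
  measurable_fun [set: T] f -> measurable_fun [set: T] h ->
  (forall x, 0 <= f x) -> (forall x, 0 <= h x) -> (forall x, h x \is a fin_num) ->
  \int[m]_x h x < +oo ->
  \int[m]_x (f x - h x) = \int[m]_x f x - \int[m]_x h x /\
  \int[m]_x (- (f x - h x)) = - (\int[m]_x f x - \int[m]_x h x).
Proof.
move=> mf mh f0 h0 hfin hoo.
have mB : measurable_fun [set: T] (fun x => f x - h x) by exact: emeasurable_funB.
have neg_le : \int[m]_x (fun x => f x - h x)^\- x <= \int[m]_x h x.
  apply: ge0_le_integral => //.
  - exact: measurable_funeneg.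
  - move=> x _; rewrite funenegE ge_max h0 andbT.
  move: (f0 x) (h0 x) (hfin x).
  case: (f x) => [r| |] //; case: (h x) => [s| |] //.
    by rewrite -EFinB -EFinN !lee_fin; lra.
  by rewrite addye//= leNye.
have neg_fin : \int[m]_x (fun x => f x - h x)^\- x \is a fin_num.
  rewrite ge0_fin_numE; first exact: le_lt_trans neg_le hoo.
  by apply: integral_ge0 => *; exact: funeneg_ge0.
have hint : \int[m]_x h x \is a fin_num.
  by rewrite ge0_fin_numE//; exact: integral_ge0.
have key : \int[m]_x (f x - h x) = \int[m]_x f x - \int[m]_x h x.
  have E : \int[m]_x (fun x => f x - h x)^\+ x + \int[m]_x h x =
      \int[m]_x f x + \int[m]_x (fun x => f x - h x)^\- x.
    rewrite -!ge0_integralD//; [|exact: measurable_funeneg|exact: measurable_funepos].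
    apply: eq_integral => x _; rewrite funeposE funenegE.
    move: (f0 x) (h0 x) (hfin x).
    case: (f x) => [r| |] //; case: (h x) => [s| |] // r0 s0 _.
      rewrite -!EFinB -!EFin_max -!EFinD; congr (_%:E).
      by rewrite /Num.max; case: ifPn; case: ifPn; lra.
    by rewrite /= !maxye ?addye//= maxNye.
  rewrite integralE; move: E neg_fin hint.
  case: (\int[m]_x h x) => [s| |] //; case: (\int[m]_x _^\- x) => [t| |] //.
  have : 0 <= \int[m]_x (fun x => f x - h x)^\+ x by apply: integral_ge0.
  have : 0 <= \int[m]_x f x by apply: integral_ge0.
  case: (\int[m]_x _^\+ x) => [u| |] //; case: (\int[m]_x f x) => [v| |] //.
  by move=> _ _ [E] _ _; congr (_%:E); lra.
split => //; rewrite -key integralN// fin_num_adde_defl//.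
by rewrite fin_numN.
Qed.

End IntegralSub.

Section Energy.
Context {R : realType}.
Local Open Scope ereal_scope.
Notation mR := (measurableTypeR R).
Notation leb := (@lebesgue_measure R).
Variables (beta : R) (Vt : R -> R).
Hypotheses (beta0 : (0 < beta)%R) (mVt : measurable_fun [set: mR] (Vt : mR -> R)).
Hypothesis (Vt0 : forall x, (0 <= Vt x)%R).
Hypothesis growth : forall C : R, exists K : R, (0 < K)%R /\
  forall x, (K <= `|x|)%R -> (C * (1 + `|x|) <= Vt x)%R.

(** The energy up to an additive constant: the two [clog] of the kernel, with weight beta / 2, make
    up for the term beta [clog] taken out of the potential. *)
Definition eng (mu : probability mR R) : \bar R :=
  \int[mu]_x (Vt x)%:E + (beta / 2)%:E * \int[mu \x mu]_z Lk z.1 z.2.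

Lemma eng_ge0 mu : 0 <= eng mu.
Proof.
apply: adde_ge0; first by apply: integral_ge0 => x _; rewrite lee_fin.
apply: mule_ge0; first by rewrite lee_fin divr_ge0// ltW.
by apply: integral_ge0 => z _; exact: Lk_ge0.
Qed.

Lemma clog_le_Vt : exists C : R, forall x, (clog x <= Vt x + C)%R.
Proof.
have [K [K0 HK]] := growth 1; exists K => x.
have := clog_le_norm x; have := Vt0 x.
by have [|] := leP K `|x|%R; [move/HK|]; lra.
Qed.

(** The integral of beta [clog] equals (beta / 2) times the double integral of clog x + clog y. If
    [Vt] has an infinite integral, both sides are +oo. Otherwise [clog], dominated by [Vt] plus a
    constant, is integrable, and infinity minus infinity does not occur. *)
Lemma energyE (V : R -> R) (c1 : R) (mu : probability mR R) : (0 <= c1)%R ->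
  (forall x, V x = Vt x + beta * clog x - c1)%R ->
  energy V beta mu = eng mu - c1%:E.
Proof.
move=> c10 VE.
have mcl := @measurable_clog R.
pose P := \int[mu]_x (Vt x)%:E; pose C := \int[mu]_x (clog x)%:E.
have P0 : 0 <= P by apply: integral_ge0 => x _; rewrite lee_fin.
have C0 : 0 <= C by apply: integral_ge0 => x _; rewrite lee_fin clog_ge0.
have cst1 (c : R) : \int[mu]_x c%:E = c%:E.
  exact: integral_probability_cst.
have VPC : \int[mu]_x (V x)%:E = P + beta%:E * C - c1%:E.
  have -> : \int[mu]_x (V x)%:E = \int[mu]_x ((Vt x + beta * clog x)%:E - c1%:E).
    by apply: eq_integral => x _; rewrite VE.
  have mf1 : measurable_fun [set: mR] (fun x => (Vt x + beta * clog x)%:E).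
    by apply/measurable_EFinP/measurable_funD => //; exact: measurable_funM.
  have f10 x : 0 <= (Vt x + beta * clog x)%:E.
    by rewrite lee_fin addr_ge0// mulr_ge0 ?clog_ge0// ltW.
  have c1oo : \int[mu]_x c1%:E < +oo by rewrite cst1 ltry.
  have [-> _] := ge0_integralB_fin mf1 (measurable_cst c1%:E) f10 (fun=> c10) (fun=> isT) c1oo.
  rewrite cst1; congr (_ - _).
  rewrite -ge0_integralZl_EFin ?ltW//; last 2 first.
  - by move=> x _; rewrite lee_fin clog_ge0.
  - exact/measurable_EFinP.
  rewrite -ge0_integralD//.
  - by move=> x _; rewrite lee_fin.
  - exact/measurable_EFinP.
  - by move=> x _; rewrite lee_fin mulr_ge0 ?clog_ge0// ltW.
  - by apply: measurable_funeM; exact/measurable_EFinP.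
have CP : C < +oo \/ P = +oo.
  have [D DP] := clog_le_Vt.
  have [|] := ltP P +oo; last by rewrite leye_eq => /eqP; right.
  move=> Poo; left.
  have : C <= P + `|D|%:E.
    rewrite -cst1 -ge0_integralD//; last 2 first.
    - by move=> x _; rewrite lee_fin.
    - exact/measurable_EFinP.
    apply: ge0_le_integral => //.
    - by move=> x _; rewrite lee_fin clog_ge0.
    - exact/measurable_EFinP.
    - by apply/measurable_EFinP/measurable_funD.
    - by move=> x _; rewrite lee_fin (le_trans (DP x))// lerD2l ler_norm.
  by move=> /le_lt_trans; apply; rewrite lte_add_pinfty// ltry.
have I0 : 0 <= \int[mu \x mu]_z Lk z.1 z.2.
  by apply: integral_ge0 => z _; exact: Lk_ge0.
rewrite /energy VPC /eng -/P.
have [Poo|] := eqVneq P +oo.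
  rewrite Poo addye; last by rewrite gt_eqF// (lt_le_trans ltNy0)// mule_ge0// lee_fin ltW.
  rewrite addye// eqxx addye// gt_eqF// (lt_le_trans ltNy0)// mule_ge0//.
  by rewrite lee_fin divr_ge0// ltW.
move=> Pfin; case: CP => [Cfin|/eqP]; last by rewrite (negbTE Pfin).
have Cf : C \is a fin_num by rewrite ge0_fin_numE.
have Pf : P \is a fin_num by rewrite ge0_fin_numE// ltey.
have -> : (P + beta%:E * C - c1%:E == +oo) = false.
  by rewrite -(fineK Cf) -(fineK Pf).
have mc1 : measurable_fun [set: mR * mR] (fun z : mR * mR => (clog z.1)%:E).
  by apply/measurable_EFinP; exact: (measurableT_comp mcl measurable_fst).
have mc2 : measurable_fun [set: mR * mR] (fun z : mR * mR => (clog z.2)%:E).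
  by apply/measurable_EFinP; exact: (measurableT_comp mcl measurable_snd).
have cc0 (z : mR * mR) : 0 <= (clog z.1 + clog z.2)%:E.
  by rewrite lee_fin addr_ge0 ?clog_ge0.
have hE : \int[mu \x mu]_z (clog z.1 + clog z.2)%:E = C + C.
  under eq_integral do rewrite EFinD.
  rewrite ge0_integralD//; try by move=> x _; rewrite lee_fin clog_ge0.
  congr (_ + _).
    rewrite (@fubini_tonelli1 _ _ _ _ _ mu mu)//; last by move=> z; rewrite lee_fin clog_ge0.
    by apply: eq_integral => x _; rewrite /fubini_F/= cst1.
  rewrite (@fubini_tonelli2 _ _ _ _ _ mu mu)//; last by move=> z; rewrite lee_fin clog_ge0.
  by apply: eq_integral => x _; rewrite /fubini_G/= cst1.
have mcc : measurable_fun [set: mR * mR] (fun z : mR * mR => (clog z.1 + clog z.2)%:E).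
  by apply/measurable_EFinP/measurable_funD; exact/measurable_EFinP.
have ccoo : \int[mu \x mu]_z (clog z.1 + clog z.2)%:E < +oo.
  by rewrite hE lte_add_pinfty.
have [_ logE] := ge0_integralB_fin (@measurable_Lk R) mcc
  (fun z => Lk_ge0 z.1 z.2) cc0 (fun=> isT) ccoo.
have -> : \int[mu \x mu]_z lne `|z.1 - z.2|%:E =
    - (\int[mu \x mu]_z Lk z.1 z.2 - (C + C)).
  rewrite -hE -logE; apply: eq_integral => -[x y] _ /=.
  rewrite /Lk; case: eqVneq => [->|xy].
    by rewrite subrr normr0 lexx.
  by rewrite leNgt normr_gt0 subr_eq0 xy/=; congr (_%:E); ring.
move: I0; case: (\int[mu \x mu]_z Lk z.1 z.2) => [I| |]// _.
  rewrite -(fineK Cf) -(fineK Pf) -?(EFinM, EFinD, EFinN, EFinB).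
  by rewrite /=; congr (_%:E); lra.
have b20 : 0 < (beta / 2)%:E by rewrite lte_fin divr_gt0.
rewrite -(fineK Cf) -(fineK Pf) addye// (gt0_muley b20) /=.
by rewrite (gt0_muleNy b20).
Qed.

End Energy.

(** * Competitors of the minimiser *)

Section Perturbation.
Context {R : realType}.
Local Open Scope ereal_scope.
Notation mR := (measurableTypeR R).
Notation leb := (@lebesgue_measure R).

Lemma exists_law d (T : measurableType d) (P : probability T R) (X : T -> mR) :
  measurable_fun [set: T] X ->
  exists mu : probability mR R, forall g : mR -> \bar R,
    measurable_fun [set: mR] g -> (forall x, 0 <= g x) ->
    \int[mu]_x g x = \int[P]_t g (X t).
Proof.
move=> mX; pose X' : {mfun T >-> mR} := mfun_Sub (mem_set mX).
by exists (distribution P X') => g mg g0; rewrite ge0_integral_distribution.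
Qed.

Lemma measurable_abs_le (K : R) : measurable ([set x | (`|x| <= K)%R] : set mR).
Proof.
have -> : [set x | (`|x| <= K)%R] = `[(- K)%R, K]%classic.
  by apply/seteqP; split => x /=; rewrite in_itv/= ler_norml.
exact: measurable_itv.
Qed.

(** The mixture (1 - e) sigma + e Unif[y, y + e], realised as the law of a random variable. A single
    uniform variable on [0, 1] is both the coin, compared with e, and, when it falls below e, the
    displacement added to y. *)
Lemma exists_mixture (sigma : probability mR R) (e : R) (e0 : (0 < e)%R) (y : R) :
  (e < 1)%R ->
  exists mu : probability mR R, forall g : mR -> \bar R,
    measurable_fun [set: mR] g -> (forall x, 0 <= g x) ->
    \int[mu]_x g x = e%:E * \int[uniform_prob e0]_s g (y + s)%R +
                     (1 - e)%:E * \int[sigma]_x g x.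
Proof.
move=> e1.
pose X (z : mR * mR) : mR := if (z.2 <= e)%R then (y + z.2)%R else z.1.
have mX : measurable_fun [set: mR * mR] X.
  apply: measurable_fun_ifT.
  - by apply: (@measurable_fun_ler _ (mR * mR)%type R).
  - exact: (measurableT_comp (@measurable_shift R y) measurable_snd).
  - exact: measurable_fst.
have [mu muE] := exists_law (sigma \x uniform_prob (@ltr01 R))%E mX.
exists mu => g mg g0; rewrite muE//.
have mgX : measurable_fun [set: mR * mR] (g \o X) by exact: measurableT_comp.
rewrite (@fubini_tonelli2 _ _ _ _ _ sigma (uniform_prob (@ltr01 R)) _ mgX (fun z => g0 _)).
have mgy : measurable_fun [set: mR] (fun s : mR => g (y + s)%R).
  exact: (measurableT_comp mg (@measurable_shift R y)).
have -> : fubini_G sigma (g \o X) =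
    (fun s : mR => if (s <= e)%R then g (y + s)%R else \int[sigma]_x g x).
  apply/funext => s; rewrite /fubini_G/= /X/=; case: (s <= e)%R => //.
  exact: (integral_probability_cst sigma (g (y + s)%R)).
have S0 : 0 <= \int[sigma]_x g x by exact: integral_ge0.
have mif : measurable_fun [set: mR]
    (fun s : mR => if (s <= e)%R then g (y + s)%R else \int[sigma]_x g x).
  apply: measurable_fun_ifT => //.
  by apply: (@measurable_fun_ler _ mR R).
have if0 (s : mR) : 0 <= if (s <= e)%R then g (y + s)%R else \int[sigma]_x g x.
  by case: ifP.
rewrite !integral_uniform//.
rewrite !subr0 invr1 mul1e.
rewrite muleA -EFinM divff ?gt_eqF// mul1e.
have -> : `[0%R, 1%R]%classic = `[0%R, e]%classic `|` `]e, 1%R]%classic :> set mR.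
  apply/seteqP; split => s /=; rewrite !in_itv/=.
    by move=> /andP[s0 s1]; have [se|se] := leP s e; [left|right]; rewrite ?s0.
  by move=> [/andP[s0 se]|/andP[s0 se]]; apply/andP; split; lra.
rewrite ge0_integral_setU//; last 2 first.
- exact: measurable_funTS.
- apply/disj_setPS => s /=; rewrite !in_itv/= => -[/andP[_ se] /andP[es _]].
  by move: es; rewrite ltNge se.
congr (_ + _).
  by apply: eq_integral => s; rewrite inE/= in_itv/= => /andP[_ ->].
transitivity (\int[leb]_(s in `]e, 1%R]) (\int[sigma]_x g x)).
  by apply: eq_integral => s; rewrite inE/= in_itv/= => /andP[es _]; rewrite leNgt es.
rewrite integral_cst// muleC; congr (_ * _).
etransitivity; first exact: lebesgue_measure_itv.
by rewrite /= lte_fin e1 EFinB.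
Qed.

(** The mass of sigma outside [-K, K] is moved to the uniform law on [0, 1]. *)
Lemma exists_truncation (sigma : probability mR R) (K : R) :
  exists mu : probability mR R, forall g : mR -> \bar R,
    measurable_fun [set: mR] g -> (forall x, 0 <= g x) ->
    \int[mu]_x g x = \int[sigma]_x
      (if (`|x| <= K)%R then g x else \int[uniform_prob (@ltr01 R)]_s g s).
Proof.
pose X (z : mR * mR) : mR := if (`|z.1| <= K)%R then z.1 else z.2.
have mX : measurable_fun [set: mR * mR] X.
  apply: measurable_fun_ifT => //.
  apply: (@measurable_fun_ler _ (mR * mR)%type R) => //.
  exact: (measurableT_comp (@normr_measurable R setT) measurable_fst).
have [mu muE] := exists_law (sigma \x uniform_prob (@ltr01 R))%E mX.
exists mu => g mg g0; rewrite muE//.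
have mgX : measurable_fun [set: mR * mR] (g \o X) by exact: measurableT_comp.
rewrite (@fubini_tonelli1 _ _ _ _ _ sigma (uniform_prob (@ltr01 R)) _ mgX (fun z => g0 _)).
apply: eq_integral => s _; rewrite /fubini_F/= /X/=; case: (`|s| <= K)%R => //.
exact: (integral_probability_cst (uniform_prob (@ltr01 R)) (g s)).
Qed.

End Perturbation.

(** * The equilibrium measure: compact support, first-order condition, no atoms *)

Section Equilibrium.
Context {R : realType}.
Local Open Scope ereal_scope.
Notation mR := (measurableTypeR R).
Notation leb := (@lebesgue_measure R).
Variables (beta : R) (Vt : R -> R).
Hypotheses (beta0 : (0 < beta)%R) (cVt : continuous Vt).
Hypothesis (Vt0 : forall x, (0 <= Vt x)%R).
Hypothesis growth : forall C : R, exists K : R, (0 < K)%R /\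
  forall x, (K <= `|x|)%R -> (C * (1 + `|x|) <= Vt x)%R.

Lemma measurable_cVt : measurable_fun [set: mR] (Vt : mR -> R).
Proof. exact: continuous_measurable_fun. Qed.

Lemma Vt_bounded (K : R) : exists2 M : R, (0 <= M)%R & forall x, (`|x| <= K)%R -> (Vt x <= M)%R.
Proof.
have [K0|K0] := ltP K 0%R.
  by exists 0%R => // x xK; move: (le_lt_trans xK K0); rewrite ltNge normr_ge0.
have [|c _ Hc] := @EVT_max R Vt (- K) K _ (continuous_subspaceT cVt).
  by rewrite ge0_cp.
by exists (Vt c) => // x xK; apply: Hc; rewrite in_itv/= -ler_norml.
Qed.

Section prob.
Variable mu : probability mR R.

Definition pot (x : mR) : \bar R := \int[mu]_y Lk x y.

Lemma pot_ge0 x : 0 <= pot x.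
Proof. by apply: integral_ge0 => y _; exact: Lk_ge0. Qed.

Lemma measurable_pot : measurable_fun [set: mR] pot.
Proof.
exact: (@measurable_fun_fubini_tonelli_F _ _ _ _ _ mu _ (@measurable_Lk R) (fun z => Lk_ge0 z.1 z.2)).
Qed.

Lemma engE : eng beta Vt mu = \int[mu]_x (Vt x)%:E + (beta / 2)%:E * \int[mu]_x pot x.
Proof.
rewrite /eng; congr (_ + _ * _).
exact: (@fubini_tonelli1 _ _ _ _ _ mu mu _ (@measurable_Lk R) (fun z => Lk_ge0 z.1 z.2)).
Qed.

End prob.

Let U01 := uniform_prob (@ltr01 R).

Lemma uniform01_Vt : \int[U01]_s (Vt s)%:E < +oo.
Proof.
have [M M0 MP] := Vt_bounded 1.
apply: (@le_lt_trans _ _ (\int[U01]_s M%:E)).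
  apply: le_integral_uniform => //.
  - by apply/measurable_EFinP; exact: measurable_cVt.
  - by move=> s /andP[s0 s1]; rewrite lee_fin MP// ger0_norm.
by rewrite integral_uniform_cst ltry.
Qed.

Lemma measurable_EVt : measurable_fun [set: mR] (fun x : mR => (Vt x)%:E).
Proof. by apply/measurable_EFinP; exact: measurable_cVt. Qed.

Lemma integral_EVt_ge0 (mu : probability mR R) : 0 <= \int[mu]_x (Vt x)%:E.
Proof. by apply: integral_ge0 => x _; rewrite lee_fin. Qed.

Lemma integral_pot_ge0 (mu : probability mR R) : 0 <= \int[mu]_x pot mu x.
Proof. by apply: integral_ge0 => x _; exact: pot_ge0. Qed.

Variable sigma : probability mR R.
Hypothesis hmin : forall mu : probability mR R, eng beta Vt sigma <= eng beta Vt mu.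

Let b20 : (0 < beta / 2)%R. Proof. by rewrite divr_gt0. Qed.

(** Comparison with the uniform law on [0, 1]. *)
Lemma eng_sigma_fin : eng beta Vt sigma < +oo.
Proof.
apply: le_lt_trans (hmin U01) _; rewrite engE lte_add_pinfty//.
  exact: uniform01_Vt.
rewrite lte_mul_pinfty// ?lee_fin ?ltW//.
apply: (@le_lt_trans _ _ (\int[U01]_x 7%:E)); last by rewrite integral_uniform_cst ltry.
apply: le_integral_uniform => //.
- exact: measurable_pot.
- by move=> s; exact: pot_ge0.
- move=> s _; rewrite /pot (eq_integral (fun y : mR => Lk y s)); last by move=> y _; rewrite LkC.
  exact: uniform01_Lk.
Qed.

Lemma eng_fin : (\int[sigma]_x (Vt x)%:E \is a fin_num) *
  (\int[sigma]_x pot sigma x \is a fin_num).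
Proof.
have := eng_sigma_fin; rewrite engE.
have := integral_EVt_ge0 sigma; have := integral_pot_ge0 sigma.
case: (\int[sigma]_x (Vt x)%:E) => [a| |] //; case: (\int[sigma]_x pot sigma x) => [i| |] //.
  by rewrite gt0_muley ?lte_fin// addey.
by rewrite gt0_muley ?lte_fin.
Qed.

Definition engV : R := fine (\int[sigma]_x (Vt x)%:E).
Definition engI : R := fine (\int[sigma]_x pot sigma x).

Lemma engVE : \int[sigma]_x (Vt x)%:E = engV%:E. Proof. by rewrite fineK// eng_fin. Qed.
Lemma engIE : \int[sigma]_x pot sigma x = engI%:E. Proof. by rewrite fineK// eng_fin. Qed.
Lemma engV_ge0 : (0 <= engV)%R. Proof. exact: fine_ge0 (integral_EVt_ge0 _). Qed.
Lemma engI_ge0 : (0 <= engI)%R. Proof. exact: fine_ge0 (integral_pot_ge0 _). Qed.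

(** Let q be the mass outside [-K, K]. Moving it to [0, 1] lowers the potential term by at least (7
    beta + 1) q, because outside [Vt] exceeds its mean [v1] over [0, 1] by 7 beta + 1. It raises the
    interaction term by at most (beta / 2) 14 q = 7 beta q. Minimality forces q = 0. *)
Lemma sigma_compact_support : exists2 K0 : R, (0 < K0)%R &
  forall K, (K0 <= K)%R -> sigma (~` [set x | (`|x| <= K)%R]) = 0.
Proof.
have [v1 v1E] : exists v1 : R, \int[U01]_s (Vt s)%:E = v1%:E.
  exists (fine (\int[U01]_s (Vt s)%:E)); rewrite fineK// ge0_fin_numE ?uniform01_Vt//.
  exact: integral_EVt_ge0.
have v10 : (0 <= v1)%R by rewrite -lee_fin -v1E; exact: integral_EVt_ge0.
have [K0 [K00 HK0]] := growth (v1 + 7 * beta + 1).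
exists K0 => // K KK0.
pose B : set mR := ~` [set x | (`|x| <= K)%R].
have mB : measurable B by apply: measurableC; exact: measurable_abs_le.
rewrite -/B; have [mu muE] := exists_truncation sigma K.
have [q qE] : exists q : R, sigma B = q%:E.
  by exists (fine (sigma B)); rewrite fineK//; exact: fin_num_measure.
have q0 : (0 <= q)%R by rewrite -lee_fin -qE.
have m1B (c : R) : measurable_fun [set: mR] (fun x : mR => (c * \1_B x)%:E).
  by apply/measurable_EFinP; apply: measurable_funM.
have c1B (c : R) x : (0 <= c)%R -> 0 <= (c * \1_B x)%:E.
  by move=> c0; rewrite lee_fin mulr_ge0.
have cE (c : R) : (0 <= c)%R -> \int[sigma]_x (c * \1_B x)%:E = (c * q)%:E.
  move=> c0; under eq_integral do rewrite EFinM.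
  rewrite ge0_integralZl_EFin//; last by apply/measurable_EFinP.
  by rewrite integral_indic// setIT EFinM; congr (_ * _); exact: qE.
have ifB (c : R) (g : mR -> \bar R) : (0 <= c)%R -> (forall x, 0 <= g x) ->
    measurable_fun [set: mR] g -> \int[U01]_s g s <= c%:E ->
    \int[mu]_x g x <= \int[sigma]_x g x + (c * q)%:E.
  move=> c0 g0 mg gc; rewrite muE// -cE// -ge0_integralD//; last by move=> x _; exact: c1B.
  have mif : measurable_fun [set: mR]
      (fun x : mR => if (`|x| <= K)%R then g x else \int[U01]_s g s).
    apply: measurable_fun_ifT => //.
    by apply: (@measurable_fun_ler _ mR R).
  apply: ge0_le_integral => //.
  - by move=> x _; case: ifP => // _; exact: integral_ge0.
  - by apply: emeasurable_funD.
  - move=> x _; rewrite /B indicE in_setC; case: ifPn => xK.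
      by rewrite mem_set//= mulr0 adde0.
    rewrite memNset/=; last exact/negP.
    by rewrite mulr1; apply: le_trans gc _; rewrite leeDr.
have potmu z : pot mu z <= pot sigma z + (7 * q)%:E.
  apply: ifB => //.
  - by move=> y; exact: Lk_ge0.
  - exact: measurable_Lk_comp.
  rewrite (eq_integral (fun y : mR => Lk y z)); last by move=> y _; rewrite LkC.
  exact: uniform01_Lk.
have Imu : \int[mu]_x pot mu x <= (engI + 14 * q)%:E.
  apply: (@le_trans _ _ (\int[mu]_z (pot sigma z + (7 * q)%:E))).
    apply: ge0_le_integral => //.
    - by move=> x _; exact: pot_ge0.
    - exact: measurable_pot.
    - by apply: emeasurable_funD => //; exact: measurable_pot.
  rewrite ge0_integralD//; last 3 first.
  - by move=> x _; exact: pot_ge0.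
  - exact: measurable_pot.
  - by move=> x _; rewrite lee_fin mulr_ge0.
  rewrite integral_probability_cst.
  rewrite (_ : (engI + 14 * q)%R = (engI + 7 * q + 7 * q)%R); last by ring.
  rewrite [leRHS]EFinD; apply: leeD2r; rewrite EFinD -engIE; apply: ifB => //.
  - by move=> x; exact: pot_ge0.
  - exact: measurable_pot.
  rewrite (@fubini_tonelli _ _ _ _ _ U01 sigma _ (@measurable_Lk R) (fun z => Lk_ge0 z.1 z.2)).
  apply: (@le_trans _ _ (\int[sigma]_x 7%:E)); last by rewrite integral_probability_cst.
  apply: ge0_le_integral => //.
  - by move=> x _; apply: integral_ge0 => s _; exact: Lk_ge0.
  - exact: (@measurable_fun_fubini_tonelli_G _ _ _ _ _ U01 _ (@measurable_Lk R) (fun z => Lk_ge0 z.1 z.2)).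
  - by move=> x _; exact: uniform01_Lk.
have Vmu : \int[mu]_x (Vt x)%:E + ((7 * beta + 1) * q)%:E <= engV%:E.
  rewrite muE; last 2 first.
  - exact: measurable_EVt.
  - by move=> x; rewrite lee_fin.
  rewrite v1E -engVE -cE; last by rewrite addr_ge0// mulr_ge0// ltW.
  have mif : measurable_fun [set: mR]
      (fun x : mR => if (`|x| <= K)%R then (Vt x)%:E else v1%:E).
    apply: measurable_fun_ifT => //; last exact: measurable_EVt.
    by apply: (@measurable_fun_ler _ mR R).
  have if0 x : 0 <= (if (`|x| <= K)%R then (Vt x)%:E else v1%:E).
    by case: ifP => _; rewrite lee_fin.
  have b0 : (0 <= 7 * beta + 1)%R by rewrite addr_ge0// mulr_ge0// ltW.
  rewrite -ge0_integralD//; last by move=> x _; exact: c1B.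
  apply: ge0_le_integral => //.
  - by move=> x _; apply: adde_ge0 => //; exact: c1B.
  - by apply: emeasurable_funD.
  - exact: measurable_EVt.
  - move=> x _; rewrite /B indicE in_setC; case: ifPn => xK.
      by rewrite mem_set//= mulr0 adde0.
    rewrite memNset/=; last exact/negP.
    rewrite mulr1 -EFinD lee_fin.
    have xK' : (K0 <= `|x|)%R by apply: le_trans KK0 _; rewrite ltW// ltNge.
    have := HK0 x xK'; have := normr_ge0 x; nra.
have := hmin mu; rewrite !engE engVE engIE.
have := integral_EVt_ge0 mu; have := integral_pot_ge0 mu.
move: Vmu Imu.
case: (\int[mu]_x (Vt x)%:E) => [a'| |] //; case: (\int[mu]_x pot mu x) => [i'| |] //.
rewrite -!(EFinM, EFinD) !lee_fin => h1 h2 h3 h4 h5.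
rewrite qE; congr (_%:E); apply/eqP; rewrite eq_le q0 andbT.
have h6 : (beta / 2 * i' <= beta / 2 * (engI + 14 * q))%R by rewrite ler_pM2l.
by lra.
Qed.

(** The first-order condition at finite e, for the competitor (1 - e) sigma + e Unif[y, y + e]. A
    point mass would have infinite energy; the uniform law has self-energy of order log(1/e), which
    enters with the factor e^2 and leaves the last term after division by e. *)
Lemma Euler_Lagrange (e : R) (e0 : (0 < e)%R) (y : R) : (e < 1)%R ->
  (engV + beta * engI)%:E <=
    \int[uniform_prob e0]_s (Vt (y + s))%:E +
    beta%:E * \int[uniform_prob e0]_s pot sigma (y + s)%R +
    (beta / 2 * e * (engI + (2 * clog y + 3 * e + 4 - ln e)))%:E.
Proof.
move=> e1.
have lne0 : (ln e <= 0)%R by apply: ln_le0; exact: ltW.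
have [mu muE] := exists_mixture sigma e0 y e1.
have mshift (g : mR -> \bar R) : measurable_fun [set: mR] g ->
    measurable_fun [set: mR] (fun s : mR => g (y + s)%R).
  by move=> mg; exact: (measurableT_comp mg (@measurable_shift R y)).
have mVs := mshift _ measurable_EVt.
set A' := \int[uniform_prob e0]_s (Vt (y + s))%:E.
set J := \int[uniform_prob e0]_s pot sigma (y + s)%R.
have A'0 : 0 <= A' by apply: integral_ge0 => s _; rewrite lee_fin.
have J0 : 0 <= J by apply: integral_ge0 => s _; exact: pot_ge0.
pose Av (z : mR) : \bar R := \int[uniform_prob e0]_s Lk z (y + s)%R.
have Av0 z : 0 <= Av z by apply: integral_ge0 => s _; exact: Lk_ge0.
have mLs : measurable_fun [set: mR * mR] (fun z : mR * mR => Lk z.1 (y + z.2)%R).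
  apply: measurable_Lk_comp; first exact: measurable_fst.
  exact: (measurableT_comp (@measurable_shift R y) measurable_snd).
have mAv : measurable_fun [set: mR] Av.
  exact: (@measurable_fun_fubini_tonelli_F _ _ _ _ _ (uniform_prob e0) _ mLs (fun z => Lk_ge0 _ _)).
have potmu z : pot mu z = e%:E * Av z + (1 - e)%:E * pot sigma z.
  rewrite /pot muE//.
  - exact: measurable_Lk_comp.
  - by move=> ?; exact: Lk_ge0.
have e'0 : (0 <= 1 - e)%R by lra.
have JE : \int[sigma]_x Av x = J.
  rewrite /Av (@fubini_tonelli _ _ _ _ _ sigma (uniform_prob e0) _ mLs (fun z => Lk_ge0 _ _)).
  by apply: eq_integral => s _; apply: eq_integral => x _; exact: LkC.
have k0 : \int[uniform_prob e0]_s Av (y + s)%R <= (2 * clog y + 3 * e + 4 - ln e)%:E.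
  rewrite -[leRHS](integral_uniform_cst e0).
  apply: le_integral_uniform => //.
  - exact: mshift.
  - move=> s; rewrite lee_fin; have := clog_ge0 y; lra.
  - move=> s /andP[s0 se]; rewrite /Av.
    rewrite (eq_integral (fun t : mR => Lk (y + t)%R (y + s)%R)); last by move=> t _; rewrite LkC.
    apply: le_trans (uniform_Lk_near _ _ _ (ltW e1)) _.
    by rewrite lee_fin; have := le_clogD y s0; lra.
have mps := measurable_pot sigma.
have lincomb d (T : measurableType d) (P : {measure set T -> \bar R}) (f g : T -> \bar R) :
    measurable_fun [set: T] f -> measurable_fun [set: T] g ->
    (forall x, 0 <= f x) -> (forall x, 0 <= g x) ->
    \int[P]_x (e%:E * f x + (1 - e)%:E * g x) =
    e%:E * \int[P]_x f x + (1 - e)%:E * \int[P]_x g x.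
  move=> mf mg f0 g0; rewrite ge0_integralD//.
  - by rewrite !ge0_integralZl_EFin// ltW.
  - by move=> x _; rewrite mule_ge0// lee_fin ltW.
  - exact: measurable_funeM.
  - by move=> x _; rewrite mule_ge0.
  - exact: measurable_funeM.
have Imu : \int[mu]_x pot mu x =
   e%:E * (e%:E * \int[uniform_prob e0]_s Av (y + s)%R + (1 - e)%:E * J) +
   (1 - e)%:E * (e%:E * J + (1 - e)%:E * engI%:E).
  rewrite muE; last 2 first.
  - exact: measurable_pot.
  - by move=> x; exact: pot_ge0.
  congr (_ * _ + _ * _).
    transitivity (\int[uniform_prob e0]_s (e%:E * Av (y + s)%R + (1 - e)%:E * pot sigma (y + s)%R)).
      by apply: eq_integral => s _; rewrite potmu.
    apply: lincomb; [exact: mshift|exact: mshift|by move=> s|].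
    by move=> s; exact: pot_ge0.
  transitivity (\int[sigma]_s (e%:E * Av s + (1 - e)%:E * pot sigma s)).
    by apply: eq_integral => s _; rewrite potmu.
  rewrite (lincomb _ _ _ _ _ mAv mps)//; last by move=> x; exact: pot_ge0.
  by rewrite JE engIE.
have := hmin mu; rewrite !engE engVE engIE Imu muE; last 2 first.
- exact: measurable_EVt.
- by move=> x; rewrite lee_fin.
rewrite -/A' engVE.
have : 0 <= \int[uniform_prob e0]_s Av (y + s)%R.
  by apply: integral_ge0.
clear JE Imu; move: k0 A'0 J0.
case: (\int[uniform_prob e0]_s Av (y + s)%R) => [k| |] //.
(* An infinite average makes the right-hand side +oo. *)
case: A' => [a'| |] //; case: J => [j| |] //; last 3 first.
- by move=> *; rewrite gt0_muley ?lte_fin// addey// addye// leey.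
- by move=> *; rewrite -EFinM addye// addye// leey.
- by move=> *; rewrite gt0_muley ?lte_fin// addey// addye// leey.
rewrite -!(EFinM, EFinD) !lee_fin => h1 h2 h3 h4 h5.
have := engI_ge0 => i0.
set kk := (2 * clog y + 3 * e + 4 - ln e)%R in h1 *.
have : (e * (engV + beta * engI) <= e * (a' + beta * j + beta / 2 * e * (engI + kk)))%R.
  have h6 : (beta / 2 * (e * e) * k <= beta / 2 * (e * e) * kk)%R.
    by rewrite ler_wpM2l// mulr_ge0// ?mulr_ge0 ?ltW.
  have h7 : (0 <= beta * (e * e) * j)%R by rewrite !mulr_ge0// ltW.
  by lra.
by rewrite ler_pM2l.
Qed.

(** Between two points of an interval of radius exp(-c) / 2 the kernel is at least c, so the mass q
    of the interval satisfies c q^2 <= [engI]. The choice of c excludes q > eta. *)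
Lemma sigma_nonatomic (eta : R) : (0 < eta)%R -> exists2 delta : R, (0 < delta)%R &
  forall y : R, sigma [set z | (`|z - y| < delta)%R] <= eta%:E.
Proof.
move=> eta0; pose c := (engI / eta ^+ 2 + 1)%R.
have c0 : (0 < c)%R by rewrite ltr_wpDl// divr_ge0// ?sqr_ge0// engI_ge0.
pose delta := (expR (- c) / 2)%R.
have delta0 : (0 < delta)%R by rewrite divr_gt0// expR_gt0.
exists delta => // y; pose B : set mR := [set z | (`|z - y| < delta)%R].
rewrite -/B.
have mB : measurable B.
  have -> : B = ball y delta by apply/seteqP; split => z; rewrite /B /ball/= distrC.
  exact: measurable_ball.
have [q qE] : exists q : R, sigma B = q%:E.
  by exists (fine (sigma B)); rewrite fineK//; exact: fin_num_measure.
have q0 : (0 <= q)%R by rewrite -lee_fin -qE.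
have Bc (D : R) : \int[sigma]_(x in B) D%:E = (D * q)%:E.
  by rewrite integral_cst// EFinM; congr (_ * _); exact: qE.
have potB x : B x -> (c * q)%:E <= pot sigma x.
  move=> Bx; rewrite -Bc.
  apply: (@le_trans _ _ (\int[sigma]_(y in B) Lk x y)); last first.
    apply: ge0_subset_integral => //; last by move=> *; exact: Lk_ge0.
    exact: measurable_Lk_comp.
  apply: ge0_le_integral => //.
  - by move=> *; rewrite lee_fin ltW.
  - by apply: measurable_funTS; exact: measurable_Lk_comp.
  move=> z Bz; have xz : (`|x - z| <= expR (- c))%R.
    have -> : (x - z = (x - y) - (z - y))%R by ring.
    apply: le_trans (ler_normB _ _) _.
    by move: Bx Bz; rewrite /B/= /delta; lra.
  apply: le_trans (Lk_ge (expR_gt0 _) xz).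
  by rewrite expRK lee_fin opprK; have := clog_ge0 x; have := clog_ge0 z; lra.
have : (c * q * q)%:E <= engI%:E.
  rewrite -engIE -Bc.
  apply: (@le_trans _ _ (\int[sigma]_(x in B) pot sigma x)); last first.
    apply: ge0_subset_integral => //; last by move=> *; exact: pot_ge0.
    exact: measurable_pot.
  apply: ge0_le_integral => //.
  - by move=> *; rewrite lee_fin mulr_ge0// ltW.
  - by apply: measurable_funTS; exact: measurable_pot.
rewrite lee_fin qE lee_fin => h; rewrite leNgt; apply/negP => qeta.
have qq : (eta * eta < q * q)%R by rewrite ltr_pM// ltW.
have cE : (c * (eta * eta) = engI + eta * eta)%R.
  by rewrite /c; field; rewrite gt_eqF.
have e2 : (0 < eta * eta)%R by rewrite mulr_gt0.
have : (c * (eta * eta) < c * (q * q))%R by rewrite ltr_pM2l.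
by lra.
Qed.

End Equilibrium.

(** * Interpolation of -log by triangular kernels *)

Lemma ln_le_sub1 (R : realType) (x : R) : 0 < x -> ln x <= x - 1.
Proof. by move=> x0; have := @le_ln1Dx R (x - 1); rewrite subrKC; apply; lra. Qed.

Section Triangular.
Context {R : realType}.
Implicit Types r u x y : R.

Definition tri r u : R := Num.max 0 (1 - `|u| / r).

Lemma tri_ge0 r u : 0 <= tri r u.
Proof. by rewrite /tri le_max lexx. Qed.

Lemma tri_le1 r u : 0 < r -> tri r u <= 1.
Proof. by move=> r0; rewrite /tri ge_max ler01 gerBl divr_ge0// ltW. Qed.

Lemma tri_in r u : 0 < r -> `|u| <= r -> tri r u = 1 - `|u| / r.
Proof. by move=> r0 ur; rewrite /tri; apply/max_idPr; rewrite subr_ge0 ler_pdivrMr// mul1r. Qed.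

Lemma tri_out r u : 0 < r -> r <= `|u| -> tri r u = 0.
Proof. by move=> r0 ur; rewrite /tri; apply/max_idPl; rewrite subr_le0 ler_pdivlMr// mul1r. Qed.

Lemma tri_sym r x y : tri r (x - y) = tri r (y - x).
Proof. by rewrite /tri distrC. Qed.

Variables (e q : R).
Hypotheses (e0 : 0 < e) (q1 : 1 < q).

Let A := ln q / (q - 1).

(* Up to an additive constant, a piecewise linear interpolation of [- ln] at the
   nodes [e * q ^+ k], written as a positive combination of triangular kernels. *)
Definition trisum n u : R :=
  A * (tri (e * q ^+ n) u + (q - 1) * \sum_(1 <= k < n.+1) tri (e * q ^+ k) u).

Let q0 : 0 < q. Proof. exact: lt_trans q1. Qed.
Let q10 : 0 < q - 1. Proof. by rewrite subr_gt0. Qed.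
Let r0 k : 0 < e * q ^+ k. Proof. by rewrite mulr_gt0// exprn_gt0. Qed.
Let lnq0 : 0 < ln q. Proof. exact: ln_gt0. Qed.
Let A0 : 0 < A. Proof. by rewrite divr_gt0. Qed.
Let A1 : A <= 1.
Proof.
by rewrite ler_pdivrMr// mul1r ln_le_sub1.
Qed.

(** A lower bound on the weight of the widest triangle, the one whose remainder is kept in
    [trisum_psd]. *)
Lemma trisum_coef : q^-1 <= A.
Proof.
rewrite ler_pdivlMr// mulrBr mulVf ?gt_eqF// mulr1.
have := @ln_le_sub1 R q^-1; rewrite invr_gt0 lnV ?posrE// => /(_ q0); lra.
Qed.

Lemma trisum_ge0 n u : 0 <= trisum n u.
Proof.
apply: mulr_ge0; first exact: ltW.
apply: addr_ge0; first exact: tri_ge0.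
by apply: mulr_ge0; [exact: ltW|apply: sumr_ge0 => k _; exact: tri_ge0].
Qed.

(** Unlike -log, the interpolation is bounded at 0, so the diagonal of a double sum over N particles
    costs only O(N). *)
Lemma trisum_le n u : trisum n u <= 1 + (q - 1) * n%:R.
Proof.
rewrite -[leRHS]mul1r; apply: ler_pM => //.
- exact: ltW.
- apply: addr_ge0; first exact: tri_ge0.
  by apply: mulr_ge0; [exact: ltW|apply: sumr_ge0 => k _; exact: tri_ge0].
- apply: lerD; first exact: tri_le1.
  rewrite ler_pM2l//; apply: (@le_trans _ _ (\sum_(1 <= k < n.+1) 1)).
    by apply: ler_sum => k _; exact: tri_le1.
  by rewrite sumr_const_nat subn1.
Qed.

Lemma trisum_out n u : e * q ^+ n <= `|u| -> trisum n u = 0.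
Proof.
move=> h; rewrite /trisum tri_out// add0r big_nat big1 ?mulr0// => k /andP[_ kn].
apply: tri_out => //; apply: le_trans h; rewrite ler_pM2l//.
by apply: ler_weXn2l => //; exact: ltW.
Qed.

(** In this range q tri(e q^(n+1)) - tri(e q^n) is the constant q - 1, since the slopes in |u|
    cancel, and A (q - 1) = ln q. *)
Lemma trisum_step n u : `|u| <= e * q ^+ n -> trisum n.+1 u = trisum n u + ln q.
Proof.
move=> h; have h' : `|u| <= e * q ^+ n.+1.
  apply: le_trans h _; rewrite exprS mulrCA ler_peMl ?ltW//.
rewrite /trisum big_nat_recr//= (tri_in (r0 n.+1) h') (tri_in (r0 n) h).
rewrite exprS /A; field; rewrite !gt_eqF ?exprn_gt0//=.
Qed.

Lemma trisum_top n u : e * q ^+ n <= `|u| <= e * q ^+ n.+1 ->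
  trisum n.+1 u = A * q * (1 - `|u| / (e * q ^+ n.+1)).
Proof.
move=> /andP[h1 h2]; rewrite /trisum big_nat_recr//= big_nat big1.
  by rewrite add0r (tri_in (r0 n.+1) h2); ring.
move=> k /andP[_ kn]; apply: tri_out => //; apply: le_trans h1; rewrite ler_pM2l//.
by apply: ler_weXn2l => //; exact: ltW.
Qed.

Lemma trisum_top_bnd n u : e * q ^+ n <= `|u| <= e * q ^+ n.+1 ->
  0 <= trisum n.+1 u <= ln q.
Proof.
move=> h; rewrite trisum_ge0 trisum_top//=; move: h => /andP[h1 h2].
have -> : ln q = A * q * (1 - q^-1) by rewrite /A; field; rewrite !gt_eqF.
have Aq0 : 0 < A * q by exact: mulr_gt0.
rewrite (ler_pM2l Aq0) lerD2l lerN2 ler_pdivlMr// exprS.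
by have -> : q^-1 * (e * (q * q ^+ n)) = e * q ^+ n by field; rewrite gt_eqF.
Qed.

Lemma ln_node n : ln (e * q ^+ n.+1) = ln (e * q ^+ n) + ln q.
Proof. by rewrite exprS mulrCA [RHS]addrC; apply: lnM; rewrite posrE ?r0. Qed.

(** A new node adds ln q to both sides wherever the previous bound applies; on the new outer shell
    the left-hand side is at most 0. The maximum with e caps the singularity, below which the
    interpolation stays bounded. *)
Lemma trisum_lower n u : `|u| <= e * q ^+ n ->
  ln (e * q ^+ n) - ln (Num.max `|u| e) - ln q <= trisum n u.
Proof.
elim: n => [|n IH] h.
  move: h; rewrite expr0 mulr1 => h; rewrite (max_idPr h).
  by have := trisum_ge0 0 u; have := lnq0; lra.
have [un|un] := leP `|u| (e * q ^+ n).
  by rewrite trisum_step// ln_node; have := IH un; lra.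
have h3 : e * q ^+ n <= `|u| <= e * q ^+ n.+1 by rewrite ltW.
have /andP[h4 _] := trisum_top_bnd h3.
apply: le_trans h4; rewrite ln_node.
have : ln (e * q ^+ n) <= ln (Num.max `|u| e).
  rewrite ler_ln ?posrE// ?lt_max ?e0 ?orbT//.
  by rewrite le_max ltW.
by have := lnq0; lra.
Qed.

(** The same induction as for the lower bound: on the outer shell the sum is at most ln q, and the
    base case is ln t <= t - 1 at t = |u| / e. *)
Lemma trisum_upper n u : 0 < `|u| -> `|u| <= e * q ^+ n ->
  trisum n u <= ln (e * q ^+ n) - ln `|u| + ln q.
Proof.
move=> u0; elim: n => [|n IH] h.
  rewrite /trisum big_nat big1 => [|k]; last by rewrite andbC; case: k.
  move: h; rewrite expr0 mulr1 mulr0 addr0 => h; rewrite tri_in//.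
  have : A * (1 - `|u| / e) <= 1 - `|u| / e.
    by rewrite ler_piMl// subr_ge0 ler_pdivrMr// mul1r.
  have := @ln_le_sub1 R (`|u| / e); rewrite divr_gt0// ln_div ?posrE//.
  by have := lnq0; move=> ? /(_ isT); lra.
have [un|un] := leP `|u| (e * q ^+ n).
  by rewrite trisum_step// ln_node; have := IH un; lra.
have h3 : e * q ^+ n <= `|u| <= e * q ^+ n.+1 by rewrite ltW.
have /andP[_ h4] := trisum_top_bnd h3.
apply: le_trans h4 _.
have : ln `|u| <= ln (e * q ^+ n.+1) by rewrite ler_ln ?posrE.
by have := lnq0; lra.
Qed.

Lemma trisum_sym n x y : trisum n (x - y) = trisum n (y - x).
Proof.
by rewrite /trisum tri_sym; congr (_ * (_ + _ * _)); apply: eq_bigr => k _; rewrite tri_sym.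
Qed.

End Triangular.

(** * Positive definiteness of the triangular kernels *)

Section PositiveDefinite.
Context {R : realType}.
Local Open Scope ereal_scope.
Notation mR := (measurableTypeR R).
Notation leb := (@lebesgue_measure R).

(* [window r z x = 1] if [z < x <= z + r], and 0 otherwise. *)
Definition window (r : R) (z x : mR) : R := \1_(`[(x - r)%R, x[%classic : set mR) z.

Lemma window_ge0 r z x : (0 <= window r z x)%R. Proof. by []. Qed.

Lemma window_le1 r z x : (window r z x <= 1)%R.
Proof. by rewrite /window indicE; case: (_ \in _). Qed.

Lemma windowE r z x : window r z x = if ((x - r <= z) && (z < x))%R then 1%R else 0%R.
Proof.
rewrite /window indicE; case: ifPn => h; first by rewrite mem_set//= in_itv.
by rewrite memNset//= in_itv/=; exact/negP.
Qed.

Lemma measurable_window r : measurable_fun [set: mR * mR] (fun p : mR * mR => window r p.1 p.2).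
Proof.
under eq_fun do rewrite windowE.
apply: measurable_fun_ifT => //; apply: measurable_and.
  apply: (@measurable_fun_ler _ (mR * mR)%type R) => //.
  by apply: measurable_funB.
by apply: (@measurable_fun_ltr _ (mR * mR)%type R).
Qed.

Lemma measurable_Ewindow r :
  measurable_fun [set: mR * mR] (fun p : mR * mR => (window r p.1 p.2)%:E).
Proof. by apply/measurable_EFinP; exact: measurable_window. Qed.

Lemma measurable_windowr r z : measurable_fun [set: mR] (window r z).
Proof. exact: (measurable_fun_pair2 z (@measurable_window r)). Qed.

Lemma measurable_windowl r x : measurable_fun [set: mR] (fun z => window r z x).
Proof. exact: (measurable_fun_pair1 x (@measurable_window r)). Qed.

Lemma measurable_tri r : measurable_fun [set: mR] (tri r : mR -> R).
Proof.
apply: measurable_maxr => //; apply: measurable_funB => //.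
by apply: measurable_funM => //; exact: normr_measurable.
Qed.

Lemma measurable_sub2 : measurable_fun [set: mR * mR] (fun p : mR * mR => (p.1 - p.2)%R : mR).
Proof. by apply: measurable_funB. Qed.

Lemma measurable_Etri r :
  measurable_fun [set: mR * mR] (fun p : mR * mR => (tri r (p.1 - p.2))%:E).
Proof.
apply/measurable_EFinP.
exact: (measurableT_comp (@measurable_tri r) measurable_sub2).
Qed.

(** The windows attached to x and y overlap in length r - |x - y|, or not at all. The triangular
    kernel is thus the autocorrelation of an interval, which is the source of its positive
    definiteness. *)
Lemma integral_window2 r x y : (0 < r)%R ->
  \int[leb]_z (window r z x * window r z y)%:E = (r * tri r (x - y))%:E.
Proof.
move=> r0; wlog xy : x y / (x <= y)%R.
  move=> H; have [|/ltW] := leP x y; first exact: H.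
  by move=> /H; rewrite tri_sym => <-; apply: eq_integral => z _; rewrite mulrC.
have -> : (fun z : mR => (window r z x * window r z y)%:E) =
    (fun z => (\1_(`[(y - r)%R, x[%classic : set mR) z)%:E).
  apply/funext => z; rewrite !windowE indicE; congr (_%:E).
  have -> : (z \in (`[(y - r)%R, x[%classic : set mR)) = ((y - r <= z) && (z < x))%R.
    by apply/idP/idP; rewrite inE/= in_itv.
  have [zx|zx] := ltP z x; rewrite ?andbF ?mul0r//.
  have [yz|yz] := leP (y - r)%R z; last by rewrite andFb mulr0.
  by rewrite (lt_le_trans zx xy) (le_trans _ yz) ?mulr1// lerD2r.
rewrite integral_indic// setIT; etransitivity; first exact: lebesgue_measure_itv.
have nxy : (`|x - y| = y - x)%R by rewrite distrC ger0_norm// subr_ge0.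
rewrite /= lte_fin; have [h|h] := ltP (y - r)%R x.
  rewrite tri_in// ?nxy; last by lra.
  by rewrite -EFinB; congr (_%:E); field; rewrite gt_eqF.
by rewrite tri_out// ?mulr0 ?nxy//; lra.
Qed.

Section one.
Variables (r : R) (r0 : (0 < r)%R).
Implicit Types mu nu : probability mR R.

(** This is the mu-measure of ]z, z + r]. *)
Definition mass (mu : probability mR R) (z : mR) : \bar R := \int[mu]_x (window r z x)%:E.

Lemma mass_ge0 mu z : 0 <= mass mu z.
Proof. by apply: integral_ge0 => x _; rewrite lee_fin window_ge0. Qed.

Lemma mass_le1 mu z : mass mu z <= 1.
Proof.
rewrite -[leRHS](integral_probability_cst mu); apply: ge0_le_integral => //.
- by move=> x _; rewrite lee_fin window_ge0.
- by apply/measurable_EFinP; exact: measurable_windowr.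
- by move=> x _; rewrite lee_fin window_le1.
Qed.

Lemma mass_fin mu z : mass mu z \is a fin_num.
Proof. by rewrite ge0_fin_numE ?mass_ge0// (le_lt_trans (mass_le1 _ _))// ltry. Qed.

Lemma measurable_mass mu : measurable_fun [set: mR] (mass mu).
Proof.
exact: (@measurable_fun_fubini_tonelli_F _ _ _ _ _ mu _ (@measurable_Ewindow r) (fun p => window_ge0 _ _ _)).
Qed.

Lemma integral_window_mass mu (h : mR -> \bar R) :
  measurable_fun [set: mR] h -> (forall z, 0 <= h z) ->
  \int[mu]_x \int[leb]_z (h z * (window r z x)%:E) = \int[leb]_z (h z * mass mu z).
Proof.
move=> mh h0.
have mhw : measurable_fun [set: mR * mR] (fun p : mR * mR => h p.1 * (window r p.1 p.2)%:E).
  apply: emeasurable_funM; last exact: measurable_Ewindow.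
  exact: (measurableT_comp mh measurable_fst).
have hw0 (p : mR * mR) : 0 <= h p.1 * (window r p.1 p.2)%:E.
  by apply: mule_ge0 => //; rewrite lee_fin window_ge0.
rewrite -(@fubini_tonelli _ _ _ _ _ leb mu _ mhw hw0).
apply: eq_integral => z _ /=; rewrite ge0_integralZl//; last first.
  by move=> x _; rewrite lee_fin window_ge0.
by apply/measurable_EFinP; exact: measurable_windowr.
Qed.

Definition triQ (mu nu : probability mR R) : \bar R :=
  \int[mu]_x \int[nu]_y (tri r (x - y))%:E.

Lemma triQE mu nu : r%:E * triQ mu nu = \int[leb]_z (mass mu z * mass nu z).
Proof.
under [RHS]eq_integral do rewrite muleC.
rewrite -integral_window_mass; [|exact: measurable_mass|exact: mass_ge0].
have tri0 (p : mR * mR) : 0 <= (tri r (p.1 - p.2))%:E by rewrite lee_fin tri_ge0.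
rewrite -ge0_integralZl_EFin ?ltW//; last 2 first.
- by move=> x _; apply: integral_ge0 => y _; rewrite lee_fin tri_ge0.
- exact: (@measurable_fun_fubini_tonelli_F _ _ _ _ _ nu _ (@measurable_Etri r) tri0).
apply: eq_integral => x _.
rewrite -ge0_integralZl_EFin ?ltW//; last 2 first.
- by move=> y _; rewrite lee_fin tri_ge0.
- exact: (measurable_fun_pair2 x (@measurable_Etri r)).
transitivity (\int[leb]_z ((window r z x)%:E * mass nu z)); last first.
  by apply: eq_integral => z _; rewrite muleC.
rewrite -integral_window_mass; last first.
- by move=> z; rewrite lee_fin window_ge0.
- by apply/measurable_EFinP; exact: measurable_windowl.
by apply: eq_integral => y _; rewrite -EFinM -integral_window2.
Qed.

(** The squared L^2 distance between the window masses at scale r: the quantity in which the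
    empirical measure is shown to concentrate at sigma. *)
Definition gap2 mu nu : \bar R :=
  \int[leb]_z ((fine (mass mu z) - fine (mass nu z)) ^+ 2)%:E.

Lemma measurable_gap mu nu :
  measurable_fun [set: mR] (fun z => (fine (mass mu z) - fine (mass nu z))%R).
Proof.
by apply: measurable_funB; apply: measurableT_comp => //; exact: measurable_mass.
Qed.

Lemma gap2_ge0 mu nu : 0 <= gap2 mu nu.
Proof. by apply: integral_ge0 => z _; rewrite lee_fin sqr_ge0. Qed.

Lemma gap2C mu nu : gap2 mu nu = gap2 nu mu.
Proof. by apply: eq_integral => z _; congr (_%:E); ring. Qed.

(** The identity a^2 + b^2 = 2 a b + (a - b)^2 for the masses a and b of a window, integrated over
    the windows. It is written without subtraction to remain in the extended nonnegative numbers. *)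
Lemma triQ_psd mu nu :
  triQ mu mu + triQ nu nu = triQ mu nu + triQ mu nu + (r^-1)%:E * gap2 mu nu.
Proof.
have rE (x : \bar R) : x = (r^-1)%:E * (r%:E * x).
  by rewrite muleA -EFinM mulVf ?gt_eqF// mul1e.
have Q0 m1 m2 : 0 <= r%:E * triQ m1 m2.
  by rewrite triQE; apply: integral_ge0 => z _; rewrite mule_ge0// mass_ge0.
have r'0 : 0 <= (r^-1)%:E by rewrite lee_fin invr_ge0 ltW.
have E : r%:E * triQ mu mu + r%:E * triQ nu nu =
    (r%:E * triQ mu nu + r%:E * triQ mu nu) + gap2 mu nu.
  rewrite !triQE /gap2.
  have mm m1 m2 : measurable_fun [set: mR] (fun z => mass m1 z * mass m2 z).
    by apply: emeasurable_funM; exact: measurable_mass.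
  have m0 m1 m2 z : 0 <= mass m1 z * mass m2 z by rewrite mule_ge0 ?mass_ge0.
  have mg : measurable_fun [set: mR] (fun z => ((fine (mass mu z) - fine (mass nu z)) ^+ 2)%:E).
    by apply/measurable_EFinP; apply: measurable_funX; exact: measurable_gap.
  have mg0 z : 0 <= ((fine (mass mu z) - fine (mass nu z)) ^+ 2)%:E.
    by rewrite lee_fin sqr_ge0.
  transitivity (\int[leb]_z (mass mu z * mass mu z + mass nu z * mass nu z)).
    by rewrite ge0_integralD.
  transitivity (\int[leb]_z ((mass mu z * mass nu z + mass mu z * mass nu z) +
      ((fine (mass mu z) - fine (mass nu z)) ^+ 2)%:E)); last first.
    rewrite ge0_integralD//; last 2 first.
    - by move=> z _; rewrite adde_ge0.
    - exact: emeasurable_funD.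
    by rewrite ge0_integralD.
  apply: eq_integral => z _.
  rewrite -(fineK (mass_fin mu z)) -(fineK (mass_fin nu z)) /=.
  by rewrite -!EFinM -!EFinD; congr (_%:E); ring.
transitivity ((r^-1)%:E * (r%:E * triQ mu mu + r%:E * triQ nu nu)).
  by rewrite (ge0_muleDr _ (Q0 mu mu) (Q0 nu nu)) -[X in _ = X + _]rE -[X in _ = _ + X]rE.
rewrite E (ge0_muleDr _ _ (gap2_ge0 mu nu)); last exact: adde_ge0.
by rewrite (ge0_muleDr _ (Q0 mu nu) (Q0 mu nu)) -rE.
Qed.

(* A test function [x |-> \int phi(z) window r z x dz] is controlled by the gap. *)
Lemma test_function_gap mu nu (phi : mR -> R) (t : R) : (0 < t)%R ->
  measurable_fun [set: mR] phi -> (forall z, (0 <= phi z)%R) ->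
  \int[mu]_x \int[leb]_z (phi z * window r z x)%:E <=
  \int[nu]_x \int[leb]_z (phi z * window r z x)%:E +
  ((t / 2)%:E * \int[leb]_z (phi z ^+ 2)%:E + ((2 * t)^-1)%:E * gap2 mu nu).
Proof.
move=> t0 mphi phi0.
have mE : measurable_fun [set: mR] (fun z => (phi z)%:E) by apply/measurable_EFinP.
have tf (m1 : probability mR R) : \int[m1]_x \int[leb]_z (phi z * window r z x)%:E =
    \int[leb]_z ((phi z)%:E * mass m1 z).
  by rewrite -integral_window_mass.
rewrite !tf.
have m0 (m1 : probability mR R) z : 0 <= (phi z)%:E * mass m1 z.
  by apply: mule_ge0; [rewrite lee_fin|exact: mass_ge0].
have mm (m1 : probability mR R) : measurable_fun [set: mR] (fun z => (phi z)%:E * mass m1 z).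
  by apply: emeasurable_funM => //; exact: measurable_mass.
have t20 : (0 <= t / 2)%R by rewrite divr_ge0// ltW.
have t2V0 : (0 <= (2 * t)^-1)%R by rewrite invr_ge0 mulr_ge0// ltW.
have mp : measurable_fun [set: mR] (fun z => (phi z ^+ 2)%:E).
  by apply/measurable_EFinP; exact: measurable_funX.
have mg : measurable_fun [set: mR] (fun z => ((fine (mass mu z) - fine (mass nu z)) ^+ 2)%:E).
  by apply/measurable_EFinP; apply: measurable_funX; exact: measurable_gap.
have p0 z : 0 <= (phi z ^+ 2)%:E by rewrite lee_fin sqr_ge0.
have g0 z : 0 <= ((fine (mass mu z) - fine (mass nu z)) ^+ 2)%:E by rewrite lee_fin sqr_ge0.
rewrite /gap2 -!ge0_integralZl_EFin//.
have t0e (c : R) (x : \bar R) : (0 <= c)%R -> 0 <= x -> 0 <= c%:E * x.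
  by move=> c0 x0; rewrite mule_ge0.
rewrite -ge0_integralD//; last 4 first.
- by move=> z _; exact: t0e.
- exact: measurable_funeM.
- by move=> z _; exact: t0e.
- exact: measurable_funeM.
rewrite -ge0_integralD//; last 2 first.
- by move=> z _; rewrite adde_ge0 ?t0e.
- by apply: emeasurable_funD; exact: measurable_funeM.
apply: ge0_le_integral => //.
- by apply: emeasurable_funD => //; apply: emeasurable_funD; exact: measurable_funeM.
move=> z _; rewrite -(fineK (mass_fin mu z)) -(fineK (mass_fin nu z)) /=.
rewrite -!EFinM -!EFinD lee_fin.
set a := fine (mass mu z); set b := fine (mass nu z).
(* Young's inequality phi (a - b) <= t phi^2 / 2 + (a - b)^2 / (2 t), as the positivity of a
   square. *)
suff : (0 <= (2 * t)^-1 * (a - b - t * phi z) ^+ 2)%R.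
  have -> : ((2 * t)^-1 * (a - b - t * phi z) ^+ 2 =
    (2 * t)^-1 * (a - b) ^+ 2 + t / 2 * phi z ^+ 2 - phi z * (a - b))%R.
    by field; rewrite gt_eqF.
  by lra.
by rewrite mulr_ge0// sqr_ge0.
Qed.

End one.

End PositiveDefinite.

(** * Empirical measures and the quadratic lower bound *)

Section Empirical.
Context {R : realType}.
Local Open Scope ereal_scope.
Notation mR := (measurableTypeR R).
Variables (N : nat) (l : nat -> mR).

(** There are [N.+1] atoms, so that the normalisation is always invertible. *)
Definition empirical : set mR -> \bar R :=
  mscale ((N.+1%:R : R)^-1%:nng)%R (msum (fun i => \d_(l i)) N.+1).

HB.instance Definition _ := Measure.on empirical.

Lemma empirical_setT : empirical [set: mR] = 1.
Proof.
rewrite /empirical /mscale/= /msum/=.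
under eq_bigr do rewrite diracT.
by rewrite sumEFin -EFinM sumr_const card_ord mulVf.
Qed.

HB.instance Definition _ := Measure_isProbability.Build _ _ _ empirical empirical_setT.

Lemma integral_empirical (g : mR -> \bar R) :
  measurable_fun [set: mR] g -> (forall x, 0 <= g x) ->
  \int[empirical]_x g x = (N.+1%:R^-1)%R%:E * \sum_(i < N.+1) g (l i).
Proof.
move=> mg g0; rewrite [LHS]ge0_integral_mscale//; congr (_ * _).
rewrite ge0_integral_measure_sum//; apply: eq_bigr => i _.
by rewrite integral_dirac// diracT mul1e.
Qed.

End Empirical.

Section TrisumPsd.
Context {R : realType}.
Local Open Scope ereal_scope.
Notation mR := (measurableTypeR R).
Notation leb := (@lebesgue_measure R).
Implicit Types mu nu : probability mR R.
Variables (e q : R) (n : nat).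
Hypotheses (e0 : (0 < e)%R) (q1 : (1 < q)%R).

Let A := (ln q / (q - 1))%R.
(** Weights and radii of [trisum] as one family: index 0 stands for the additional triangle of the
    largest radius e q^n. *)
Let w (k : nat) : R := if k is 0%N then A else (A * (q - 1))%R.
Let rad (k : nat) : R := (e * q ^+ (if k is 0 then n else k))%R.

Let A0 : (0 < A)%R. Proof. by rewrite divr_gt0 ?ln_gt0// subr_gt0. Qed.
Let w0 k : (0 <= w k)%R.
Proof.
case: k => [|k]; first exact: ltW.
by apply: mulr_ge0; [exact: ltW|rewrite subr_ge0 ltW].
Qed.
Let rad0 k : (0 < rad k)%R.
Proof. by rewrite mulr_gt0// exprn_gt0// (lt_trans _ q1). Qed.

Let trisumE u : trisum e q n u = (\sum_(k < n.+1) w k * tri (rad k) u)%R.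
Proof.
rewrite /trisum big_ord_recl /= mulrDr; congr (_ + _)%R.
by rewrite mulrA big_add1/= big_mkord mulr_sumr.
Qed.

Lemma measurable_trisum : measurable_fun [set: mR] (trisum e q n : mR -> R).
Proof.
rewrite (_ : trisum e q n = fun u => (\sum_(k < n.+1) w k * tri (rad k) u)%R); last exact/funext.
by apply: measurable_sum => k; apply: measurable_funM => //; exact: measurable_tri.
Qed.

Lemma measurable_trisum2 : measurable_fun [set: mR * mR]
  (fun p : mR * mR => (trisum e q n (p.1 - p.2))%:E).
Proof.
apply/measurable_EFinP.
exact: (measurableT_comp measurable_trisum measurable_sub2).
Qed.

Definition trisumQ mu nu : \bar R :=
  \int[mu]_x \int[nu]_y (trisum e q n (x - y))%:E.

Let QE mu nu : trisumQ mu nu = \sum_(k < n.+1) (w k)%:E * triQ (rad k) mu nu.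
Proof.
have t0 (p : mR * mR) : 0 <= (trisum e q n (p.1 - p.2))%:E by rewrite lee_fin trisum_ge0.
have t'0 k (p : mR * mR) : 0 <= (tri (rad k) (p.1 - p.2))%:E by rewrite lee_fin tri_ge0.
transitivity (\int[mu \x nu]_p (trisum e q n (p.1 - p.2))%:E).
  by rewrite (@fubini_tonelli1 _ _ _ _ _ mu nu _ measurable_trisum2 t0).
transitivity (\int[mu \x nu]_p \sum_(k < n.+1) ((w k)%:E * (tri (rad k) (p.1 - p.2))%:E)).
  apply: eq_integral => p _; rewrite trisumE -sumEFin; apply: eq_bigr => k _.
  by rewrite EFinM.
rewrite ge0_integral_sum//; last 2 first.
- by move=> k; apply: measurable_funeM; exact: measurable_Etri.
- by move=> k p _; apply: mule_ge0; [rewrite lee_fin; exact: w0|exact: t'0].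
apply: eq_bigr => k _; rewrite ge0_integralZl_EFin//; last exact: measurable_Etri.
congr (_ * _); rewrite (@fubini_tonelli1 _ _ _ _ _ mu nu _ (@measurable_Etri R (rad k)))//.
Qed.

(** The identities [triQ_psd] are summed over the triangles. Of the nonnegative remainders only the
    one of the widest triangle is kept, with weight at least 1/q. *)
Lemma trisum_psd mu nu :
  trisumQ mu nu + trisumQ mu nu +
    ((q * (e * q ^+ n))^-1)%:E * gap2 (e * q ^+ n) mu nu <=
  trisumQ mu mu + trisumQ nu nu.
Proof.
have T0 k m1 m2 : 0 <= (w k)%:E * triQ (rad k) m1 m2.
  apply: mule_ge0; first by rewrite lee_fin.
  by apply: integral_ge0 => x _; apply: integral_ge0 => y _; rewrite lee_fin tri_ge0.
rewrite !QE -!big_split/=.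
have -> : \sum_(k < n.+1) ((w k)%:E * triQ (rad k) mu mu + (w k)%:E * triQ (rad k) nu nu) =
   \sum_(k < n.+1) ((w k)%:E * triQ (rad k) mu nu + (w k)%:E * triQ (rad k) mu nu) +
   \sum_(k < n.+1) (w k)%:E * (((rad k)^-1)%:E * gap2 (rad k) mu nu).
  rewrite -big_split/=; apply: eq_bigr => k _.
  have Q0 m1 m2 : 0 <= triQ (rad k) m1 m2.
    by apply: integral_ge0 => x _; apply: integral_ge0 => y _; rewrite lee_fin tri_ge0.
  have g0 : 0 <= ((rad k)^-1)%:E * gap2 (rad k) mu nu.
    by rewrite mule_ge0 ?gap2_ge0// lee_fin invr_ge0 ltW.
  rewrite -(ge0_muleDr _ (Q0 mu mu) (Q0 nu nu)) (triQ_psd (rad0 k)).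
  rewrite (ge0_muleDr _ _ g0); last exact: adde_ge0.
  by rewrite (ge0_muleDr _ (Q0 mu nu) (Q0 mu nu)).
apply: leeD2l.
rewrite big_ord_recl/=; apply: lee_paddr; last first.
  rewrite muleA -EFinM; apply: lee_wpmul2r; first exact: gap2_ge0.
  rewrite lee_fin invfM ler_wpM2r ?invr_ge0 ?(ltW (rad0 0))//.
  exact: trisum_coef.
apply: sume_ge0 => k _; apply: mule_ge0; first by rewrite lee_fin; exact: (w0 k.+1).
by rewrite mule_ge0 ?gap2_ge0// lee_fin invr_ge0 ltW.
Qed.

End TrisumPsd.

(** * The first-order condition for the smoothed kernel *)

Section EffectivePotential.
Context {R : realType}.
Local Open Scope ereal_scope.
Notation mR := (measurableTypeR R).
Notation leb := (@lebesgue_measure R).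

(** One-sided uniform continuity, fitted to averages over [y, y + s]; compactness of [-K, K] enters
    through near coverings. *)
Lemma segment_unif_continuous (f : R -> R) (K eta : R) : continuous f -> (0 < eta)%R ->
  exists2 d : R, (0 < d)%R & forall y s, (`|y| <= K)%R -> (0 <= s <= d)%R ->
    (f (y + s) <= f y + eta)%R.
Proof.
move=> cf eta0.
pose P (d : R) (y : R) := forall s, (0 <= s <= d)%R -> (f (y + s) <= f y + eta)%R.
have cK : compact `[(- K)%R, K]%classic by exact: segment_compact.
move/compact_near_coveringP : cK => /(_ R (0%R^'+) P _) H.
have {}H : \forall d \near 0%R^'+, `[(- K)%R, K]%classic `<=` P d.
  apply: H => x _.
  have /cvgrPdist_lt /(_ (eta / 2)%R) := cf x.
  rewrite divr_gt0// => /(_ isT) [d /= d0 Hd].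
  exists (ball x (d / 2)%R, [set e : R | (e < d / 2)%R]).
    split; first by apply: nbhsx_ballx; rewrite divr_gt0.
    by apply: nbhs_right_lt; rewrite divr_gt0.
  move=> [y e] [/= xy ed] s /andP[s0 se].
  have h1 := Hd y; have h2 := Hd (y + s)%R.
  move: h1 h2; rewrite /ball_/= in xy *.
  move=> h1 h2.
  have xy' : (`|x - y| < d / 2)%R by exact: xy.
  have {h1} : (`|f x - f y| < eta / 2)%R by apply: h1; lra.
  have {h2} : (`|f x - f (y + s)| < eta / 2)%R.
    apply: h2; have -> : (x - (y + s) = (x - y) - s)%R by ring.
    by apply: le_lt_trans (ler_normB _ _) _; rewrite (ger0_norm s0); lra.
  by rewrite !ltr_norml => /andP[? ?] /andP[? ?]; lra.
have [d [d0 Hd]] : exists d : R, (0 < d)%R /\ `[(- K)%R, K]%classic `<=` P d.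
  near (0%R : R)^'+ => d; exists d; split; first by near: d; exact: nbhs_right_gt.
  by near: d.
exists d => // y s yK; apply: Hd; by rewrite /= in_itv/= -ler_norml.
Unshelve. all: by end_near. Qed.

(** The cap leaves room for a lower bound of [Lk] at distances beyond r, where [trisum] vanishes. It
    is inactive on the support of sigma once r is large. *)
Definition capped_clog (r : R) (x : R) : R := Num.min (clog x) (ln (r / 2)).

Lemma capped_clog_ge0 r x : (2 <= r)%R -> (0 <= capped_clog r x)%R.
Proof.
by move=> r2; rewrite le_min clog_ge0 ln_ge0// ler_pdivlMr// mul1r.
Qed.

Lemma capped_clog_le r x : (capped_clog r x <= clog x)%R.
Proof. by rewrite ge_min lexx. Qed.

Lemma capped_clog_le_ln r x : (capped_clog r x <= ln (r / 2))%R.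
Proof. by rewrite ge_min lexx orbT. Qed.

Lemma capped_clogE r x : (2 * (1 + `|x|) <= r)%R -> capped_clog r x = clog x.
Proof.
move=> h; apply/min_idPl; rewrite /clog ler_ln ?posrE.
- by rewrite ler_pdivlMr// mulrC.
- by rewrite ltr_pwDl.
- by rewrite divr_gt0//; apply: lt_le_trans h; rewrite mulr_gt0// ltr_pwDl.
Qed.

Lemma measurable_capped_clog r : measurable_fun [set: mR] (capped_clog r : mR -> R).
Proof. by apply: measurable_minr => //; exact: measurable_clog. Qed.

Section fixed.
Variables (e q : R) (n : nat).
Hypotheses (e0 : (0 < e)%R) (q1 : (1 < q)%R).
Let r := (e * q ^+ n)%R.
Hypothesis r2 : (2 <= r)%R.

(** A minorant of [Lk] that is finite on the diagonal: [trisum] minus ln r + ln q replaces -log|x -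
    y|. *)
Definition Lmin (x y : R) : R :=
  (trisum e q n (x - y) - ln r - ln q + capped_clog r x + capped_clog r y)%R.

Let r0 : (0 < r)%R. Proof. exact: lt_le_trans r2. Qed.

Let ln_norm_sub_le x y : (`|y| <= `|x|)%R -> (r < `|x - y|)%R ->
  (ln `|x - y| <= ln r + (clog x - capped_clog r x))%R.
Proof.
move=> yx rxy; have xy0 : (0 < `|x - y|)%R by exact: lt_trans rxy.
apply: (@le_trans _ _ (ln r + (clog x - ln (r / 2)))%R); last first.
  by have := capped_clog_le_ln r x; lra.
rewrite ln_div ?posrE//.
have -> : (ln r + (clog x - (ln r - ln 2)) = ln (2 * (1 + `|x|)))%R.
  by rewrite [in RHS]lnM ?posrE ?ltr_pwDl// /clog; ring.
rewrite ler_ln ?posrE ?mulr_gt0 ?ltr_pwDl//.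
by have := ler_normB x y; lra.
Qed.

(** Up to distance r this is [trisum_upper]. Beyond it [trisum] is 0, and the point of larger
    modulus pays: |x - y| <= 2 (1 + |x|) if |y| <= |x|, so the slack of its cap covers log(|x - y| /
    r). *)
Lemma Lmin_le_Lk x y : (Lmin x y)%:E <= Lk x y.
Proof.
rewrite /Lk; case: eqVneq => [_|xy]; first by rewrite leey.
have u0 : (0 < `|x - y|)%R by rewrite normr_gt0 subr_eq0.
have lnq : (0 < ln q)%R by exact: ln_gt0.
rewrite lee_fin /Lmin.
have := capped_clog_le r x; have := capped_clog_le r y.
have [h|h] := leP `|x - y|%R r.
  by have := trisum_upper e0 q1 u0 h; rewrite -/r; lra.
rewrite trisum_out//; last exact: ltW.
have [yx|/ltW yx] := leP `|y|%R `|x|%R.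
  by have := ln_norm_sub_le yx h; lra.
by rewrite distrC in h *; have := ln_norm_sub_le yx h; lra.
Qed.

(** The price per particle for adding the diagonal to the sum over pairs; it does not depend on the
    particle. *)
Lemma Lmin_diag x : (Lmin x x <= 1 + (q - 1) * n%:R + ln r)%R.
Proof.
rewrite /Lmin; have := trisum_le e0 q1 n (x - x)%R.
have := capped_clog_le_ln r x; rewrite ln_div ?posrE//.
have : (0 < ln q)%R by exact: ln_gt0.
have : (0 <= ln (2 : R))%R by rewrite ln_ge0// ler1n.
by lra.
Qed.


Variable sigma : probability mR R.

Definition smooth_pot (y : mR) : \bar R := \int[sigma]_x (trisum e q n (y - x))%:E.

Let T0 (p : mR * mR) : 0 <= (trisum e q n (p.1 - p.2))%:E.
Proof. by rewrite lee_fin trisum_ge0. Qed.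

Lemma measurable_smooth_pot : measurable_fun [set: mR] smooth_pot.
Proof.
exact: (@measurable_fun_fubini_tonelli_F _ _ _ _ _ sigma _ (@measurable_trisum2 R e q n) T0).
Qed.

Lemma smooth_pot_ge0 y : 0 <= smooth_pot y.
Proof. by apply: integral_ge0 => x _; exact: (T0 (y, x)). Qed.

Lemma smooth_pot_le y : smooth_pot y <= (1 + (q - 1) * n%:R)%:E.
Proof.
rewrite -[leRHS](integral_probability_cst sigma); apply: ge0_le_integral => //.
- by move=> x _; exact: (T0 (y, x)).
- exact: (measurable_fun_pair2 y (@measurable_trisum2 R e q n)).
- by move=> x _; rewrite lee_fin trisum_le.
Qed.

Lemma smooth_pot_fin y : smooth_pot y \is a fin_num.
Proof. by rewrite ge0_fin_numE ?smooth_pot_ge0// (le_lt_trans (smooth_pot_le y))// ltry. Qed.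

(* The average of the logarithmic kernel over [y, y + e] is at most the smoothed
   kernel, up to a small error and an O(1) error on the event [|y - x| < M e]. *)
Lemma uniform_Lk_smooth (M : R) x y : (2 <= M)%R -> (e <= 1)%R -> (`|y - x| <= r)%R ->
  \int[uniform_prob e0]_s Lk (y + s)%R x + (ln r)%:E <=
  (clog y + clog x + trisum e q n (y - x) + (ln q + e + 2 / M) +
   (4 + ln M) * \1_[set z | (`|z - y| < M * e)%R] x)%:E.
Proof.
move=> M2 e1 ur.
have M0 : (0 < M)%R by lra.
have lnM0 : (0 <= ln M)%R by rewrite ln_ge0//; lra.
have M2' : (0 <= 2 / M)%R by rewrite divr_ge0// ltW.
have := trisum_lower e0 q1 ur; rewrite -/r => tl.
have [xy|xy] := ltP `|y - x|%R (M * e)%R.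
  rewrite indicE mem_set/=; last by rewrite distrC.
  apply: (@le_trans _ _ ((clog y + clog x + e + 4 - ln e)%:E + (ln r)%:E)).
    by apply: leeD2r; exact: uniform_Lk_near.
  have : (ln (Num.max `|y - x| e) <= ln M + ln e)%R.
    rewrite -lnM ?posrE// ler_ln ?posrE ?lt_max ?e0 ?orbT ?mulr_gt0// ge_max (ltW xy).
    by rewrite ler_peMl ?ltW//; lra.
  by rewrite -EFinD lee_fin mulr1; lra.
rewrite indicE memNset/=; last by rewrite distrC ltNge xy.
have ey : (e <= `|y - x|)%R by apply: le_trans xy; rewrite ler_peMl ?ltW//; lra.
apply: (@le_trans _ _ ((clog y + clog x - ln `|y - x| + e + 2 / M)%:E + (ln r)%:E)).
  by apply: leeD2r; exact: uniform_Lk_far.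
by rewrite (max_idPl ey) in tl; rewrite -EFinD lee_fin mulr0; lra.
Qed.

End fixed.

End EffectivePotential.
Section EffectivePotential2.
Context {R : realType}.
Local Open Scope ereal_scope.
Notation mR := (measurableTypeR R).
Notation leb := (@lebesgue_measure R).
Variables (beta : R) (Vt : R -> R).
Hypotheses (beta0 : (0 < beta)%R) (cVt : continuous Vt).
Hypothesis (Vt0 : forall x, (0 <= Vt x)%R).
Hypothesis growth : forall C : R, exists K : R, (0 < K)%R /\
  forall x, (K <= `|x|)%R -> (C * (1 + `|x|) <= Vt x)%R.
Variable sigma : probability mR R.
Hypothesis hmin : forall mu : probability mR R, eng beta Vt sigma <= eng beta Vt mu.

Notation engV := (engV Vt sigma).
Notation engI := (engI sigma).
Let engVE' := engVE beta0 cVt Vt0 hmin.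
Let engIE' := engIE beta0 cVt Vt0 hmin.
Let I0 := engI_ge0 sigma.
Let V0 := engV_ge0 Vt0 sigma.

(** Beyond R0 the confinement alone dominates all the constants of the effective potential, with a
    margin |x| to spare. This margin is what later makes the bound on the density integrable. *)
Definition large_radius (R0 : R) : Prop :=
  [/\ (1 <= R0)%R, sigma (~` [set x | (`|x| <= R0)%R]) = 0 &
   forall x, (R0 <= `|x|)%R ->
     (engV + beta * engI + beta * (ln (4 * R0) + 1) + `|x| <= Vt x)%R].

Lemma exists_large_radius : exists K0 : R, forall R0, (K0 <= R0)%R -> large_radius R0.
Proof.
have [K1 K10 HK1] := sigma_compact_support beta0 cVt Vt0 growth hmin.
have [K2 [K20 HK2]] := growth (engV + beta * engI + 5 * beta + 1).
exists (Num.max 1 (Num.max K1 K2))%R => R0.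
rewrite !ge_max => /and3P[R01 RK1 RK2]; split => //; first exact: HK1.
move=> x Rx; have := HK2 x (le_trans RK2 Rx).
have l4 : (ln (4 * R0) <= 4 * R0 - 1)%R by apply: ln_le_sub1; lra.
have bI : (0 <= beta * engI)%R by rewrite mulr_ge0// ltW.
have h1 : (beta * ln (4 * R0) <= beta * (4 * `|x| - 1))%R.
  by rewrite ler_pM2l//; lra.
have h2 : (0 <= (engV + beta * engI) * `|x|)%R by rewrite mulr_ge0// addr_ge0.
have h3 : (0 <= beta * `|x|)%R by rewrite mulr_ge0// ltW.
by have := beta0; lra.
Qed.

Lemma integral_clog_fin : \int[sigma]_x (clog x)%:E \is a fin_num.
Proof.
have [C HC] := clog_le_Vt Vt0 growth.
rewrite ge0_fin_numE; last by apply: integral_ge0 => x _; rewrite lee_fin clog_ge0.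
apply: (@le_lt_trans _ _ (\int[sigma]_x ((Vt x)%:E + `|C|%:E))).
  apply: ge0_le_integral => //.
  - by move=> x _; rewrite lee_fin clog_ge0.
  - by apply/measurable_EFinP; exact: measurable_clog.
  - by apply: emeasurable_funD => //; exact: measurable_EVt.
  - by move=> x _; rewrite -EFinD lee_fin; apply: le_trans (HC x) _; rewrite lerD2l ler_norm.
rewrite ge0_integralD//; last exact: measurable_EVt.
  by rewrite engVE' integral_probability_cst -EFinD ltry.
by move=> x _; rewrite lee_fin.
Qed.

Definition meanclog : R := fine (\int[sigma]_x (clog x)%:E).

Lemma meanclogE : \int[sigma]_x (clog x)%:E = meanclog%:E.
Proof. by rewrite fineK// integral_clog_fin. Qed.

Lemma meanclog_ge0 : (0 <= meanclog)%R.
Proof. by apply: fine_ge0; apply: integral_ge0 => x _; rewrite lee_fin clog_ge0. Qed.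

(** [uniform_Lk_smooth] integrated against sigma. Almost every x has |x| <= R0, hence lies within 2
    R0 of y, where the interpolation is accurate; the indicator integrates to at most c. *)
Lemma uniform_pot_smooth (e q M R0 c : R) (n : nat) (e0 : (0 < e)%R) y :
  (1 < q)%R -> (2 <= M)%R -> (e <= 1)%R -> (1 <= R0)%R ->
  (e * q ^+ n = 4 * R0)%R -> sigma (~` [set x | (`|x| <= R0)%R]) = 0 ->
  (`|y| <= R0)%R -> sigma [set z | (`|z - y| < M * e)%R] <= c%:E ->
  \int[uniform_prob e0]_s pot sigma (y + s)%R + (ln (4 * R0))%:E <=
  (clog y + meanclog + (ln q + e + 2 / M) + (4 + ln M) * c)%:E +
  smooth_pot e q n sigma y.
Proof.
move=> q1 M2 e1 R01 rE supp yR0 sc.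
have M0 : (0 < M)%R by lra.
have lnM0 : (0 <= ln M)%R by rewrite ln_ge0//; lra.
have M2' : (0 <= 2 / M)%R by rewrite divr_ge0// ltW.
have lnq0 : (0 < ln q)%R by exact: ln_gt0.
have lnR0 : (0 <= ln (4 * R0))%R by rewrite ln_ge0//; lra.
have mLs : measurable_fun [set: mR * mR] (fun z : mR * mR => Lk (y + z.1)%R z.2).
  apply: measurable_Lk_comp; last exact: measurable_snd.
  exact: (measurableT_comp (@measurable_shift R y) measurable_fst).
pose U := uniform_prob e0.
have L0 (z : mR * mR) : 0 <= Lk (y + z.1)%R z.2 by exact: Lk_ge0.
have -> : \int[U]_s pot sigma (y + s)%R = \int[sigma]_x \int[U]_s Lk (y + s)%R x.
  exact: (@fubini_tonelli _ _ _ _ _ U sigma _ mLs L0).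
have mU : measurable_fun [set: mR] (fun x : mR => \int[U]_s Lk (y + s)%R x).
  exact: (@measurable_fun_fubini_tonelli_G _ _ _ _ _ U _ mLs L0).
have U0 x : 0 <= \int[U]_s Lk (y + s)%R x by apply: integral_ge0 => s _; exact: Lk_ge0.
rewrite -[(ln (4 * R0))%:E](integral_probability_cst sigma) -ge0_integralD//.
pose B : set mR := [set z | (`|z - y| < M * e)%R].
have mB : measurable B.
  have -> : B = ball y (M * e)%R by apply/seteqP; split => z; rewrite /B /ball/= distrC.
  exact: measurable_ball.
pose g1 (x : mR) : \bar R := (clog x)%:E.
pose g2 (x : mR) : \bar R := (clog y + (ln q + e + 2 / M) + (4 + ln M) * \1_B x)%:E.
pose g3 (x : mR) : \bar R := (trisum e q n (y - x))%:E.
have mg1 : measurable_fun [set: mR] g1 by apply/measurable_EFinP; exact: measurable_clog.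
have mg2 : measurable_fun [set: mR] g2.
  by apply/measurable_EFinP; apply: measurable_funD => //; exact: measurable_funM.
have mg3 : measurable_fun [set: mR] g3.
  exact: (measurable_fun_pair2 y (@measurable_trisum2 R e q n)).
have g10 x : 0 <= g1 x by rewrite lee_fin clog_ge0.
have b0 : (0 <= clog y + (ln q + e + 2 / M))%R.
  by rewrite !addr_ge0 ?clog_ge0//; exact: ltW.
have g20 x : 0 <= g2 x.
  by rewrite lee_fin addr_ge0// mulr_ge0// addr_ge0.
have g30 x : 0 <= g3 x by rewrite lee_fin trisum_ge0.
apply: (@le_trans _ _ (\int[sigma]_x (g1 x + (g2 x + g3 x)))).
  apply: ae_ge0_le_integral => //.
  - by move=> x _; rewrite adde_ge0.
  - by apply: emeasurable_funD.
  - by move=> x _; rewrite !adde_ge0.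
  - by do 2 apply: emeasurable_funD => //.
  exists (~` [set x | (`|x| <= R0)%R]); split => //.
    by apply: measurableC; exact: measurable_abs_le.
  move=> x /=; apply: contra_not => xR0 _.
  have ur : (`|y - x| <= e * q ^+ n)%R.
    by rewrite rE; apply: le_trans (ler_normB _ _) _; lra.
  have r2 : (2 <= e * q ^+ n)%R by rewrite rE; lra.
  have := uniform_Lk_smooth e0 q1 M2 e1 ur; rewrite rE => h.
  by apply: le_trans h _; rewrite /g1 /g2 /g3 -!EFinD lee_fin; lra.
rewrite ge0_integralD//; last 2 first.
- by move=> x _; rewrite adde_ge0.
- exact: emeasurable_funD.
rewrite ge0_integralD// /g1 meanclogE addeA -/(smooth_pot e q n sigma y).
apply: leeD2r.
have -> : \int[sigma]_x g2 x = (clog y + (ln q + e + 2 / M))%:E + (4 + ln M)%:E * sigma B.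
  rewrite /g2; under eq_integral do rewrite EFinD EFinM.
  rewrite ge0_integralD//; last 2 first.
  - by move=> x _; rewrite -EFinM lee_fin mulr_ge0// addr_ge0.
  - by apply: measurable_funeM; apply/measurable_EFinP.
  rewrite integral_probability_cst ge0_integralZl_EFin//; last 2 first.
  - by apply/measurable_EFinP.
  - by rewrite addr_ge0.
  by rewrite integral_indic// setIT.
rewrite addeA -EFinD; apply: (@le_trans _ _ ((meanclog + (clog y + (ln q + e + 2 / M)))%:E +
  (4 + ln M)%:E * c%:E)).
  by apply: leeD2l; apply: lee_wpmul2l => //; rewrite lee_fin addr_ge0.
by rewrite -EFinM -EFinD lee_fin; lra.
Qed.


Lemma exists_small_node (q r e1 : R) : (1 < q)%R -> (0 < r)%R -> (0 < e1)%R ->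
  exists n : nat, (r / q ^+ n <= e1)%R.
Proof.
move=> q1 r0 e10; have q0 : (0 < q)%R by exact: lt_trans q1.
have : (fun n => q^-1 ^+ n : R)%R @ \oo --> (0 : R)%R.
  by apply: cvg_expr; rewrite ger0_norm ?invr_ge0 ?(ltW q0)// invf_lt1.
move/cvgr0Pnorm_lt => /(_ (e1 / r)%R); rewrite divr_gt0// => /(_ isT).
move=> [n _ /(_ n (leqnn n))] H.
exists n; rewrite -exprVn mulrC -ler_pdivlMr//; apply: le_trans (ltW H).
exact: ler_norm.
Qed.

(** Apply ln t <= t - 1 to t = 1 / sqrt e. It makes the self-energy term of [Euler_Lagrange] small
    with e. *)
Lemma N_mul_ln_le (e : R) : (0 < e)%R -> (- (e * ln e) <= 2 * Num.sqrt e)%R.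
Proof.
move=> e0; have s0 : (0 < Num.sqrt e)%R by rewrite sqrtr_gt0.
have se : (Num.sqrt e ^+ 2 = e)%R by rewrite sqr_sqrtr// ltW.
have h : (ln (Num.sqrt e)^-1 <= (Num.sqrt e)^-1 - 1)%R.
  by apply: ln_le_sub1; rewrite invr_gt0.
rewrite lnV ?posrE// in h.
have lnE : (ln e = 2 * ln (Num.sqrt e))%R.
  by rewrite -{1}se lnXn// mulr2n; ring.
have : (Num.sqrt e ^+ 2 * (- ln (Num.sqrt e)) <= Num.sqrt e ^+ 2 * (Num.sqrt e)^-1)%R.
  by rewrite ler_wpM2l ?sqr_ge0//; lra.
have -> : (Num.sqrt e ^+ 2 * (Num.sqrt e)^-1 = Num.sqrt e)%R by field; rewrite gt_eqF.
by rewrite se lnE; lra.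
Qed.

(** For |y| < R0, [Euler_Lagrange] with the averaged potential of sigma replaced by its smoothing
    through [uniform_pot_smooth]. For |y| >= R0 the growth of [Vt] suffices and leaves the surplus
    |y|. *)
Lemma effective_potential (R0 eta : R) : large_radius R0 -> (0 < eta)%R ->
  exists e q n, [/\ (0 < e)%R, (1 < q <= 2)%R, (e * q ^+ n = 4 * R0)%R &
  forall y, (engV + beta * engI - eta + beta * (ln (4 * R0) + ln q) +
      (if (R0 <= `|y|)%R then `|y| else 0))%:E <=
    (Vt y + beta * capped_clog (4 * R0) y + beta * meanclog)%:E +
      beta%:E * smooth_pot e q n sigma y].
Proof.
move=> [R01 supp far] eta0.
(* The unit of error: each error term below is bounded by a small multiple of beta t = eta / 32. *)
pose t := (eta / (32 * beta))%R.
have bt : (beta * t = eta / 32)%R by rewrite /t; field; rewrite gt_eqF.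
have t0 : (0 < t)%R by rewrite divr_gt0// mulr_gt0.
pose q : R := (1 + Num.min 1 t)%R.
have q1 : (1 < q)%R by rewrite ltrDl lt_min ltr01.
have q2 : (q <= 2)%R by rewrite /q; have : (Num.min 1 t <= 1)%R; [rewrite ge_min lexx|lra].
have lnqt : (ln q <= t)%R.
  apply: le_trans (ln_le_sub1 _) _; first exact: lt_trans q1.
  by rewrite /q; have : (Num.min 1 t <= t)%R; [rewrite ge_min lexx orbT|lra].
have lnq1 : (ln q <= 1)%R.
  by apply: le_trans (ln_le_sub1 _) _; [exact: lt_trans q1|lra].
have lnq0 : (0 < ln q)%R by exact: ln_gt0.
pose M : R := (Num.max 2 (2 / t))%R.
have M2 : (2 <= M)%R by rewrite le_max lexx.
have M0 : (0 < M)%R by lra.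
have lnM0 : (0 <= ln M)%R by rewrite ln_ge0//; lra.
have Mt : (2 / M <= t)%R.
  by rewrite ler_pdivrMr// -ler_pdivrMl// mulrC le_max lexx orbT.
pose c := (t / (4 + ln M))%R.
have c0 : (0 < c)%R by rewrite divr_gt0// ltr_pwDl.
have cM : ((4 + ln M) * c = t)%R by rewrite /c; field; rewrite gt_eqF// ltr_pwDl.
have [d1 d10 Hd1] := sigma_nonatomic beta0 cVt Vt0 hmin c0.
have eta40 : (0 < eta / 4)%R by rewrite divr_gt0.
have [d2 d20 Hd2] := segment_unif_continuous R0 cVt eta40.
(* One bound on e per error: the oscillation of [Vt] ([d2]), the mass of intervals of radius M e
   ([d1 / M]), and the two parts of the self-energy term, polynomial and logarithmic (the last
   two). *)
pose e1 : R := (Num.min (Num.min (1/2) t) (Num.min d2 (Num.min (d1 / M)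
  (Num.min (t / (engI + 2 * R0 + 7)) (t ^+ 2)))))%R.
have IR0 : (0 < engI + 2 * R0 + 7)%R by have := I0; lra.
have e10 : (0 < e1)%R.
  have a1 : (0 < 1 / 2 :> R)%R by lra.
  have a2 : (0 < d1 / M)%R by exact: divr_gt0.
  have a3 : (0 < t / (engI + 2 * R0 + 7))%R by exact: divr_gt0.
  have a4 : (0 < t ^+ 2)%R by exact: exprn_gt0.
  by rewrite !lt_min a1 t0 d20 a2 a3 a4.
have R00 : (0 < 4 * R0)%R by lra.
have [n Hn] := exists_small_node q1 R00 e10.
have q0 : (0 < q)%R by exact: lt_trans q1.
(* The largest node e q^n is then exactly 4 R0. *)
pose e := (4 * R0 / q ^+ n)%R.
have e0 : (0 < e)%R by rewrite divr_gt0// exprn_gt0.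
have rE : (e * q ^+ n = 4 * R0)%R by rewrite /e mulfVK// gt_eqF// exprn_gt0.
exists e, q, n; split => //; first by rewrite q1.
move: Hn; rewrite -/e !le_min => /andP[/andP[e12 et] /and3P[ed2 ed1 /andP[eIR et2]]].
move=> y; have [Ry|yR] := leP R0 `|y|%R.
  rewrite -[leLHS]adde0; apply: leeD; last first.
    by rewrite mule_ge0 ?lee_fin ?(ltW beta0)// smooth_pot_ge0.
  rewrite lee_fin.
  have h1 := far y Ry.
  have h2 : (0 <= beta * capped_clog (4 * R0) y)%R.
    by rewrite mulr_ge0 ?(ltW beta0)// capped_clog_ge0//; lra.
  have h3 : (0 <= beta * meanclog)%R by rewrite mulr_ge0 ?(ltW beta0)// meanclog_ge0.
  have h4 : (beta * ln q <= beta * 1)%R by rewrite ler_pM2l.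
  by lra.
have eM : (M * e <= d1)%R by rewrite mulrC -ler_pdivlMr.
have sc : sigma [set z | (`|z - y| < M * e)%R] <= c%:E.
  apply: le_trans (Hd1 y); apply: le_measure; rewrite ?inE.
  - have -> : [set z | (`|z - y| < M * e)%R] = ball y (M * e)%R.
      by apply/seteqP; split => z; rewrite /ball/= distrC.
    exact: measurable_ball.
  - have -> : [set z | (`|z - y| < d1)%R] = ball y d1.
      by apply/seteqP; split => z; rewrite /ball/= distrC.
    exact: measurable_ball.
  - by move=> z /= h; exact: lt_le_trans h eM.
have e1' : (e < 1)%R by lra.
have EL := Euler_Lagrange beta0 cVt Vt0 hmin e0 y e1'.
have UP := uniform_pot_smooth e0 q1 M2 (ltW e1') R01 rE supp (ltW yR) sc.
have UV : \int[uniform_prob e0]_s (Vt (y + s))%:E <= (Vt y + eta / 4)%:E.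
  rewrite -[leRHS](integral_uniform_cst e0); apply: le_integral_uniform => //.
  - apply: (measurableT_comp (measurable_EVt cVt)); exact: measurable_shift.
  - by move=> s; rewrite lee_fin.
  - by move=> s; rewrite lee_fin; apply: addr_ge0 => //; exact: ltW.
  - move=> s /andP[s0 se]; rewrite lee_fin; apply: Hd2; first exact: ltW.
    by rewrite s0 (le_trans se).
have UP0 : 0 <= \int[uniform_prob e0]_s pot sigma (y + s)%R.
  by apply: integral_ge0 => s _; exact: pot_ge0.
have UV0 : 0 <= \int[uniform_prob e0]_s (Vt (y + s))%:E.
  by apply: integral_ge0 => s _; rewrite lee_fin.
have sfin : smooth_pot e q n sigma y \is a fin_num by exact: smooth_pot_fin.
have yclog : (clog y <= R0)%R by apply: le_trans (clog_le_norm _) (ltW yR).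
have capE : capped_clog (4 * R0) y = clog y by apply: capped_clogE; lra.
rewrite capE -(fineK sfin); rewrite -(fineK sfin) in UP.
set sp := fine (smooth_pot e q n sigma y) in UP *.
move: UP EL UV UP0 UV0.
case: (\int[uniform_prob e0]_s pot sigma (y + s)%R) => [p| |] //.
case: (\int[uniform_prob e0]_s (Vt (y + s))%:E) => [v| |] //.
rewrite -!(EFinM, EFinD) !lee_fin cM => UP EL UV _ _.
have elne := N_mul_ln_le e0.
have sqt : (Num.sqrt e <= t)%R.
  by rewrite -(ger0_norm (ltW t0)) -sqrtr_sqr ler_wsqrtr.
have eIt : (e * (engI + 2 * R0 + 7) <= t)%R by rewrite -ler_pdivlMr.
have h1 : (beta / 2 * e * (engI + (2 * clog y + 3 * e + 4 - ln e)) <= 3 / 2 * (beta * t))%R.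
  have : (e * (engI + (2 * clog y + 3 * e + 4 - ln e)) <= 3 * t)%R.
    have : (e * (engI + 2 * clog y + 3 * e + 4) <= e * (engI + 2 * R0 + 7))%R.
      by rewrite ler_pM2l//; lra.
    by lra.
  by move=> h; have := ler_wpM2l (ltW beta0) h; lra.
have h2 : (beta * p <= beta * (clog y + meanclog + (ln q + e + 2 / M) + t + sp - ln (4 * R0)))%R.
  by rewrite ler_pM2l//; lra.
have h3 : (beta * (ln q + ln q + e + 2 / M) <= beta * (4 * t))%R.
  by rewrite ler_pM2l//; lra.
by lra.
Qed.

End EffectivePotential2.

(** * Upper bound on the density of the ensemble *)

Lemma sum_ord_const (R : pzSemiRingType) N (a : R) : \sum_(i < N) a = N%:R * a.
Proof. by rewrite sumr_const card_ord mulr_natl. Qed.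

Lemma sum_pairs (R : realType) N (F : 'I_N -> 'I_N -> R) : (forall i j, F i j = F j i) ->
  \sum_(i < N) \sum_(j < N) F i j =
  2 * (\sum_(i < N) \sum_(j < N | (i < j)%N) F i j) + \sum_(i < N) F i i.
Proof.
move=> Fsym.
have E i : \sum_(j < N) F i j = \sum_(j < N | (i < j)%N) F i j +
    (F i i + \sum_(j < N | (j < i)%N) F i j).
  rewrite (bigID (fun j : 'I_N => (i < j)%N))/=; congr (_ + _).
  rewrite (bigD1 i)/= ?ltnn//; congr (_ + _).
  by apply: eq_bigl => j; rewrite -leqNgt ltn_neqAle andbC -val_eqE.
under eq_bigr do rewrite E.
rewrite !big_split/=.
have -> : \sum_(i < N) \sum_(j < N | (j < i)%N) F i j =
    \sum_(i < N) \sum_(j < N | (i < j)%N) F i j.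
  rewrite (exchange_big_dep predT)//=; apply: eq_bigr => i _.
  by apply: eq_bigr => j _.
by ring.
Qed.

Section WeightBound.
Context {R : realType}.
Notation mR := (measurableTypeR R).
Notation leb := (@lebesgue_measure R).
Variables (beta : R) (Vt V : R -> R) (c1 : R).
Hypotheses (beta0 : (0 < beta)%R) (cVt : continuous Vt).
Hypothesis (Vt0 : forall x, (0 <= Vt x)%R).
Hypothesis growth : forall C : R, exists K : R, (0 < K)%R /\
  forall x, (K <= `|x|)%R -> (C * (1 + `|x|) <= Vt x)%R.
Hypothesis VE : forall x, (V x = Vt x + beta * clog x - c1)%R.

(** Each particle is in N - 1 pairs, whereas the factor N in front of V brings N copies of its
    [clog]: one copy per particle is left over. *)
Lemma weight_exponent N (l : N.-tuple mR) :
  beta * (\sum_(i < N) \sum_(j < N | (i < j)%N) (clog (tnth l i) + clog (tnth l j)))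
    - N%:R * \sum_(i < N) V (tnth l i) =
  N%:R ^+ 2 * c1 - N%:R * (\sum_(i < N) Vt (tnth l i))
    - beta * \sum_(i < N) clog (tnth l i).
Proof.
have h1 := @sum_pairs R N (fun i j => clog (tnth l i) + clog (tnth l j)) (fun i j => addrC _ _).
have h1l : \sum_(i < N) \sum_(j < N) (clog (tnth l i) + clog (tnth l j)) =
    2 * N%:R * \sum_(i < N) clog (tnth l i).
  under eq_bigr do rewrite big_split/= sum_ord_const.
  by rewrite big_split/= sum_ord_const -mulr_sumr; ring.
rewrite h1l big_split/= in h1.
have -> : \sum_(i < N) V (tnth l i) = \sum_(i < N) Vt (tnth l i) +
    beta * (\sum_(i < N) clog (tnth l i)) - N%:R * c1.
  under eq_bigr do rewrite VE.
  by rewrite big_split/= big_split/= -mulr_sumr sumrN sum_ord_const.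
set S1 := \sum_(i < N) \sum_(j < N | (i < j)%N) (clog (tnth l i) + clog (tnth l j)) in h1 *.
set c := \sum_(i < N) clog (tnth l i) in h1 *.
have -> : S1 = (N%:R - 1) * c by lra.
by ring.
Qed.

(** A minorant of [Lk] gives a majorant of the weight. By symmetry the sum over pairs is half the
    double sum without its diagonal, and the leftover -beta sum [clog] is at most 0. *)
Lemma weight_le_kernel N (l : N.-tuple mR) (L : R -> R -> R) :
  (forall x y, L x y = L y x) -> (forall x y, ((L x y)%:E <= Lk x y)%E) ->
  beta_weight V beta l <=
  expR (N%:R ^+ 2 * c1 - N%:R * \sum_(i < N) Vt (tnth l i)
    - beta / 2 * (\sum_(i < N) \sum_(j < N) L (tnth l i) (tnth l j) -
                  \sum_(i < N) L (tnth l i) (tnth l i))).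
Proof.
move=> Lsym LLk.
have pairle x y : `|x - y| `^ beta <= expR (beta * (clog x + clog y - L x y)).
  have := LLk x y; rewrite /Lk; case: eqVneq => [->|xy].
    by rewrite subrr normr0 powR0 ?expR_ge0// gt_eqF.
  rewrite lee_fin => h; rewrite /powR normr_eq0 subr_eq0 (negbTE xy) ler_expR.
  by rewrite ler_pM2l//; lra.
rewrite /beta_weight.
apply: (@le_trans _ _ ((\prod_(i < N) \prod_(j < N | (i < j)%N)
    expR (beta * (clog (tnth l i) + clog (tnth l j) - L (tnth l i) (tnth l j)))) *
    expR (- N%:R * \sum_(i < N) V (tnth l i)))).
  rewrite ler_wpM2r ?expR_ge0//; apply: ler_prod => i _.
  rewrite prodr_ge0/=; last by move=> j _; rewrite powR_ge0.
  by apply: ler_prod => j _; rewrite powR_ge0 pairle.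
under eq_bigr do rewrite -expR_sum.
rewrite -expR_sum -expRD ler_expR.
set s := \sum_(i < N) \sum_(j < N | _) _.
have sE : s = beta * (\sum_(i < N) \sum_(j < N | (i < j)%N) (clog (tnth l i) + clog (tnth l j)))
   - beta * (\sum_(i < N) \sum_(j < N | (i < j)%N) L (tnth l i) (tnth l j)).
  rewrite -mulrBr -sumrB mulr_sumr; apply: eq_bigr => i _.
  by rewrite -sumrB mulr_sumr.
have h2 := @sum_pairs R N (fun i j => L (tnth l i) (tnth l j)) (fun i j => Lsym _ _).
have := weight_exponent l.
rewrite sE; set S2 := \sum_(i < N) \sum_(j < N | (i < j)%N) L (tnth l i) (tnth l j) in h2 *.
rewrite h2; set c := \sum_(i < N) clog (tnth l i).
have c0 : 0 <= beta * c by rewrite mulr_ge0 ?(ltW beta0)// sumr_ge0// => i _; exact: clog_ge0.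
by rewrite mulNr; lra.
Qed.


Definition emp N (l : N.+1.-tuple mR) : probability mR R := empirical N (nth 0 l).

Lemma integral_emp N (l : N.+1.-tuple mR) (g : mR -> \bar R) :
  measurable_fun [set: mR] g -> (forall x, (0 <= g x)%E) ->
  (\int[emp l]_x g x = (N.+1%:R^-1)%:E * \sum_(i < N.+1) g (tnth l i))%E.
Proof.
move=> mg g0; rewrite [LHS]integral_empirical//; congr (_ * _)%E.
by apply: eq_bigr => i _; rewrite (tnth_nth 0).
Qed.

(** [trisum_psd] for the empirical measure and sigma, multiplied by the square of the number of
    particles: the double sum is at least its linearisation at sigma plus the gap. The gap is finite
    because everything on the other side is. *)
Lemma double_sum_lower (e q : R) n (sigma : probability mR R) N (l : N.+1.-tuple mR) :
  0 < e -> 1 < q ->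
  let r := e * q ^+ n in let G := gap2 r (emp l) sigma in
  (G \is a fin_num) /\
  2 * N.+1%:R * (\sum_(i < N.+1) fine (smooth_pot e q n sigma (tnth l i)))
    - N.+1%:R ^+ 2 * fine (\int[sigma]_x smooth_pot e q n sigma x)
    + N.+1%:R ^+ 2 * ((q * r)^-1 * fine G) <=
  \sum_(i < N.+1) \sum_(j < N.+1) trisum e q n (tnth l i - tnth l j).
Proof.
move=> e0 q1 r G.
have q0 : 0 < q by exact: lt_trans q1.
have r0 : 0 < r by rewrite mulr_gt0// exprn_gt0.
have := @trisum_psd R e q n e0 q1 (emp l) sigma; rewrite -/r -/G.
have EE : trisumQ e q n (emp l) sigma =
    (N.+1%:R^-1 * \sum_(i < N.+1) fine (smooth_pot e q n sigma (tnth l i)))%:E.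
  rewrite /trisumQ -/(smooth_pot e q n sigma _) integral_emp; last 2 first.
  - exact: measurable_smooth_pot.
  - by move=> x; exact: smooth_pot_ge0.
  rewrite EFinM; congr (_ * _)%E; rewrite -sumEFin; apply: eq_bigr => i _.
  by rewrite fineK// smooth_pot_fin.
have E2 : trisumQ e q n (emp l) (emp l) =
    (N.+1%:R^-1 * \sum_(i < N.+1) (N.+1%:R^-1 *
      \sum_(j < N.+1) trisum e q n (tnth l i - tnth l j)))%:E.
  rewrite /trisumQ -/(smooth_pot e q n (emp l) _) integral_emp; last 2 first.
  - exact: measurable_smooth_pot.
  - by move=> x; exact: smooth_pot_ge0.
  rewrite EFinM; congr (_ * _)%E; rewrite -sumEFin; apply: eq_bigr => i _.
  rewrite /smooth_pot integral_emp; last 2 first.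
  - exact: (measurable_fun_pair2 _ (@measurable_trisum2 R e q n)).
  - by move=> x; rewrite lee_fin trisum_ge0.
  by rewrite EFinM -sumEFin.
have s2fin : (\int[sigma]_x smooth_pot e q n sigma x)%E \is a fin_num.
  rewrite ge0_fin_numE; last by apply: integral_ge0 => x _; exact: smooth_pot_ge0.
  apply: (@le_lt_trans _ _ (\int[sigma]_x (1 + (q - 1) * n%:R)%:E)%E).
    apply: ge0_le_integral => //.
    - by move=> x _; exact: smooth_pot_ge0.
    - exact: measurable_smooth_pot.
    - by move=> x _; exact: smooth_pot_le.
  by rewrite integral_probability_cst ltry.
have QS : trisumQ e q n sigma sigma = (\int[sigma]_x smooth_pot e q n sigma x)%E by [].
rewrite EE E2 QS -(fineK s2fin).
have G0 : (0 <= G)%E by exact: gap2_ge0.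
have k0 : 0 < (q * r)^-1 by rewrite invr_gt0 mulr_gt0.
case: G G0 => [g| |]// g0; last by rewrite gt0_muley ?lte_fin// addey.
rewrite -!(EFinM, EFinD) lee_fin => h; split=> //=.
have N0 : 0 < N.+1%:R :> R by [].
have N20 : 0 < N.+1%:R ^+ 2 :> R by rewrite exprn_gt0.
move: h; rewrite -mulr_sumr -(ler_pM2l N20).
set A := \sum_(i < N.+1) fine _; set B := \sum_(i < N.+1) \sum_(j < N.+1) _; set C := fine _.
have -> : N.+1%:R ^+ 2 * (N.+1%:R^-1 * A + N.+1%:R^-1 * A + (q * r)^-1 * g) =
   2 * N.+1%:R * A + N.+1%:R ^+ 2 * ((q * r)^-1 * g).
  by field; rewrite !gt_eqF.
have -> : N.+1%:R ^+ 2 * (N.+1%:R^-1 * (N.+1%:R^-1 * B) + C) = B + N.+1%:R ^+ 2 * C.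
  by field.
by lra.
Qed.

Variable sigma : probability mR R.
Hypothesis hmin : forall mu : probability mR R, (eng beta Vt sigma <= eng beta Vt mu)%E.

Definition min_energy : R := engV Vt sigma + beta / 2 * engI sigma.

Lemma integral_capped_clog R0 : large_radius beta Vt sigma R0 ->
  (\int[sigma]_x (capped_clog (4 * R0) x)%:E = (meanclog sigma)%:E)%E.
Proof.
move=> [R01 supp _]; rewrite -(meanclogE beta0 cVt Vt0 growth hmin).
apply: ge0_ae_eq_integral => //.
- by apply/measurable_EFinP; exact: measurable_capped_clog.
- by apply/measurable_EFinP; exact: measurable_clog.
- by move=> x _; rewrite lee_fin capped_clog_ge0//; lra.
- by move=> x _; rewrite lee_fin clog_ge0.
exists (~` [set x | (`|x| <= R0)%R]); split => //.
  by apply: measurableC; exact: measurable_abs_le.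
move=> x /=; apply: contra_not => xR0 _.
by rewrite capped_clogE//; lra.
Qed.

(** The inequality [Lmin_le_Lk] integrated twice against sigma: smoothing raises the self-energy by
    at most ln q. *)
Lemma smooth_energy_le (e q R0 : R) n : large_radius beta Vt sigma R0 ->
  0 < e -> 1 < q -> e * q ^+ n = 4 * R0 ->
  fine (\int[sigma]_x smooth_pot e q n sigma x) + 2 * meanclog sigma <=
  engI sigma + ln (4 * R0) + ln q.
Proof.
move=> hR0 e0 q1 rE; have [R01 _ _] := hR0.
have r2 : 2 <= e * q ^+ n by rewrite rE; lra.
have mcap := @measurable_capped_clog R (4 * R0).
have cap0 x : 0 <= capped_clog (4 * R0) x by apply: capped_clog_ge0; lra.
have lnq0 : 0 < ln q by exact: ln_gt0.
have lnr0 : 0 <= ln (4 * R0) by rewrite ln_ge0//; lra.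
have mT x := measurable_fun_pair2 x (@measurable_trisum2 R e q n).
have inner x : (smooth_pot e q n sigma x + (capped_clog (4 * R0) x + meanclog sigma)%:E <=
    pot sigma x + (ln (4 * R0) + ln q)%:E)%E.
  rewrite -[X in (_ <= _ + X)%E](integral_probability_cst sigma) -ge0_integralD//; last 3 first.
  - by move=> y _; exact: Lk_ge0.
  - exact: measurable_Lk_comp.
  - by move=> y _; rewrite lee_fin addr_ge0// ltW.
  apply: (@le_trans _ _ (\int[sigma]_y ((trisum e q n (x - y))%:E +
     ((capped_clog (4 * R0) x)%:E + (capped_clog (4 * R0) y)%:E)))%E).
    rewrite ge0_integralD//; last 4 first.
    - by move=> y _; rewrite lee_fin trisum_ge0.
    - exact: mT.
    - by move=> y _; rewrite -EFinD lee_fin addr_ge0.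
    - by apply: emeasurable_funD => //; exact/measurable_EFinP.
    apply: leeD2l; rewrite ge0_integralD//; last 3 first.
    - by move=> y _; rewrite lee_fin.
    - by move=> y _; rewrite lee_fin.
    - exact/measurable_EFinP.
    by rewrite integral_probability_cst (integral_capped_clog hR0) EFinD.
  apply: ge0_le_integral => //.
  - by move=> y _; rewrite -!EFinD lee_fin !addr_ge0// trisum_ge0.
  - apply: emeasurable_funD; first exact: mT.
    by apply: emeasurable_funD => //; exact/measurable_EFinP.
  - by apply: emeasurable_funD => //; exact: measurable_Lk_comp.
  move=> y _; have := Lmin_le_Lk e0 q1 r2 x y; rewrite /Lmin rE.
  case: (Lk x y) => [L| |] //; rewrite -!EFinD ?lee_fin ?leey//; lra.
have s2fin : (\int[sigma]_x smooth_pot e q n sigma x)%E \is a fin_num.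
  rewrite ge0_fin_numE; last by apply: integral_ge0 => x _; exact: smooth_pot_ge0.
  apply: (@le_lt_trans _ _ (\int[sigma]_x (1 + (q - 1) * n%:R)%:E)%E).
    apply: ge0_le_integral => //.
    - by move=> x _; exact: smooth_pot_ge0.
    - exact: measurable_smooth_pot.
    - by move=> x _; exact: smooth_pot_le.
  by rewrite integral_probability_cst ltry.
have mc0 := meanclog_ge0 sigma.
rewrite -lee_fin.
have -> : (engI sigma + ln (4 * R0) + ln q)%:E =
    (\int[sigma]_x (pot sigma x + (ln (4 * R0) + ln q)%:E))%E.
  rewrite ge0_integralD//.
  - by rewrite (engIE beta0 cVt Vt0 hmin) integral_probability_cst -EFinD addrA.
  - by move=> x _; exact: pot_ge0.
  - exact: measurable_pot.
  - by move=> x _; rewrite lee_fin addr_ge0// ltW.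
have -> : (fine (\int[sigma]_x smooth_pot e q n sigma x) + 2 * meanclog sigma)%:E =
    (\int[sigma]_x (smooth_pot e q n sigma x + (capped_clog (4 * R0) x + meanclog sigma)%:E))%E.
  have S0 x : (0 <= smooth_pot e q n sigma x)%E by exact: smooth_pot_ge0.
  have mS : measurable_fun [set: mR] (smooth_pot e q n sigma).
    exact: measurable_smooth_pot.
  have C0 x : (0 <= (capped_clog (4 * R0) x + meanclog sigma)%:E)%E.
    by rewrite lee_fin addr_ge0.
  have mC : measurable_fun [set: mR]
      (fun x : mR => (capped_clog (4 * R0) x + meanclog sigma)%:E).
    by apply/measurable_EFinP; apply: measurable_funD.
  transitivity (\int[sigma]_x smooth_pot e q n sigma x +
      \int[sigma]_x (capped_clog (4 * R0) x + meanclog sigma)%:E)%E; last first.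
    by apply/esym/ge0_integralD.
  rewrite EFinD fineK//; congr (_ + _)%E.
  under eq_integral do rewrite EFinD.
  rewrite ge0_integralD//; last 2 first.
  - by move=> x _; rewrite lee_fin.
  - exact/measurable_EFinP.
  by rewrite integral_probability_cst (integral_capped_clog hR0) -EFinD; congr (_%:E); ring.
apply: ge0_le_integral => //.
- by move=> x _; rewrite adde_ge0 ?smooth_pot_ge0// lee_fin addr_ge0.
- apply: emeasurable_funD; first exact: measurable_smooth_pot.
  by apply/measurable_EFinP; apply: measurable_funD.
- by apply: emeasurable_funD => //; exact: measurable_pot.
Qed.

(** With [Lmin] in place of the kernel, [double_sum_lower] linearises the interaction at sigma,
    [effective_potential] bounds the linear part below by a constant per particle plus the outer
    surplus, and [smooth_energy_le] brings the constants together into [min_energy]. The diagonal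
    only contributes to the term linear in the number of particles. *)
Lemma weight_le_gap (R0 eta : R) : large_radius beta Vt sigma R0 -> 0 < eta ->
  exists C : R, forall N (l : N.+1.-tuple mR),
    let G := gap2 (4 * R0) (emp l) sigma in
    (G \is a fin_num) /\
    beta_weight V beta l <=
    expR (N.+1%:R ^+ 2 * (c1 - min_energy + eta - beta / (16 * R0) * fine G)
      - N.+1%:R * (\sum_(i < N.+1) (if R0 <= `|tnth l i| then `|tnth l i| else 0))
      + N.+1%:R * C).
Proof.
move=> hR0 eta0; have [R01 _ _] := hR0.
have [e [q [n [e0 /andP[q1 q2] rE EP]]]] :=
  effective_potential beta0 cVt Vt0 growth hmin hR0 eta0.
have r2 : 2 <= e * q ^+ n by rewrite rE; lra.
exists (beta / 2 * (1 + (q - 1) * n%:R + ln (4 * R0))) => N l G.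
have [Gfin DS] := @double_sum_lower e q n sigma N l e0 q1.
rewrite rE -/G in Gfin DS; split => //.
have Lsym x y : Lmin e q n x y = Lmin e q n y x by rewrite /Lmin trisum_sym; ring.
have Lle x y := Lmin_le_Lk e0 q1 r2 x y.
apply: le_trans (weight_le_kernel l Lsym Lle) _.
rewrite ler_expR.
have q0 : 0 < q by exact: lt_trans q1.
have SE := smooth_energy_le hR0 e0 q1 rE.
set s2 := fine (\int[sigma]_x _)%E in SE DS.
pose sp i := fine (smooth_pot e q n sigma (tnth l i)).
rewrite -/(sp _) in DS.
have LD : \sum_(i < N.+1) Lmin e q n (tnth l i) (tnth l i) <=
    N.+1%:R * (1 + (q - 1) * n%:R + ln (4 * R0)).
  apply: le_trans (ler_sum _ (fun i _ => Lmin_diag e0 q1 r2 (tnth l i))) _.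
  by rewrite sum_ord_const rE.
have LS : \sum_(i < N.+1) \sum_(j < N.+1) Lmin e q n (tnth l i) (tnth l j) =
    \sum_(i < N.+1) \sum_(j < N.+1) trisum e q n (tnth l i - tnth l j)
    - N.+1%:R ^+ 2 * (ln (4 * R0) + ln q)
    + 2 * N.+1%:R * \sum_(i < N.+1) capped_clog (4 * R0) (tnth l i).
  have -> : 2 * N.+1%:R * \sum_(i < N.+1) capped_clog (4 * R0) (tnth l i) =
    \sum_(i < N.+1) \sum_(j < N.+1) (capped_clog (4 * R0) (tnth l i) + capped_clog (4 * R0) (tnth l j)).
    under [RHS]eq_bigr do rewrite big_split/= sum_ord_const.
    by rewrite big_split/= sum_ord_const -mulr_sumr; ring.
  have -> : N.+1%:R ^+ 2 * (ln (4 * R0) + ln q) =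
    \sum_(i < N.+1) \sum_(j < N.+1) (ln (4 * R0) + ln q).
    by rewrite !sum_ord_const; ring.
  rewrite -sumrB -big_split/=; apply: eq_bigr => i _.
  rewrite -sumrB -big_split/=; apply: eq_bigr => j _.
  by rewrite /Lmin rE; ring.
have EPs : \sum_(i < N.+1) (engV Vt sigma + beta * engI sigma - eta + beta * (ln (4 * R0) + ln q)
     + (if R0 <= `|tnth l i| then `|tnth l i| else 0)) <=
   \sum_(i < N.+1) (Vt (tnth l i) + beta * capped_clog (4 * R0) (tnth l i) + beta * meanclog sigma
     + beta * sp i).
  apply: ler_sum => i _; have := EP (tnth l i).
  have sfin : smooth_pot e q n sigma (tnth l i) \is a fin_num by exact: smooth_pot_fin.
  by rewrite -(fineK sfin) -EFinM -EFinD lee_fin.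
rewrite !big_split/= !sum_ord_const -!mulr_sumr in EPs.
rewrite LS; move: EPs.
set th := \sum_(i < N.+1) (if _ then _ else _).
set SV := \sum_(i < N.+1) Vt _; set SC := \sum_(i < N.+1) capped_clog _ _ in LS *.
set SP := \sum_(i < N.+1) sp _ in DS *.
move=> EPs.
have N0 : 0 < N.+1%:R :> R by [].
have b2 : 0 < beta / 2 by rewrite divr_gt0.
have g0 : 0 <= fine G by apply: fine_ge0; exact: gap2_ge0.
(* Here q <= 2 removes q from the coefficient of the gap. *)
have kap : (8 * R0)^-1 * fine G <= (q * (4 * R0))^-1 * fine G.
  apply: ler_wpM2r => //; rewrite lef_pV2 ?posrE ?mulr_gt0//; try lra.
  have := ler_wpM2r (_ : 0 <= 4 * R0) q2; lra.
have h1 := ler_wpM2l (ltW N0) EPs.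
have h2 := ler_wpM2l (ltW b2) DS.
have h3 := ler_wpM2l (ltW b2) LD.
have h4 := ler_wpM2l (ltW (mulr_gt0 b2 (exprn_gt0 2 N0))) SE.
have h5 := ler_wpM2l (ltW (mulr_gt0 b2 (exprn_gt0 2 N0))) kap.
rewrite /min_energy.
have -> : beta / (16 * R0) * fine G = beta / 2 * ((8 * R0)^-1 * fine G).
  by field; rewrite gt_eqF//; lra.
rewrite expr2 in h2 h4 h5 *.
by lra.
Qed.

End WeightBound.

(** * Lower bound on the partition function *)

Section PartitionLowerBound.
Context {R : realType}.
Local Open Scope ereal_scope.
Notation mR := (measurableTypeR R).
Notation leb := (@lebesgue_measure R).
Notation pow := (power_measure leb).
Variables (sigma : probability mR R) (e : R) (e0 : (0 < e)%R).

(** Under [P] the variable [X] has the law of sigma convolved with the uniform law on [0, e], whose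
    density is at most 1/e. *)
Let P : probability (mR * mR)%type R := (sigma \x uniform_prob e0)%E.
Let X (z : mR * mR) : mR := (z.1 + z.2)%R.

Let mX : measurable_fun [set: mR * mR] X.
Proof. exact: (@measurable_funD _ (mR * mR)%type R setT fst snd measurable_fst measurable_snd). Qed.

Lemma smoothed_integralE (g : mR -> \bar R) :
  measurable_fun [set: mR] g -> (forall x, 0 <= g x) ->
  \int[P]_z g (X z) = \int[sigma]_x \int[uniform_prob e0]_s g (x + s)%R.
Proof.
move=> mg g0; have mgX : measurable_fun [set: mR * mR] (g \o X) by exact: measurableT_comp.
exact: (@fubini_tonelli1 _ _ _ _ _ sigma (uniform_prob e0) _ mgX (fun z => g0 _)).
Qed.

Lemma smoothed_integral_le (g : mR -> \bar R) :
  measurable_fun [set: mR] g -> (forall x, 0 <= g x) ->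
  e%:E * \int[P]_z g (X z) <= \int[leb]_x g x.
Proof.
move=> mg g0; rewrite smoothed_integralE// -lee_pdivlMl//.
rewrite -[leRHS](integral_probability_cst sigma); apply: ge0_le_integral => //.
- by move=> x _; exact: integral_ge0.
- have mgX : measurable_fun [set: mR * mR] (g \o X) by exact: measurableT_comp.
  exact: (@measurable_fun_fubini_tonelli_F _ _ _ _ _ (uniform_prob e0) _ mgX (fun z => g0 _)).
- move=> x _; have mgx : measurable_fun [set: mR] (fun s : mR => g (x + s)%R).
    exact: (measurableT_comp mg (@measurable_shift R x)).
  rewrite integral_uniform// subr0; apply: lee_wpmul2l; first by rewrite lee_fin invr_ge0 ltW.
  rewrite -(ge0_integral_shift x mg g0); apply: ge0_subset_integral => //.
Qed.

Variables (beta : R) (beta0 : (0 < beta)%R).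

Definition gibbs_energy (W : mR -> \bar R) N (l : N.-tuple mR) : \bar R :=
  \sum_(i < N) W (tnth l i) +
  \sum_(i < N) \sum_(j < N | (i < j)%N) beta%:E * Lk (tnth l i) (tnth l j).

Let bL0 x y : 0 <= beta%:E * Lk x y.
Proof. by apply: mule_ge0; [rewrite lee_fin ltW|exact: Lk_ge0]. Qed.

Lemma gibbs_energy_ge0 W N (l : N.-tuple mR) : (forall x, 0 <= W x) -> 0 <= gibbs_energy W l.
Proof.
by move=> W0; apply: adde_ge0; do !apply: sume_ge0 => ? _.
Qed.

Lemma measurable_gibbs_energy W N : measurable_fun [set: mR] W ->
  measurable_fun [set: N.-tuple mR] (gibbs_energy W (N := N)).
Proof.
move=> mW; apply: emeasurable_funD.
  apply: emeasurable_sum => i.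
  exact: (measurableT_comp mW (@measurable_tnth _ mR N i)).
apply: emeasurable_sum => i; under eq_fun do rewrite big_mkcond.
apply: emeasurable_sum => j; case: (i < j)%N; last exact: measurable_cst.
by apply: measurable_funeM; apply: measurable_Lk_comp; exact: measurable_tnth.
Qed.

Let U (y : mR) : \bar R := \int[P]_z (beta%:E * Lk (X z) y).

Let U0 y : 0 <= U y. Proof. by apply: integral_ge0. Qed.

Let mLX : measurable_fun [set: (mR * mR) * mR]
  (fun p : (mR * mR) * mR => beta%:E * Lk (X p.1) p.2).
Proof.
apply: measurable_funeM; apply: measurable_Lk_comp; last exact: measurable_snd.
exact: (measurableT_comp mX measurable_fst).
Qed.

Let mU : measurable_fun [set: mR] U.
Proof.
exact: (@measurable_fun_fubini_tonelli_G _ _ _ _ _ P _ mLX (fun p => bL0 _ _)).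
Qed.

Lemma gibbs_energy_cons W N x (l : N.-tuple mR) :
  gibbs_energy W (cons_pair (x, l)) =
  (W x + \sum_(j < N) beta%:E * Lk x (tnth l j)) + gibbs_energy W l.
Proof.
rewrite /gibbs_energy !big_ord_recl/= tnth0.
under eq_bigr do rewrite tnthS.
have -> : \sum_(j < N.+1 | (0 < j)%N) beta%:E * Lk x (tnth (cons_pair (x, l)) j) =
    \sum_(j < N) beta%:E * Lk x (tnth l j).
  rewrite big_mkcond big_ord_recl/= add0e; apply: eq_bigr => j _.
  by rewrite tnthS.
have -> : \sum_(i < N) \sum_(j < N.+1 | (lift ord0 i < j)%N)
      beta%:E * Lk (tnth (cons_pair (x, l)) (lift ord0 i)) (tnth (cons_pair (x, l)) j) =
    \sum_(i < N) \sum_(j < N | (i < j)%N) beta%:E * Lk (tnth l i) (tnth l j).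
  apply: eq_bigr => i _; rewrite big_mkcond big_ord_recl/= add0e [RHS]big_mkcond.
  by apply: eq_bigr => j _; rewrite !tnthS.
by rewrite addeACA.
Qed.

(** Jensen's inequality one particle at a time. Integrating out a particle against the smoothed law
    adds its mean interaction [U] to the one-body potential of the remaining ones, so the induction
    must run over all [W]. The mean of [W] grows by k at each step, whence N (N - 1) / 2 copies of k
    in the end. *)
Lemma gibbs_jensen N (W : mR -> \bar R) (w k : R) :
  measurable_fun [set: mR] W -> (forall x, 0 <= W x) ->
  \int[P]_z W (X z) = w%:E -> \int[P]_z U (X z) = k%:E ->
  (e ^+ N * expR (- (N%:R * w + N%:R * (N%:R - 1) / 2 * k)))%:E <=
  \int[pow N]_l expeR (- gibbs_energy W l).
Proof.
move=> + + + kE; elim: N W w => [|N IH] W w mW W0 wE.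
  rewrite integral_pow0 /gibbs_energy !big_ord0 adde0 oppe0 expeR0.
  by rewrite expr0 !mul0r addr0 oppr0 expR0 mulr1.
have mH := @measurable_gibbs_energy W N.+1 mW.
have H0 (l : N.+1.-tuple mR) := @gibbs_energy_ge0 W N.+1 l W0.
rewrite integral_powSl//; last 2 first.
- exact: measurable_expeRN.
- by move=> l; exact: expeR_ge0.
pose W' x := W x + U x.
have W'0 x : 0 <= W' x by exact: adde_ge0.
have mW' : measurable_fun [set: mR] W' by exact: emeasurable_funD.
have W'E : \int[P]_z W' (X z) = (w + k)%:E.
  rewrite ge0_integralD//; first by rewrite wE kE.
  - exact: (measurableT_comp mW mX).
  - exact: (measurableT_comp mU mX).
have {}IH := IH W' _ mW' W'0 W'E.
have mH' := @measurable_gibbs_energy W' N mW'.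
have H'0 (l : N.-tuple mR) := @gibbs_energy_ge0 W' N l W'0.
have c0 : 0 <= (e * expR (- w))%:E by rewrite lee_fin mulr_ge0 ?expR_ge0// ltW.
apply: (@le_trans _ _ ((e * expR (- w))%:E * \int[pow N]_l expeR (- gibbs_energy W' l))).
  apply: le_trans (lee_wpmul2l c0 IH).
  rewrite -EFinM lee_fin exprS mulrACA -expRD -mulrA -[leRHS]mulrA.
  rewrite le_eqVlt; apply/orP; left; apply/eqP; congr (_ * (_ * expR _))%R.
  by rewrite -[N.+1]addn1 natrD; field.
rewrite -ge0_integralZl//; last 2 first.
- exact: measurable_expeRN.
- by move=> l _; exact: expeR_ge0.
apply: ge0_le_integral => //.
- by move=> l _; rewrite mule_ge0// expeR_ge0.
- by apply: measurable_funeM; exact: measurable_expeRN.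
- exact: (@measurable_powSl R N (fun l => expeR (- gibbs_energy W l))
    (measurable_expeRN mH H0) (fun l => expeR_ge0 _)).
move=> l _.
pose h x := W x + \sum_(j < N) beta%:E * Lk x (tnth l j).
have h0 x : 0 <= h x by rewrite adde_ge0// sume_ge0.
have mh : measurable_fun [set: mR] h.
  apply: emeasurable_funD => //; apply: emeasurable_sum => j.
  by apply: measurable_funeM; apply: measurable_Lk_comp.
have eH x : expeR (- gibbs_energy W (cons_pair (x, l))) =
    expeR (- h x) * expeR (- gibbs_energy W l).
  rewrite gibbs_energy_cons oppeD ?expeRD//.
  by apply: ge0_adde_def; rewrite inE; [exact: h0|exact: gibbs_energy_ge0].
under [leRHS]eq_integral do rewrite eH.
rewrite ge0_integralZr//; last 3 first.
- exact: measurable_expeRN.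
- by move=> x _; exact: expeR_ge0.
- exact: expeR_ge0.
have hP : \int[P]_z h (X z) = w%:E + \sum_(j < N) U (tnth l j).
  rewrite ge0_integralD//; last 3 first.
  - exact: (measurableT_comp mW mX).
  - by move=> z _; exact: sume_ge0.
  - apply: emeasurable_sum => j; apply: measurable_funeM.
    by apply: measurable_Lk_comp.
  rewrite wE ge0_integral_sum// => j; apply: measurable_funeM.
  by apply: measurable_Lk_comp.
have J : e%:E * expeR (- (w%:E + \sum_(j < N) U (tnth l j))) <= \int[leb]_x expeR (- h x).
  apply: le_trans (smoothed_integral_le (measurable_expeRN mh h0) (fun x => expeR_ge0 _)).
  apply: lee_wpmul2l; first by rewrite lee_fin ltW.
  rewrite -hP; apply: jensen_expeRN => //; exact: measurableT_comp.
apply: le_trans (lee_wpmul2r (expeR_ge0 _) J).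
have -> : gibbs_energy W' l = \sum_(j < N) U (tnth l j) + gibbs_energy W l.
  by rewrite /gibbs_energy /W' big_split/= [X in X + _]addeC addeA.
have S0 : 0 <= \sum_(j < N) U (tnth l j) by exact: sume_ge0.
set S := \sum_(j < N) U _ in S0 *.
have -> : - (w%:E + S) = - w%:E - S by apply: oppeD; exact: fin_num_adde_defr.
have -> : - (S + gibbs_energy W l) = - S - gibbs_energy W l.
  by apply: oppeD; apply: ge0_adde_def; rewrite inE//; exact: gibbs_energy_ge0.
by rewrite !expeRD/= EFinM !muleA.
Qed.

End PartitionLowerBound.
Section PartitionLowerBound2.
Context {R : realType}.
Notation mR := (measurableTypeR R).
Notation leb := (@lebesgue_measure R).
Variables (beta : R) (Vt V : R -> R) (c1 : R).
Hypotheses (beta0 : (0 < beta)%R) (cVt : continuous Vt).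
Hypothesis (Vt0 : forall x, (0 <= Vt x)%R).
Hypothesis growth : forall C : R, exists K : R, (0 < K)%R /\
  forall x, (K <= `|x|)%R -> (C * (1 + `|x|) <= Vt x)%R.
Hypothesis VE : forall x, (V x = Vt x + beta * clog x - c1)%R.

(** If two particles coincide the Gibbs energy is +oo and the left-hand side is 0. Otherwise both
    sides agree by [weight_exponent]. *)
Lemma gibbs_energy_le_weight N (l : N.-tuple mR) :
  ((expR (N%:R ^+ 2 * c1))%:E *
    expeR (- gibbs_energy beta (fun x => (N%:R * Vt x + beta * clog x)%:E) l) <=
   (beta_weight V beta l)%:E)%E.
Proof.
set H := gibbs_energy _ _ _.
have w0 : 0 <= beta_weight V beta l.
  rewrite /beta_weight mulr_ge0 ?expR_ge0// prodr_ge0// => i _.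
  by rewrite prodr_ge0// => j _; rewrite powR_ge0.
have [Hoo|Hfin] := eqVneq H +oo%E.
  by rewrite Hoo/= mule0 lee_fin.
have W0 i : (0 <= (N%:R * Vt (tnth l i) + beta * clog (tnth l i))%:E)%E.
  by rewrite lee_fin addr_ge0// mulr_ge0// ?clog_ge0// ltW.
have bL0 x y : (0 <= beta%:E * Lk x y)%E.
  by apply: mule_ge0; [rewrite lee_fin ltW|exact: Lk_ge0].
have lij (i j : 'I_N) : (i < j)%N -> tnth l i != tnth l j.
  move=> ij; apply: contra_neq Hfin => lE.
  have : (beta%:E * Lk (tnth l i) (tnth l j) <= H)%E.
    rewrite /H /gibbs_energy (bigD1 i)//= [X in (_ <= _ + X)%E](bigD1 i)//=.
    rewrite [X in (_ <= _ + (X + _))%E](bigD1 j)//=.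
    rewrite -addeA; apply: lee_paddl; first exact: W0.
    apply: lee_paddl; first by apply: sume_ge0 => k _; exact: W0.
    by rewrite -addeA leeDl// adde_ge0// sume_ge0// => k _; apply: sume_ge0.
  rewrite lE {1}/Lk eqxx gt0_muley ?lte_fin//.
  by rewrite leye_eq => /eqP.
have LE (i j : 'I_N) : (i < j)%N -> (beta%:E * Lk (tnth l i) (tnth l j))%E =
    (beta * (clog (tnth l i) + clog (tnth l j) - ln `|tnth l i - tnth l j|))%:E.
  by move=> ij; rewrite /Lk (negbTE (lij _ _ ij)).
have -> : H = (N%:R * (\sum_(i < N) Vt (tnth l i)) + beta * (\sum_(i < N) clog (tnth l i)) +
    (beta * (\sum_(i < N) \sum_(j < N | (i < j)%N) (clog (tnth l i) + clog (tnth l j))) -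
     \sum_(i < N) \sum_(j < N | (i < j)%N) beta * ln `|tnth l i - tnth l j|))%:E.
  rewrite /H /gibbs_energy EFinD; congr (_ + _)%E.
    by rewrite sumEFin !mulr_sumr -big_split.
  rewrite mulr_sumr -sumrB -sumEFin; apply: eq_bigr => i _.
  rewrite mulr_sumr -sumrB -sumEFin; apply: eq_bigr => j ij.
  by rewrite LE// mulrBr.
rewrite /= -EFinM lee_fin /beta_weight.
have -> : \prod_(i < N) \prod_(j < N | (i < j)%N) `|tnth l i - tnth l j| `^ beta =
   expR (\sum_(i < N) \sum_(j < N | (i < j)%N) beta * ln `|tnth l i - tnth l j|).
  rewrite expR_sum; apply: eq_bigr => i _; rewrite expR_sum; apply: eq_bigr => j ij.
  by rewrite /powR normr_eq0 subr_eq0 (negbTE (lij _ _ ij)).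
rewrite -!expRD ler_expR; have := weight_exponent VE l.
set S1 := \sum_(i < N) \sum_(j < N | _) (_ + _); set S2 := \sum_(i < N) \sum_(j < N | _) _.
by rewrite mulNr; lra.
Qed.

Lemma measurable_V : measurable_fun [set: mR] (V : mR -> R).
Proof.
rewrite (_ : V = fun x => Vt x + beta * clog x - c1); last exact/funext.
apply: measurable_funB => //; apply: measurable_funD; first exact: measurable_cVt.
by apply: measurable_funM => //; exact: measurable_clog.
Qed.

Lemma measurable_beta_weight N : measurable_fun [set: N.-tuple mR] (beta_weight V beta (N := N)).
Proof.
apply: measurable_funM.
  apply: measurable_prod => i _; under eq_fun do rewrite big_mkcond.
  apply: measurable_prod => j _; case: (i < j)%N => //.
  apply: (measurableT_comp (measurable_powR beta)).
  apply: (measurableT_comp (@normr_measurable R setT)).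
  by apply: measurable_funB; exact: measurable_tnth.
apply: (measurableT_comp (@measurable_expR R)); apply: measurable_funM => //.
by apply: measurable_sum => i; exact: (measurableT_comp measurable_V (@measurable_tnth _ mR N i)).
Qed.

Lemma beta_weight_ge0 N (l : N.-tuple mR) : 0 <= beta_weight V beta l.
Proof.
rewrite /beta_weight mulr_ge0 ?expR_ge0// prodr_ge0// => i _.
by rewrite prodr_ge0// => j _; rewrite powR_ge0.
Qed.

Variable sigma : probability mR R.
Hypothesis hmin : forall mu : probability mR R, (eng beta Vt sigma <= eng beta Vt mu)%E.

Section smoothed.
Variables (e B : R) (e0 : 0 < e).
Hypothesis B0 : 0 <= B.
Hypothesis HB : forall y : R,
  (\int[sigma]_x \int[uniform_prob e0]_s Lk (x + s) y <= pot sigma y + B%:E)%E.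
Local Open Scope ereal_scope.

Let P : probability (mR * mR)%type R := (sigma \x uniform_prob e0)%E.
Let X (z : mR * mR) : mR := (z.1 + z.2)%R.
Let mX : measurable_fun [set: mR * mR] X.
Proof. exact: (@measurable_funD _ (mR * mR)%type R setT fst snd measurable_fst measurable_snd). Qed.

Let Ly (y : R) : \int[P]_z Lk (X z) y <= pot sigma y + B%:E.
Proof.
rewrite (smoothed_integralE sigma e0 (g := fun x => Lk x y)); first exact: HB.
- exact: measurable_Lk_comp.
- by move=> x; exact: Lk_ge0.
Qed.

(** The two variables of the self-energy are smoothed in turn, each at the cost B. *)
Lemma smoothed_energy_le :
  \int[P]_z \int[P]_z' Lk (X z') (X z) <= (engI sigma + 2 * B)%:E.
Proof.
have mL2 : measurable_fun [set: (mR * mR) * (mR * mR)]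
    (fun p : (mR * mR) * (mR * mR) => Lk (X p.2) (X p.1)).
  apply: measurable_Lk_comp.
    exact: (measurableT_comp mX measurable_snd).
  exact: (measurableT_comp mX measurable_fst).
apply: (@le_trans _ _ (\int[P]_z (pot sigma (X z) + B%:E))).
  apply: ge0_le_integral => //.
  - by move=> z _; apply: integral_ge0 => z' _; exact: Lk_ge0.
  - exact: (@measurable_fun_fubini_tonelli_F _ _ _ _ _ P _ mL2 (fun p => Lk_ge0 _ _)).
  - by apply: emeasurable_funD => //; exact: (measurableT_comp (measurable_pot sigma) mX).
rewrite ge0_integralD//; last 2 first.
- by move=> z _; exact: pot_ge0.
- exact: (measurableT_comp (measurable_pot sigma) mX).
rewrite integral_probability_cst.
rewrite (_ : (engI sigma + 2 * B)%R = (engI sigma + B + B)%R); last by ring.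
rewrite [leRHS]EFinD; apply: leeD2r.
have mLX : measurable_fun [set: (mR * mR) * mR]
    (fun p : (mR * mR) * mR => Lk (X p.1) p.2).
  apply: measurable_Lk_comp; last exact: measurable_snd.
  exact: (measurableT_comp mX measurable_fst).
rewrite (@fubini_tonelli _ _ _ _ _ P sigma _ mLX (fun p => Lk_ge0 _ _)).
apply: (@le_trans _ _ (\int[sigma]_y (pot sigma y + B%:E))).
  apply: ge0_le_integral => //.
  - by move=> y _; apply: integral_ge0 => z _; exact: Lk_ge0.
  - exact: (@measurable_fun_fubini_tonelli_G _ _ _ _ _ P _ mLX (fun p => Lk_ge0 _ _)).
  - by apply: emeasurable_funD => //; exact: measurable_pot.
  - by move=> y _; exact: Ly.
rewrite ge0_integralD//; last 2 first.
- by move=> y _; exact: pot_ge0.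
- exact: measurable_pot.
by rewrite integral_probability_cst (engIE beta0 cVt Vt0 hmin) EFinD.
Qed.

Lemma partition_ge_smoothed (v cl : R) (N : nat) :
  \int[P]_z (Vt (X z))%:E = v%:E -> \int[P]_z (clog (X z))%:E = cl%:E ->
  (expR (N%:R ^+ 2 * (c1 - v - beta / 2 * (engI sigma + 2 * B)) -
    N%:R * (beta * cl - ln e)))%:E <= partition_function V beta N.
Proof.
move=> vE clE.
pose W (x : mR) := (N%:R * Vt x + beta * clog x)%:E.
have W0 x : 0 <= W x.
  by rewrite lee_fin addr_ge0// mulr_ge0// ?clog_ge0// ltW.
have mclog := @measurable_clog R.
have mVt := measurable_cVt cVt.
have mW : measurable_fun [set: mR] W.
  by apply/measurable_EFinP; apply: measurable_funD; apply: measurable_funM.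
have WE : \int[P]_z W (X z) = (N%:R * v + beta * cl)%:E.
  rewrite /W; under eq_integral do rewrite EFinD !EFinM.
  have mVX : measurable_fun [set: mR * mR] (fun z => (Vt (X z))%:E).
    by apply/measurable_EFinP; exact: (measurableT_comp mVt mX).
  have mcX : measurable_fun [set: mR * mR] (fun z => (clog (X z))%:E).
    by apply/measurable_EFinP; exact: (measurableT_comp mclog mX).
  rewrite ge0_integralD//; last 4 first.
  - by move=> z _; rewrite mule_ge0// lee_fin.
  - exact: measurable_funeM.
  - by move=> z _; rewrite mule_ge0// lee_fin ?clog_ge0// ltW.
  - exact: measurable_funeM.
  rewrite !ge0_integralZl_EFin// ?(ltW beta0)//; last 2 first.
  - by move=> z _; rewrite lee_fin clog_ge0.
  - by move=> z _; rewrite lee_fin.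
  by rewrite vE clE -!EFinM -EFinD.
have bE y : \int[P]_z' (beta%:E * Lk (X z') y) = beta%:E * \int[P]_z' Lk (X z') y.
  rewrite ge0_integralZl_EFin//.
  - by move=> z _; exact: Lk_ge0.
  - exact: measurable_Lk_comp.
  - exact: ltW.
have mL2 : measurable_fun [set: (mR * mR) * (mR * mR)]
    (fun p : (mR * mR) * (mR * mR) => Lk (X p.2) (X p.1)).
  apply: measurable_Lk_comp.
    exact: (measurableT_comp mX measurable_snd).
  exact: (measurableT_comp mX measurable_fst).
have kE : exists2 k : R, (0 <= k <= beta * (engI sigma + 2 * B))%R &
    \int[P]_z \int[P]_z' (beta%:E * Lk (X z') (X z)) = k%:E.
  under eq_integral do rewrite bE.
  rewrite ge0_integralZl_EFin//; last 3 first.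
  - by move=> z _; apply: integral_ge0 => z' _; exact: Lk_ge0.
  - exact: (@measurable_fun_fubini_tonelli_F _ _ _ _ _ P _ mL2 (fun p => Lk_ge0 _ _)).
  - exact: ltW.
  have := smoothed_energy_le.
  have : 0 <= \int[P]_z \int[P]_z' Lk (X z') (X z).
    by apply: integral_ge0 => z _; apply: integral_ge0 => z' _; exact: Lk_ge0.
  case: (\int[P]_z \int[P]_z' Lk (X z') (X z)) => [k| |] // k0 kB.
  exists (beta * k)%R => //; rewrite mulr_ge0 ?(ltW beta0)//= ler_pM2l//.
have [k /andP[k0 kB] kE'] := kE.
have J := gibbs_jensen beta0 N mW W0 WE kE'.
have c0 : 0 <= (expR (N%:R ^+ 2 * c1))%:E by rewrite lee_fin expR_ge0.
have mH : measurable_fun [set: N.-tuple mR] (gibbs_energy beta W (N := N)).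
  exact: measurable_gibbs_energy.
have H0 (l : N.-tuple mR) := gibbs_energy_ge0 beta0 l W0.
apply: (@le_trans _ _ ((expR (N%:R ^+ 2 * c1))%:E *
    \int[power_measure leb N]_l expeR (- gibbs_energy beta W l))).
  apply: le_trans (lee_wpmul2l c0 J).
  rewrite -EFinM lee_fin -{2}(lnK (e0 : e \is Num.pos)) -expRM_natl -!expRD ler_expR.
  have h1 := ler_wpM2l (exprn_ge0 2 (ler0n R N)) kB.
  have h2 : (0 <= N%:R * k)%R by rewrite mulr_ge0.
  by lra.
rewrite -ge0_integralZl_EFin ?expR_ge0//; last 2 first.
- by move=> l _; exact: expeR_ge0.
- exact: measurable_expeRN.
apply: ge0_le_integral => //.
- by move=> l _; rewrite mule_ge0// expeR_ge0.
- by apply: measurable_funeM; exact: measurable_expeRN.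
- by apply/measurable_EFinP; exact: measurable_beta_weight.
- by move=> l _; exact: gibbs_energy_le_weight.
Qed.

End smoothed.

Lemma smoothed_pot_le (e M c : R) (e0 : 0 < e) (y : R) : e <= 1 -> 2 <= M ->
  (sigma [set z | (`|z - y| < M * e)%R] <= c%:E)%E ->
  (\int[sigma]_x \int[uniform_prob e0]_s Lk (x + s) y <=
   pot sigma y + (e + 2 / M + (4 + ln M) * c)%:E)%E.
Proof.
move=> e1 M2 sc.
have M0 : 0 < M by lra.
have lnM0 : 0 <= ln M by rewrite ln_ge0//; lra.
have M2' : 0 <= 2 / M by rewrite divr_ge0// ltW.
pose B : set mR := [set z | (`|z - y| < M * e)%R].
have mB : measurable B.
  have -> : B = ball y (M * e)%R by apply/seteqP; split => z; rewrite /B /ball/= distrC.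
  exact: measurable_ball.
have mL : measurable_fun [set: mR * mR] (fun p : mR * mR => Lk (p.1 + p.2) y).
  apply: measurable_Lk_comp => //.
  exact: (@measurable_funD _ (mR * mR)%type R setT fst snd measurable_fst measurable_snd).
have mLy : measurable_fun [set: mR] (fun x : mR => Lk x y) by exact: measurable_Lk_comp.
have b0 : 0 <= e + 2 / M by rewrite addr_ge0// ltW.
have g0 x : (0 <= (e + 2 / M + (4 + ln M) * \1_B x)%:E)%E.
  by rewrite lee_fin addr_ge0// mulr_ge0// addr_ge0.
have mg : measurable_fun [set: mR] (fun x : mR => (e + 2 / M + (4 + ln M) * \1_B x)%:E).
  by apply/measurable_EFinP; apply: measurable_funD => //; exact: measurable_funM.
apply: (@le_trans _ _ (\int[sigma]_x (Lk x y + (e + 2 / M + (4 + ln M) * \1_B x)%:E))%E).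
  apply: ge0_le_integral => //.
  - by move=> x _; apply: integral_ge0 => s _; exact: Lk_ge0.
  - exact: (@measurable_fun_fubini_tonelli_F _ _ _ _ _ (uniform_prob e0) _ mL (fun p => Lk_ge0 _ _)).
  - exact: emeasurable_funD.
  - by move=> x _; exact: uniform_Lk.
rewrite ge0_integralD//; last by move=> x _; exact: Lk_ge0.
apply: leeD; first by rewrite le_eqVlt; apply/orP; left; apply/eqP; apply: eq_integral => x _; exact: LkC.
have -> : (\int[sigma]_x (e + 2 / M + (4 + ln M) * \1_B x)%:E =
    (e + 2 / M)%:E + (4 + ln M)%:E * sigma B)%E.
  under eq_integral do rewrite EFinD EFinM.
  rewrite ge0_integralD//; last 2 first.
  - by move=> x _; rewrite -EFinM lee_fin mulr_ge0// addr_ge0.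
  - by apply: measurable_funeM; apply/measurable_EFinP.
  rewrite integral_probability_cst ge0_integralZl_EFin//; last 2 first.
  - by apply/measurable_EFinP.
  - by rewrite addr_ge0.
  by rewrite integral_indic// setIT.
rewrite [leRHS]EFinD [X in (_ <= _ + X)%E]EFinM; apply: leeD2l; apply: lee_wpmul2l => //.
by rewrite lee_fin addr_ge0.
Qed.

(** The smoothing length e depends on eta but not on N, so the entropy loss N log(1/e) stays linear
    in N. *)
Lemma partition_function_ge (eta : R) : 0 < eta -> exists C : R, forall N,
  ((expR (N%:R ^+ 2 * (c1 - min_energy beta Vt sigma - eta) - N%:R * C))%:E <=
   partition_function V beta N)%E.
Proof.
move=> eta0.
have [K0 HK0] := exists_large_radius beta0 cVt Vt0 growth hmin.
have [R01 supp _] := HK0 K0 (lexx _).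
pose t := eta / (6 * beta).
have bt : beta * t = eta / 6 by rewrite /t; field; rewrite gt_eqF.
have t0 : 0 < t by rewrite divr_gt0// mulr_gt0.
pose M : R := Num.max 2 (2 / t).
have M2 : 2 <= M by rewrite le_max lexx.
have M0 : 0 < M by lra.
have lnM0 : 0 <= ln M by rewrite ln_ge0//; lra.
have Mt : 2 / M <= t by rewrite ler_pdivrMr// -ler_pdivrMl// mulrC le_max lexx orbT.
pose c := t / (4 + ln M).
have c0 : 0 < c by rewrite divr_gt0// ltr_pwDl.
have cM : (4 + ln M) * c = t by rewrite /c; field; rewrite gt_eqF// ltr_pwDl.
have [d1 d10 Hd1] := sigma_nonatomic beta0 cVt Vt0 hmin c0.
have eta20 : 0 < eta / 2 by rewrite divr_gt0.
have [d2 d20 Hd2] := segment_unif_continuous K0 cVt eta20.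
pose e : R := Num.min (Num.min 1 t) (Num.min d2 (d1 / M)).
have e0 : 0 < e.
  have a2 : 0 < d1 / M by exact: divr_gt0.
  by rewrite !lt_min ltr01 t0 d20 a2.
have [e1 et ed2 ed1] : [/\ e <= 1, e <= t, e <= d2 & e <= d1 / M].
  by split; rewrite !ge_min lexx ?orbT.
clearbody e.
have eM : M * e <= d1 by rewrite mulrC -ler_pdivlMr.
have HB y : (\int[sigma]_x \int[uniform_prob e0]_s Lk (x + s) y <=
    pot sigma y + (e + 2 / M + (4 + ln M) * c)%:E)%E.
  apply: smoothed_pot_le => //; apply: le_trans (Hd1 y).
  apply: le_measure; rewrite ?inE.
  - have -> : [set z | (`|z - y| < M * e)%R] = ball y (M * e)%R.
      by apply/seteqP; split => z; rewrite /ball/= distrC.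
    exact: measurable_ball.
  - have -> : [set z | (`|z - y| < d1)%R] = ball y d1.
      by apply/seteqP; split => z; rewrite /ball/= distrC.
    exact: measurable_ball.
  - by move=> z /= h; exact: lt_le_trans h eM.
have B0 : 0 <= e + 2 / M + (4 + ln M) * c.
  by have : 0 <= 2 / M; [rewrite divr_ge0// ltW|rewrite cM; lra].
have mVt := measurable_cVt cVt.
have mclog := @measurable_clog R.
have mX : measurable_fun [set: mR * mR] (fun z : mR * mR => (z.1 + z.2)%R : mR).
  exact: (@measurable_funD _ (mR * mR)%type R setT fst snd measurable_fst measurable_snd).
have [v vE vle] : exists2 v, (\int[sigma \x uniform_prob e0]_z (Vt (z.1 + z.2)%R)%:E = v%:E)%E &
    v <= engV Vt sigma + eta / 2.
  have : (\int[sigma \x uniform_prob e0]_z (Vt (z.1 + z.2)%R)%:E <=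
      (engV Vt sigma + eta / 2)%:E)%E.
    rewrite (@smoothed_integralE R sigma e e0 (fun x => (Vt x)%:E))//; last exact/measurable_EFinP.
    rewrite EFinD -(engVE beta0 cVt Vt0 hmin) -[X in (_ <= _ + X)%E](integral_probability_cst sigma).
    rewrite -ge0_integralD//; last 3 first.
    - by move=> x _; rewrite lee_fin.
    - exact: measurable_EVt.
    - by move=> x _; rewrite lee_fin ltW.
    apply: ae_ge0_le_integral => //.
    - by move=> x _; apply: integral_ge0 => s _; rewrite lee_fin.
    - apply: (@measurable_fun_fubini_tonelli_F _ _ _ _ _ (uniform_prob e0)
        (fun p : mR * mR => (Vt (p.1 + p.2))%:E)).
      + by apply/measurable_EFinP; exact: (measurableT_comp mVt mX).
      + by move=> p; rewrite lee_fin.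
    - by move=> x _; rewrite -EFinD lee_fin addr_ge0// ltW.
    - by apply: emeasurable_funD => //; exact: measurable_EVt.
    exists (~` [set x | (`|x| <= K0)%R]); split => //.
      by apply: measurableC; exact: measurable_abs_le.
    move=> x /=; apply: contra_not => xR0 _.
    rewrite -EFinD -[leRHS](integral_uniform_cst e0); apply: le_integral_uniform => //.
    - by apply/measurable_EFinP; exact: (measurableT_comp mVt (@measurable_shift R x)).
    - by move=> s; rewrite lee_fin.
    - by move=> s; rewrite lee_fin addr_ge0// ltW.
    - move=> s /andP[s0 se]; rewrite lee_fin; apply: Hd2 => //.
      by rewrite s0 (le_trans se).
  have : (0 <= \int[sigma \x uniform_prob e0]_z (Vt (z.1 + z.2)%R)%:E)%E.
    by apply: integral_ge0 => z _; rewrite lee_fin.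
  case: (\int[sigma \x uniform_prob e0]_z _)%E => [v| |] // _ vle.
  by exists v; rewrite // -lee_fin.
have [cl clE] : exists cl, (\int[sigma \x uniform_prob e0]_z (clog (z.1 + z.2)%R)%:E = cl%:E)%E.
  have : (\int[sigma \x uniform_prob e0]_z (clog (z.1 + z.2)%R)%:E <=
      (meanclog sigma + e)%:E)%E.
    rewrite (@smoothed_integralE R sigma e e0 (fun x => (clog x)%:E))//; last 2 first.
    - exact/measurable_EFinP.
    - by move=> x; rewrite lee_fin clog_ge0.
    rewrite EFinD -(meanclogE beta0 cVt Vt0 growth hmin) -[X in (_ <= _ + X)%E](integral_probability_cst sigma).
    rewrite -ge0_integralD//; last 3 first.
    - by move=> x _; rewrite lee_fin clog_ge0.
    - exact/measurable_EFinP.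
    - by move=> x _; rewrite lee_fin ltW.
    apply: ge0_le_integral => //.
    - by move=> x _; apply: integral_ge0 => s _; rewrite lee_fin clog_ge0.
    - apply: (@measurable_fun_fubini_tonelli_F _ _ _ _ _ (uniform_prob e0)
        (fun p : mR * mR => (clog (p.1 + p.2))%:E)).
      + by apply/measurable_EFinP; exact: (measurableT_comp mclog mX).
      + by move=> p; rewrite lee_fin clog_ge0.
    - by apply: emeasurable_funD => //; exact/measurable_EFinP.
    move=> x _; rewrite -EFinD -[leRHS](integral_uniform_cst e0); apply: le_integral_uniform => //.
    - by apply/measurable_EFinP; exact: (measurableT_comp mclog (@measurable_shift R x)).
    - by move=> s; rewrite lee_fin clog_ge0.
    - by move=> s; rewrite lee_fin addr_ge0 ?clog_ge0// ltW.
    - move=> s /andP[s0 se]; rewrite lee_fin; apply: le_trans (le_clogD _ s0) _.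
      by rewrite lerD2l.
  have : (0 <= \int[sigma \x uniform_prob e0]_z (clog (z.1 + z.2)%R)%:E)%E.
    by apply: integral_ge0 => z _; rewrite lee_fin clog_ge0.
  by case: (\int[sigma \x uniform_prob e0]_z _)%E => [v'| |] // _ _; exists v'.
exists (beta * cl - ln e) => N.
apply: le_trans (partition_ge_smoothed B0 HB N vE clE).
rewrite lee_fin ler_expR lerD2r ler_wpM2l ?exprn_ge0// /min_energy.
have h1 : beta * (e + 2 / M + (4 + ln M) * c) <= beta * (3 * t) by rewrite ler_pM2l//; lra.
by lra.
Qed.

End PartitionLowerBound2.

(** * The law of one particle given the others *)

Lemma prod_pairs_at (R : comPzRingType) N (f : 'I_N -> 'I_N -> R) (i : 'I_N) :
  (forall a b, f a b = f b a) ->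
  \prod_(a < N) \prod_(b < N | (a < b)%N) f a b =
  (\prod_(a < N | a != i) f i a) *
  \prod_(a < N | a != i) \prod_(b < N | (a < b)%N && (b != i)) f a b.
Proof.
move=> fC; rewrite (bigD1 i)//=.
have -> : \prod_(a < N | a != i) \prod_(b < N | (a < b)%N) f a b =
   (\prod_(a < N | a != i) (if (a < i)%N then f i a else 1)) *
   \prod_(a < N | a != i) \prod_(b < N | (a < b)%N && (b != i)) f a b.
  rewrite -big_split/=; apply: eq_bigr => a ai.
  case: ifPn => [ai'|ai']; first by rewrite (bigD1 i)//= fC.
  rewrite mul1r; apply: eq_bigl => b; case: eqVneq => [->|_]; last by rewrite andbT.
  by rewrite (negbTE ai').
rewrite mulrA; congr (_ * _).
rewrite [X in X * _](_ : _ = \prod_(a < N | a != i) (if (i < a)%N then f i a else 1)).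
  rewrite -big_split/=; apply: eq_bigr => a ai.
  case: ltngtP => // [_|_|ai']; rewrite ?mul1r ?mulr1//.
  by move: ai; rewrite (val_inj ai') eqxx.
rewrite -big_mkcondr; apply: eq_bigl => a.
by case: eqVneq => // ->; rewrite ltnn.
Qed.

Section Exponential.
Context {R : realType}.
Notation mR := (measurableTypeR R).
Notation leb := (@lebesgue_measure R).
Local Open Scope ereal_scope.

Lemma measurable_expR_norm (c : R) :
  measurable_fun [set: mR] (fun x : mR => expR (- (c * `|x|))).
Proof.
apply: (measurableT_comp (@measurable_expR R)); apply: measurable_funN.
by apply: measurable_funM => //; exact: (@normr_measurable R setT).
Qed.

Lemma integral_expR_norm (c : R) : (0 < c)%R ->
  \int[leb]_x (expR (- (c * `|x|)))%:E = (2 / c)%:E.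
Proof.
move=> c0.
have c0' := ltW c0.
rewrite (@ge0_symfun_integralT R (fun x => expR (- (c * `|x|)))); last 3 first.
- by move=> x; exact: expR_ge0.
- move=> x; apply: continuous_comp; last exact: continuous_expR.
  apply: continuousN; apply: continuousM; first exact: cst_continuous.
  exact: norm_continuous.
- by move=> x /=; rewrite normrN.
rewrite EFinM; congr (_ * _).
have := integral_exponential_pdf c0.
have -> : \int[leb]_x (exponential_pdf c x)%:E =
    \int[leb]_(x in [set x : R | (0 <= x)%R]) (c%:E * (expR (- (c * `|x|)))%:E).
  rewrite [RHS]integral_mkcond; apply: eq_integral => x _.
  rewrite /exponential_pdf !patchE mem_setE in_itv/= andbT.
  case: ifPn => x0; first by rewrite mem_set//= ger0_norm// mulNr EFinM.
  by rewrite memNset//; apply/negP.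
rewrite ge0_integralZl_EFin//; last 2 first.
- by rewrite -set_itvcy.
- by apply/measurable_EFinP; apply: measurable_funTS; exact: measurable_expR_norm.
set I := \int[_]_(_ in _) _ => cI; rewrite -[LHS]mul1e -[1](_ : (c^-1)%:E * c%:E = _).
  by rewrite -muleA cI mule1.
by rewrite -EFinM mulVf// gt_eqF.
Qed.

End Exponential.

Section OneParticle.
Context {R : realType}.
Notation mR := (measurableTypeR R).
Notation leb := (@lebesgue_measure R).
Variables (beta : R) (Vt V : R -> R) (c1 : R).
Hypotheses (beta0 : (0 < beta)%R) (cVt : continuous Vt).
Hypothesis (Vt0 : forall x, (0 <= Vt x)%R).
Hypothesis VE : forall x, (V x = Vt x + beta * clog x - c1)%R.

Definition interaction N (l : N.-tuple mR) (i : 'I_N) (x : R) : R :=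
  \prod_(j < N | j != i) `|x - tnth l j| `^ beta.

Lemma interaction_ge0 N (l : N.-tuple mR) i x : 0 <= interaction l i x.
Proof. by apply: prodr_ge0 => j _; exact: powR_ge0. Qed.

Lemma measurable_interaction N (l : N.-tuple mR) i :
  measurable_fun [set: mR] (interaction l i : mR -> R).
Proof.
rewrite /interaction; under eq_fun do rewrite big_mkcond.
apply: measurable_prod => j _; case: (j != i) => //.
apply: (measurableT_comp (measurable_powR beta)).
apply: (measurableT_comp (@normr_measurable R setT)).
exact: measurable_funB.
Qed.

Lemma beta_weight_upd N (l : N.-tuple mR) (i : 'I_N) : exists2 D : R, 0 <= D &
  forall x, beta_weight V beta (upd l i x) = D * (interaction l i x * expR (- (N%:R * V x))).
Proof.
pose A := \prod_(a < N | a != i) \prod_(b < N | (a < b)%N && (b != i))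
  `|tnth l a - tnth l b| `^ beta.
exists (A * expR (- N%:R * \sum_(j < N | j != i) V (tnth l j))).
  by rewrite mulr_ge0 ?expR_ge0//; apply: prodr_ge0 => a _; apply: prodr_ge0 => b _; exact: powR_ge0.
move=> x; rewrite /beta_weight (@prod_pairs_at R N (fun a b =>
  `|tnth (upd l i x) a - tnth (upd l i x) b| `^ beta) i); last first.
  by move=> a b; rewrite distrC.
have -> : \prod_(a < N | a != i) `|tnth (upd l i x) i - tnth (upd l i x) a| `^ beta =
    interaction l i x.
  by apply: eq_bigr => a ai; rewrite !tnth_upd eqxx (negbTE ai).
have -> : \prod_(a < N | a != i) \prod_(b < N | (a < b)%N && (b != i))
   `|tnth (upd l i x) a - tnth (upd l i x) b| `^ beta = A.
  apply: eq_bigr => a ai; apply: eq_bigr => b /andP[_ bi].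
  by rewrite !tnth_upd (negbTE ai) (negbTE bi).
have -> : \sum_(j < N) V (tnth (upd l i x) j) = V x + \sum_(j < N | j != i) V (tnth l j).
  rewrite (bigD1 i)//= tnth_upd eqxx; congr (_ + _).
  by apply: eq_bigr => j ji; rewrite tnth_upd (negbTE ji).
by rewrite mulrDr expRD mulNr; ring.
Qed.

Lemma interaction_le N (l : N.-tuple mR) (i : 'I_N) x :
  interaction l i x <=
  expR (N.-1%:R * (beta * clog x) + beta * \sum_(j < N | j != i) clog (tnth l j)).
Proof.
have -> : N.-1%:R * (beta * clog x) + beta * \sum_(j < N | j != i) clog (tnth l j) =
    \sum_(j < N | j != i) beta * (clog x + clog (tnth l j)).
  rewrite mulr_sumr; under [RHS]eq_bigr do rewrite mulrDr.
  rewrite big_split/= sumr_const cardC1 card_ord.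
  by rewrite -[in RHS]mulr_natl.
rewrite expR_sum; apply: ler_prod => j _.
by rewrite powR_ge0 powR_le_clog.
Qed.

Lemma interaction_ge N (l : N.-tuple mR) (i : 'I_N) x :
  ((expR (beta * \sum_(j < N | j != i) clog (tnth l j)))%:E *
    expeR (- \sum_(j < N | j != i) beta%:E * Lk x (tnth l j)) <=
   (interaction l i x)%:E)%E.
Proof.
rewrite /interaction mulr_sumr.
elim: (index_enum _) => [|j s IH].
  by rewrite !big_nil/= oppr0 expR0 mule1.
rewrite !big_cons; case: ifP => // ji.
have s0 : (0 <= \sum_(j <- s | j != i) beta%:E * Lk x (tnth l j))%E.
  by apply: sume_ge0 => k _; rewrite mule_ge0 ?Lk_ge0// lee_fin ltW.
have L0 : (0 <= beta%:E * Lk x (tnth l j))%E by rewrite mule_ge0 ?Lk_ge0// lee_fin ltW.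
rewrite oppeD ?ge0_adde_def ?inE// expeRD expRD EFinM muleACA EFinM.
apply: lee_pmul => //.
- by rewrite mule_ge0 ?expeR_ge0// lee_fin expR_ge0.
- by rewrite mule_ge0 ?expeR_ge0// lee_fin expR_ge0.
rewrite (powR_Lk _ _ beta0); apply: lee_wpmul2r; first exact: expeR_ge0.
by rewrite lee_fin ler_expR ler_pM2l// lerDr clog_ge0.
Qed.

(** Jensen's inequality on [0, 1], where each kernel has mean at most 7 wherever the other particle
    lies. The factor exp(beta sum [clog]) is the same as in the upper bound [one_particle_le], so it
    cancels in ratios. *)
Lemma integral_one_particle_ge N (l : N.-tuple mR) (i : 'I_N) (M : R) :
  (forall s, 0 <= s <= 1 -> V s <= M) ->
  ((expR (beta * (\sum_(j < N | j != i) clog (tnth l j)) - N%:R * (7 * beta + M)))%:E <=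
   \int[leb]_x (interaction l i x * expR (- (N%:R * V x)))%:E)%E.
Proof.
move=> VM.
pose h (x : mR) := (\sum_(j < N | j != i) beta%:E * Lk x (tnth l j))%E.
have bL0 x y : (0 <= beta%:E * Lk x y)%E by rewrite mule_ge0 ?Lk_ge0// lee_fin ltW.
have mbL y : measurable_fun [set: mR] (fun x : mR => beta%:E * Lk x y)%E.
  by apply: measurable_funeM; exact: measurable_Lk_comp.
have h0 x : (0 <= h x)%E by apply: sume_ge0 => j _.
have mh : measurable_fun [set: mR] h.
  rewrite /h; under eq_fun do rewrite big_mkcond.
  by apply: emeasurable_sum => j; case: (j != i) => //; exact: mbL.
have mV := measurable_V cVt VE.
have w0 x : 0 <= interaction l i x * expR (- (N%:R * V x)).
  by rewrite mulr_ge0 ?interaction_ge0 ?expR_ge0.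
have mw : measurable_fun [set: mR] (fun x : mR => (interaction l i x * expR (- (N%:R * V x)))%:E).
  apply/measurable_EFinP; apply: measurable_funM; first exact: measurable_interaction.
  apply: (measurableT_comp (@measurable_expR R)); apply: measurable_funN.
  exact: measurable_funM.
pose a := expR (beta * (\sum_(j < N | j != i) clog (tnth l j)) - N%:R * M).
have U : (\int[uniform_prob (@ltr01 R)]_x (interaction l i x * expR (- (N%:R * V x)))%:E <=
   \int[leb]_x (interaction l i x * expR (- (N%:R * V x)))%:E)%E.
  rewrite integral_uniform// subr0 invr1 mul1e; apply: ge0_subset_integral => //.
  by move=> x _; rewrite lee_fin.
apply: le_trans U.
apply: (@le_trans _ _ (a%:E * \int[uniform_prob (@ltr01 R)]_x expeR (- h x))%E); last first.
  rewrite -ge0_integralZl_EFin ?expR_ge0//; last 2 first.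
  - by move=> x _; exact: expeR_ge0.
  - exact: measurable_expeRN.
  apply: le_integral_uniform => //.
  - by apply: measurable_funeM; exact: measurable_expeRN.
  - by move=> x; rewrite mule_ge0 ?expeR_ge0// lee_fin expR_ge0.
  move=> s s01; rewrite /a expRD EFinM muleAC EFinM.
  apply: lee_pmul.
  - by rewrite mule_ge0 ?expeR_ge0// lee_fin expR_ge0.
  - by rewrite lee_fin expR_ge0.
  - exact: interaction_ge.
  - by rewrite lee_fin ler_expR lerN2 ler_wpM2l// VM.
have J := jensen_expeRN (uniform_prob (@ltr01 R)) mh h0.
apply: le_trans (lee_wpmul2l _ J); last by rewrite lee_fin expR_ge0.
have Ih : (\int[uniform_prob (@ltr01 R)]_x h x <= (N%:R * (7 * beta))%:E)%E.
  have -> : h = fun x => (\sum_(j < N) (if j != i then beta%:E * Lk x (tnth l j) else 0))%E.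
    by apply/funext => x; rewrite /h big_mkcond.
  rewrite ge0_integral_sum//; last 2 first.
  - by move=> j; case: (j != i).
  - by move=> j x _; case: (j != i).
  rewrite -sum_ord_const -sumEFin; apply: lee_sum => j _.
  case: (j != i); last by rewrite integral0 lee_fin mulr_ge0// ltW.
  rewrite ge0_integralZl_EFin// ?(ltW beta0)//; last 2 first.
  - by move=> x _; exact: Lk_ge0.
  - exact: measurable_Lk_comp.
  rewrite mulrC EFinM; apply: lee_wpmul2l; first by rewrite lee_fin ltW.
  exact: uniform01_Lk.
have Ih0 : (0 <= \int[uniform_prob (@ltr01 R)]_x h x)%E by exact: integral_ge0.
move: Ih Ih0; case: (\int[uniform_prob (@ltr01 R)]_x h x)%E => [u| |] // uN u0.
rewrite /= -EFinM lee_fin /a -expRD ler_expR.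
by move: uN; rewrite lee_fin; lra.
Qed.

End OneParticle.

Section ConditionalTail.
Context {R : realType}.
Notation mR := (measurableTypeR R).
Notation leb := (@lebesgue_measure R).
Notation pow := (power_measure leb).
Variables (beta : R) (Vt V : R -> R) (c1 : R).
Hypotheses (beta0 : (0 < beta)%R) (cVt : continuous Vt).
Hypothesis (Vt0 : forall x, (0 <= Vt x)%R).
Hypothesis VE : forall x, (V x = Vt x + beta * clog x - c1)%R.

Lemma measurable_one_particle N (l : N.-tuple mR) (i : 'I_N) :
  measurable_fun [set: mR] (fun x : mR => interaction beta l i x * expR (- (N%:R * V x))).
Proof.
have mV := measurable_V cVt VE.
apply: measurable_funM; first exact: measurable_interaction.
apply: (measurableT_comp (@measurable_expR R)); apply: measurable_funN.
exact: measurable_funM.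
Qed.

Lemma one_particle_ge0 N (l : N.-tuple mR) (i : 'I_N) x :
  0 <= interaction beta l i x * expR (- (N%:R * V x)).
Proof. by rewrite mulr_ge0 ?expR_ge0//; exact: interaction_ge0. Qed.

Lemma one_particle_le N (l : N.-tuple mR) (i : 'I_N) x :
  interaction beta l i x * expR (- (N%:R * V x)) <=
  expR (beta * \sum_(j < N | j != i) clog (tnth l j) - N%:R * (Vt x - c1)).
Proof.
apply: (le_trans (ler_wpM2r (expR_ge0 _) (interaction_le beta0 l i x))).
rewrite -expRD ler_expR VE.
have : 0 <= beta * clog x by rewrite mulr_ge0 ?clog_ge0// ltW.
have -> : (N%:R = N.-1%:R + 1 :> R) by rewrite natr1 prednK// (leq_ltn_trans _ (ltn_ord i)).
by lra.
Qed.

Section weights.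
Variables (K M : R) (h : R -> R).
Hypothesis VM : forall s, 0 <= s <= 1 -> V s <= M.
Hypothesis mh : measurable_fun [set: mR] (h : mR -> R).
Hypothesis hK : forall x, K < `|x| -> 7 * beta + M + 1 + `|x| + h x <= Vt x - c1.

Definition outer_weight N (x : R) : R := if `|x| <= K then 1 else expR (N%:R * h x).

Lemma outer_weight_ge0 N x : 0 <= outer_weight N x.
Proof. by rewrite /outer_weight; case: ifP => // _; exact: expR_ge0. Qed.

Lemma measurable_outer_weight N : measurable_fun [set: mR] (outer_weight N : mR -> R).
Proof.
apply: measurable_fun_ifT => //.
  by apply: measurable_fun_ler => //; exact: (@normr_measurable R setT).
apply: (measurableT_comp (@measurable_expR R)).
exact: measurable_funM.
Qed.

(** Inside [-K, K] the weight is 1. Outside, the margin 1 + |x| in [hK] makes the contribution at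
    most 2 exp(-N) times the lower bound [integral_one_particle_ge], hence at most the whole
    integral. *)
Lemma integral_outer_weight N (l : N.-tuple mR) (i : 'I_N) :
  (\int[leb]_x (outer_weight N x * (interaction beta l i x * expR (- (N%:R * V x))))%:E <=
   2%:E * \int[leb]_x (interaction beta l i x * expR (- (N%:R * V x)))%:E)%E.
Proof.
set w := fun x : mR => interaction beta l i x * expR (- (N%:R * V x)).
have w0 x : 0 <= w x by exact: one_particle_ge0.
have mw : measurable_fun [set: mR] w by exact: measurable_one_particle.
have N1 : 1 <= N%:R :> R by rewrite ler1n (leq_ltn_trans _ (ltn_ord i)).
pose S := beta * \sum_(j < N | j != i) clog (tnth l j).
pose b := S - N%:R * (7 * beta + M + 1).
have W := integral_one_particle_ge beta0 cVt VE l i VM.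
apply: (@le_trans _ _ (\int[leb]_x ((w x)%:E + (expR b)%:E * (expR (- (1 * `|x|)))%:E))%E).
  apply: ge0_le_integral => //.
  - by move=> x _; rewrite lee_fin; exact: mulr_ge0 (outer_weight_ge0 _ _) (w0 x).
  - by apply/measurable_EFinP; apply: measurable_funM => //; exact: measurable_outer_weight.
  - apply: emeasurable_funD; first exact/measurable_EFinP.
    by apply: measurable_funeM; apply/measurable_EFinP; exact: measurable_expR_norm.
  move=> x _; rewrite -EFinM -EFinD lee_fin /outer_weight; case: ifPn => [_|].
    by rewrite mul1r lerDl mulr_ge0// expR_ge0.
  rewrite -ltNge => Kx; apply: ler_wpDl => //.
  apply: le_trans (ler_wpM2l (expR_ge0 _) (one_particle_le l i x)) _.
  rewrite -!expRD ler_expR /b -/S mul1r.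
  have := ler_wpM2l (ler0n R N) (hK Kx).
  have : 0 <= (N%:R - 1) * `|x| by rewrite mulr_ge0// subr_ge0.
  by lra.
rewrite ge0_integralD//; last 3 first.
- by move=> x _; rewrite lee_fin.
- exact/measurable_EFinP.
- by apply: measurable_funeM; apply/measurable_EFinP; exact: measurable_expR_norm.
rewrite (_ : 2%:E = 1 + 1)%E; last by [].
rewrite ge0_muleDl// mul1e; apply: leeD2l.
rewrite ge0_integralZl_EFin ?expR_ge0//; last first.
  by apply/measurable_EFinP; exact: measurable_expR_norm.
rewrite integral_expR_norm// -EFinM; apply: le_trans W.
rewrite lee_fin (_ : 2 / 1 = expR (ln 2)); last by rewrite divr1 lnK// posrE.
rewrite -expRD ler_expR /b /S.
have : ln 2 <= 1 :> R by have := @ln_le_sub1 R 2 (ltr0Sn _ _); lra.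
by lra.
Qed.

(** The weights are inserted one particle at a time. Each insertion costs at most a factor 2 with
    the other particles frozen, whether or not these carry their own weights. *)
Lemma integral_outer_weights N :
  (\int[pow N]_l (beta_weight V beta l * \prod_(i < N) outer_weight N (tnth l i))%:E <=
   (2 ^+ N)%:E * partition_function V beta N)%E.
Proof.
have mB := measurable_beta_weight cVt VE (N := N).
have B0 (l : N.-tuple mR) : 0 <= beta_weight V beta l by exact: beta_weight_ge0.
have mO (i : 'I_N) : measurable_fun [set: N.-tuple mR] (fun l => outer_weight N (tnth l i)).
  exact: (measurableT_comp (measurable_outer_weight N) (@measurable_tnth _ mR N i)).
suff H k : (k <= N)%N ->
  (\int[pow N]_l (beta_weight V beta l * \prod_(i < N | (i < k)%N) outer_weight N (tnth l i))%:E <=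
   (2 ^+ k)%:E * partition_function V beta N)%E.
  have := H N (leqnn N); congr (_ <= _)%E; apply: eq_integral => l _; congr (_ * _)%:E.
  by apply: eq_bigl => i; rewrite ltn_ord.
elim: k => [_|k IH kN].
  rewrite expr0 mul1e le_eqVlt; apply/orP; left; apply/eqP; apply: eq_integral => l _.
  by rewrite big_pred0 ?mulr1.
rewrite exprS EFinM -muleA; apply: le_trans (lee_wpmul2l _ (IH (ltnW kN))); last first.
  by rewrite lee_fin.
have mP n : measurable_fun [set: N.-tuple mR]
    (fun l => (beta_weight V beta l * \prod_(i < N | (i < n)%N) outer_weight N (tnth l i))%:E).
  apply/measurable_EFinP; apply: measurable_funM => //.
  under eq_fun do rewrite big_mkcond; apply: measurable_prod => i _.
  by case: (i < n)%N.
have P0 n (l : N.-tuple mR) :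
   0 <= beta_weight V beta l * \prod_(i < N | (i < n)%N) outer_weight N (tnth l i).
  by rewrite mulr_ge0// prodr_ge0// => i _; exact: outer_weight_ge0.
rewrite -ge0_integralZl_EFin//; last by move=> l _; rewrite lee_fin.
pose i := Ordinal kN.
apply: (@le_integral_coord R N i) => //.
- exact: measurable_funeM.
- by move=> l; rewrite lee_fin.
- by move=> l; rewrite mule_ge0 ?lee_fin.
move=> l; have [D D0 DE] := beta_weight_upd beta V l i.
pose E := D * \prod_(j < N | (j < k)%N) outer_weight N (tnth l j).
have E0 : 0 <= E by rewrite mulr_ge0// prodr_ge0// => j _; exact: outer_weight_ge0.
pose w x := interaction beta l i x * expR (- (N%:R * V x)).
have kE x : \prod_(j < N | (j < k)%N) outer_weight N (tnth (upd l i x) j) =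
    \prod_(j < N | (j < k)%N) outer_weight N (tnth l j).
  apply: eq_bigr => j jk; rewrite tnth_upd; case: eqVneq => // ji.
  by move: jk; rewrite ji ltnn.
have w0 x : 0 <= w x by exact: one_particle_ge0.
have mw : measurable_fun [set: mR] (w : mR -> R) by exact: measurable_one_particle.
rewrite [leLHS](_ : _ = \int[leb]_x (E%:E * (outer_weight N x * w x)%:E))%E; last first.
  apply: eq_integral => x _; rewrite DE (bigD1 i)//= tnth_upd eqxx -EFinM; congr (_%:E).
  rewrite (eq_bigl (fun j : 'I_N => (j < k)%N)); last first.
    by move=> j; rewrite ltnS ltn_neqAle andbC -(inj_eq val_inj).
  by rewrite kE /E /w; ring.
rewrite [leRHS](_ : _ = \int[leb]_x (E%:E * (2%:E * (w x)%:E)))%E; last first.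
  by apply: eq_integral => x _; rewrite DE kE -!EFinM; congr (_%:E); rewrite /E /w; ring.
have me1 : measurable_fun [set: mR] (fun x : mR => (outer_weight N x * w x)%:E).
  by apply/measurable_EFinP; apply: measurable_funM => //; exact: measurable_outer_weight.
have me2 : measurable_fun [set: mR] (fun x : mR => (w x)%:E) by exact/measurable_EFinP.
have me3 : measurable_fun [set: mR] (fun x : mR => 2%:E * (w x)%:E)%E by exact: measurable_funeM.
have n1 x : (0 <= (outer_weight N x * w x)%:E)%E.
  by rewrite lee_fin; exact: mulr_ge0 (outer_weight_ge0 _ _) (w0 x).
have n2 x : (0 <= (w x)%:E)%E by rewrite lee_fin.
have n3 x : (0 <= 2%:E * (w x)%:E)%E by rewrite mule_ge0 ?lee_fin.
rewrite !ge0_integralZl_EFin//.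
apply: lee_wpmul2l; first by rewrite lee_fin.
exact: integral_outer_weight.
Qed.

End weights.
End ConditionalTail.

(** * Moments in a compact set are controlled by the gap *)

Section TestFunction.
Context {R : realType}.
Notation mR := (measurableTypeR R).
Notation leb := (@lebesgue_measure R).
Local Open Scope ereal_scope.
Variables (K M : R) (H phi : R -> R).
Hypothesis K0 : (0 < K)%R.
Hypothesis dH : forall x : R, is_derive x (1%R : R) H (phi x).
Hypothesis cphi : continuous phi.
Hypothesis phiM : forall x, (`|x| <= K)%R -> (0 <= phi x <= M)%R.

Let psi (z : mR) : R := if (`|z| <= K)%R then phi z else 0%R.

Let psi0 z : (0 <= psi z)%R.
Proof. by rewrite /psi; case: ifPn => // /phiM /andP[]. Qed.

Let mphi : measurable_fun [set: mR] (phi : mR -> R).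
Proof. exact: continuous_measurable_fun. Qed.

Let mpsi : measurable_fun [set: mR] psi.
Proof.
apply: measurable_fun_ifT => //.
by apply: measurable_fun_ler => //; exact: (@normr_measurable R setT).
Qed.

Let M0 : (0 <= M)%R.
Proof.
have /andP[/le_trans h1] : (0 <= phi 0 <= M)%R by apply: phiM; rewrite normr0 ltW.
exact: h1.
Qed.

Lemma integral_phi (x : R) : (- K <= x)%R -> (x <= K)%R ->
  \int[leb]_(z in `[(- K)%R, x[%classic) (phi z)%:E = (H x - H (- K))%:E.
Proof.
move=> Kx xK.
have [<-|nKx] := eqVneq (- K)%R x.
  by rewrite set_itvco0 integral_set0 subrr.
have {}Kx : (- K < x)%R by rewrite lt_neqAle nKx.
rewrite integral_itv_bndo_bndc; last first.
  by apply: measurable_funTS; exact/measurable_EFinP.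
have cH : continuous H.
  by move=> y; apply: differentiable_continuous; apply/derivable1_diffP; exact: ex_derive.
rewrite (@continuous_FTC2 R phi H)//.
- exact: continuous_subspaceT.
- split => //.
  + by apply: cvg_at_right_filter; exact: cH.
  + by apply: cvg_at_left_filter; exact: cH.
- by move=> y _; rewrite derive1E; exact: derive_val.
Qed.

(** A window integral that reproduces a primitive: for |x| <= K the window of length 4 K covers [-K,
    x[, so the value is H x - H (-K). Outside [-K, K] only boundedness is used. *)
Definition test_function (x : mR) : \bar R :=
  \int[leb]_z (psi z * window (4 * K) z x)%:E.

Lemma test_function_ge0 x : 0 <= test_function x.
Proof. by apply: integral_ge0 => z _; rewrite lee_fin mulr_ge0// window_ge0. Qed.

Lemma measurable_psi_window : measurable_fun [set: mR * mR]
  (fun p : mR * mR => (psi p.1 * window (4 * K) p.1 p.2)%:E).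
Proof.
apply/measurable_EFinP; apply: measurable_funM; last exact: measurable_window.
exact: (measurableT_comp mpsi measurable_fst).
Qed.

Lemma measurable_test_function : measurable_fun [set: mR] test_function.
Proof.
apply: (@measurable_fun_fubini_tonelli_G _ _ _ _ _ leb _ measurable_psi_window).
by move=> z; rewrite lee_fin mulr_ge0// window_ge0.
Qed.

Lemma test_functionE (x : R) : (`|x| <= K)%R -> test_function x = (H x - H (- K))%:E.
Proof.
rewrite ler_norml => /andP[Kx xK]; rewrite -integral_phi// integral_mkcond.
apply: eq_integral => z _; rewrite patchE mem_setE in_itv/= /psi windowE ler_norml.
case: (leP (- K)%R z) => Kz; last by rewrite mul0r.
rewrite (_ : (x - 4 * K <= z)%R = true); last by lra.
case: (ltP z x) => zx; last by rewrite mulr0.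
by rewrite mulr1 (_ : (z <= K)%R = true)//; lra.
Qed.

Lemma test_function_le (x : R) : test_function x <= (H K - H (- K))%:E.
Proof.
rewrite -integral_phi//; last by have := K0; lra.
rewrite integral_itv_bndo_bndc; last first.
  by apply: measurable_funTS; exact/measurable_EFinP.
rewrite integral_mkcond; apply: ge0_le_integral => //.
- by move=> z _; rewrite lee_fin mulr_ge0// window_ge0.
- apply/measurable_EFinP; apply: measurable_funM => //; exact: measurable_windowl.
- apply/(measurable_restrictT _ _).1 => //.
  by apply: measurable_funTS; exact/measurable_EFinP.
move=> z _; rewrite patchE mem_setE in_itv/= -ler_norml /psi.
case: ifPn => [/phiM /andP[p0 _]|_]; last by rewrite mul0r.
by rewrite lee_fin ler_piMr// window_le1.
Qed.

Lemma integral_psi2 : \int[leb]_z (psi z ^+ 2)%:E <= (2 * K * M ^+ 2)%:E.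
Proof.
apply: (@le_trans _ _ (\int[leb]_z ((M ^+ 2)%:E * (\1_(`[(- K)%R, K]%classic : set mR) z)%:E))).
  apply: ge0_le_integral => //.
  - by move=> z _; rewrite lee_fin sqr_ge0.
  - by apply/measurable_EFinP; exact: measurable_funX.
  - by apply: measurable_funeM; exact/measurable_EFinP.
  move=> z _; rewrite -EFinM lee_fin /psi indicE mem_setE in_itv/= -ler_norml.
  case: ifPn => [/phiM /andP[p0 pM]|_]; last by rewrite expr0n/= mulr0.
  by rewrite mulr1 ler_pXn2r// nnegrE.
rewrite ge0_integralZl_EFin ?sqr_ge0//; last first.
  exact/measurable_EFinP.
rewrite integral_indic// setIT; rewrite [X in _ * X](_ : _ = (2 * K)%:E).
  by rewrite -EFinM lee_fin mulrC.
etransitivity; first exact: lebesgue_measure_itv.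
by rewrite /= lte_fin (_ : (- K < K)%R = true) -?EFinB; [congr (_%:E); ring|have := K0; lra].
Qed.

Lemma test_function_gap2 (mu nu : probability mR R) (t : R) : (0 < t)%R ->
  \int[mu]_x test_function x <= \int[nu]_x test_function x +
    ((t * (K * M ^+ 2))%:E + ((2 * t)^-1)%:E * gap2 (4 * K) mu nu).
Proof.
move=> t0.
apply: le_trans (test_function_gap (4 * K)%R mu nu t0 mpsi psi0) _.
apply: leeD2l; apply: leeD2r.
rewrite (_ : (t * (K * M ^+ 2))%:E = (t / 2)%:E * (2 * K * M ^+ 2)%:E).
  by apply: lee_wpmul2l integral_psi2; rewrite lee_fin divr_ge0// ltW.
by rewrite -EFinM; congr (_%:E); field.
Qed.

End TestFunction.

Section EmpiricalTest.
Context {R : realType}.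
Notation mR := (measurableTypeR R).
Notation leb := (@lebesgue_measure R).
Variables (K : R) (sigma : probability mR R).
Hypothesis K1 : 1 <= K.
Hypothesis supp : sigma (~` [set x | `|x| <= K]) = 0%E.

Lemma supported_integrable (H : R -> R) : continuous H ->
  sigma.-integrable [set: mR] (EFin \o (H : mR -> R)).
Proof.
move=> cH.
have cH' : continuous (fun x => `|H x|).
  by move=> x; apply: continuous_comp; [exact: cH|exact: norm_continuous].
have [M M0 HM] := Vt_bounded cH' (fun x => normr_ge0 _) K.
have mH : measurable_fun [set: mR] (H : mR -> R) by exact: continuous_measurable_fun.
apply/integrableP; split; first exact/measurable_EFinP.
apply: (@le_lt_trans _ _ (\int[sigma]_x M%:E)%E); last first.
  by rewrite integral_probability_cst ltry.
apply: ae_ge0_le_integral => //.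
- by apply: measurableT_comp => //; exact/measurable_EFinP.
exists (~` [set x | (`|x| <= K)%R]); split => //.
  by apply: measurableC; exact: measurable_abs_le.
by move=> x /=; apply: contra_not => xK _; rewrite lee_fin HM.
Qed.

Variables (M : R) (H phi : R -> R).
Hypothesis dH : forall x : R, is_derive x (1 : R) H (phi x).
Hypothesis cphi : continuous phi.
Hypothesis phiM : forall x, `|x| <= K -> 0 <= phi x <= M.

Let K0 : 0 < K. Proof. exact: lt_le_trans K1. Qed.

Let TF := test_function K phi.

Let mTF : measurable_fun [set: mR] TF.
Proof. exact: (measurable_test_function cphi phiM). Qed.

Let TF0 x : (0 <= TF x)%E.
Proof. exact: (test_function_ge0 phiM). Qed.

Let TFB x : (TF x <= (H K - H (- K))%:E)%E.
Proof. exact: (test_function_le K0 dH cphi phiM). Qed.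

Let TFfin x : TF x \is a fin_num.
Proof. by rewrite ge0_fin_numE// (le_lt_trans (TFB x))// ltry. Qed.

Let IfinP (mu : probability mR R) : (\int[mu]_x TF x)%E \is a fin_num.
Proof.
rewrite ge0_fin_numE; last exact: integral_ge0.
apply: (@le_lt_trans _ _ (\int[mu]_x (H K - H (- K))%:E)%E).
  by apply: ge0_le_integral.
by rewrite integral_probability_cst ltry.
Qed.

Let cH : continuous H.
Proof.
by move=> y; apply: differentiable_continuous; apply/derivable1_diffP; exact: ex_derive.
Qed.

Lemma supported_integral : \int[sigma]_x (H x) = fine (\int[sigma]_x TF x)%E + H (- K).
Proof.
have mH : measurable_fun [set: mR] (H : mR -> R) by exact: continuous_measurable_fun.
rewrite /Rintegral (ae_eq_integral (fun x => TF x + (H (- K))%:E)%E)//; last 3 first.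
- exact/measurable_EFinP.
- exact: emeasurable_funD.
- exists (~` [set x | (`|x| <= K)%R]); split => //.
    by apply: measurableC; exact: measurable_abs_le.
  move=> x /=; apply: contra_not => xK _.
  by rewrite /TF (test_functionE dH cphi)// -EFinD subrK.
rewrite integralD//.
- by rewrite integral_probability_cst fineD// IfinP.
- apply/integrableP; split => //.
  under eq_integral do rewrite gee0_abs//.
  by rewrite -ge0_fin_numE ?IfinP// integral_ge0.
- exact: finite_measure_integrable_cst.
Qed.

(** The gap controls the mean of the test function in both directions. Replacing the latter by H on
    [-K, K] errs by at most [C] per outer particle, and these are counted by the sum of their moduli
    since K >= 1. *)
Lemma test_function_emp (delta : R) : 0 < delta -> exists2 kappa : R, 0 < kappa &
  forall N (l : N.+1.-tuple mR), gap2 (4 * K) (emp l) sigma \is a fin_num ->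
  fine (gap2 (4 * K) (emp l) sigma) < kappa ->
  (\sum_(i < N.+1) if K <= `|tnth l i| then `|tnth l i| else 0) < N.+1%:R * kappa ->
  `|N.+1%:R^-1 * (\sum_(i < N.+1) if `|tnth l i| <= K then H (tnth l i) else 0) -
    \int[sigma]_x (H x)| < delta.
Proof.
move=> delta0.
have /andP[phi0 phi0M] : 0 <= phi 0 <= M by apply: phiM; rewrite normr0 ltW.
have M0 := le_trans phi0 phi0M.
(* With this t the quadratic term of Young's inequality is at most delta / 4; [kappa] then bounds
   the gap term and the outer particles by delta / 4 each. *)
pose t := delta / (4 * (K * M ^+ 2 + 1)).
have KM : 0 < K * M ^+ 2 + 1 by rewrite ltr_wpDl// mulr_ge0 ?sqr_ge0// ltW.
have t0 : 0 < t by rewrite divr_gt0// mulr_gt0.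
have tK : t * (K * M ^+ 2) <= delta / 4.
  rewrite (_ : delta / 4 = t * (K * M ^+ 2 + 1)); last first.
    by rewrite /t; field; rewrite gt_eqF.
  by rewrite ler_pM2l// lerDl.
pose C := (H K - H (- K)) + `|H (- K)|.
have HB : 0 <= H K - H (- K) by rewrite -lee_fin; exact: le_trans (TF0 0) (TFB 0).
have C0 : 0 <= C by rewrite addr_ge0.
pose kappa := Num.min (t * delta / 2) (delta / (4 * (C + 1))).
have C1 : 0 < C + 1 by rewrite ltr_wpDl.
have kappa0 : 0 < kappa by rewrite lt_min !divr_gt0// mulr_gt0.
have k1 : kappa <= t * delta / 2 by rewrite ge_min lexx.
have k2 : C * kappa <= delta / 4.
  have : kappa <= delta / (4 * (C + 1)) by rewrite ge_min lexx orbT.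
  rewrite ler_pdivlMr ?mulr_gt0// => h.
  by have := kappa0; nra.
exists kappa => // N l Gfin Gk Sk.
rewrite supported_integral.
set S := \sum_(i < N.+1) if _ then H _ else 0.
set th := \sum_(i < N.+1) if _ then _ else _ in Sk.
pose g x := fine (TF x).
have N0 : 0 < N.+1%:R :> R by [].
have gE : fine (\int[emp l]_x TF x)%E = N.+1%:R^-1 * \sum_(i < N.+1) g (tnth l i).
  rewrite integral_emp// (eq_bigr (fun i => (g (tnth l i))%:E)) => [|i _]; last by rewrite fineK.
  by rewrite sumEFin.
have h1 : `|\sum_(i < N.+1) g (tnth l i) - (S - N.+1%:R * H (- K))| <= C * th.
  rewrite -sum_ord_const /S -!sumrB /th mulr_sumr.
  apply: le_trans (ler_norm_sum _ _ _) _; apply: ler_sum => i _.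
  set x := tnth l i; case: (leP `|x| K) => xK.
    rewrite /g /TF (test_functionE dH cphi)//= subrr normr0.
    by rewrite mulr_ge0//; case: ifP.
  rewrite (ltW xK) sub0r opprK.
  have g0 : 0 <= g x by rewrite fine_ge0.
  have gB : g x <= H K - H (- K) by rewrite -lee_fin fineK.
  apply: (@le_trans _ _ C).
    by apply: le_trans (ler_normD _ _) _; rewrite ger0_norm// lerD2r.
  by rewrite ler_peMr// (le_trans K1)// ltW.
have h2 := test_function_gap2 K0 cphi phiM (emp l) sigma t0.
have h3 := test_function_gap2 K0 cphi phiM sigma (emp l) t0.
move: h2 h3; rewrite (gap2C _ sigma) -/TF.
rewrite -(fineK (IfinP (emp l))) -(fineK (IfinP sigma)) -(fineK Gfin).
rewrite -!EFinM -!EFinD !lee_fin gE.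
set a := \sum_(i < N.+1) g _ in h1 *; set tau := fine (\int[sigma]_x TF x)%E.
set G := fine (gap2 _ _ _) in Gk *.
have hG : (2 * t)^-1 * G <= delta / 4.
  have t2 : 0 < 2 * t by rewrite mulr_gt0.
  rewrite mulrC ler_pdivrMr//; apply: (le_trans (ltW Gk)); apply: (le_trans k1).
  by rewrite le_eqVlt; apply/orP; left; apply/eqP; field.
move=> h2 h3 /=.
have : `|N.+1%:R^-1 * a - (N.+1%:R^-1 * S - H (- K))| <= C * kappa.
  have -> : N.+1%:R^-1 * a - (N.+1%:R^-1 * S - H (- K)) =
     N.+1%:R^-1 * (a - (S - N.+1%:R * H (- K))).
    by rewrite !mulrBr mulKf// pnatr_eq0.
  rewrite normrM gtr0_norm ?invr_gt0// ler_pdivrMl//.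
  apply: (le_trans h1); rewrite mulrCA ler_wpM2l//; exact: ltW.
rewrite ler_norml => /andP[]; move: h2 h3 hG tK k2; rewrite -/kappa.
set u1 := (2 * t)^-1 * G; set u2 := t * (K * M ^+ 2); set u3 := N.+1%:R^-1 * a.
set u4 := N.+1%:R^-1 * S; set u5 := C * kappa; move: u1 u2 u3 u4 u5 (H _) => u1 u2 u3 u4 u5 u6.
move=> h2 h3 hG tK k2 h4 h5.
by rewrite ltr_norml; apply/andP; split; lra.
Qed.

End EmpiricalTest.

Section TruncatedMoment.
Context {R : realType}.
Notation mR := (measurableTypeR R).
Variables (K : R) (sigma : probability mR R).
Hypothesis K1 : 1 <= K.
Hypothesis supp : sigma (~` [set x | `|x| <= K]) = 0%E.

Definition truncated_moment (p N : nat) (l : N.-tuple mR) : R :=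
  N%:R^-1 * \sum_(i < N) if `|tnth l i| <= K then tnth l i ^+ p else 0.

(* [x^p] is a difference of two functions that are nondecreasing on [-K, K]. *)
Lemma truncated_moment_near (p : nat) (delta : R) : 0 < delta ->
  exists2 kappa : R, 0 < kappa &
  forall N (l : N.+1.-tuple mR), gap2 (4 * K) (emp l) sigma \is a fin_num ->
  fine (gap2 (4 * K) (emp l) sigma) < kappa ->
  (\sum_(i < N.+1) if K <= `|tnth l i| then `|tnth l i| else 0) < N.+1%:R * kappa ->
  `|truncated_moment p l - moment sigma p| < delta.
Proof.
move=> delta0.
have K0 : 0 < K by exact: lt_le_trans K1.
(* A bound of |p x^(p-1)| on [-K, K]: adding c x makes x^p nondecreasing there. *)
pose c := p%:R * K ^+ p.-1.
have c0 : 0 <= c by rewrite mulr_ge0// exprn_ge0// ltW.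
pose H1 (x : R) := x ^+ p + c * x.
pose H2 (x : R) := c * x.
pose phi1 (x : R) := p%:R * x ^+ p.-1 + c.
pose phi2 (x : R) := c.
have dH2 (x : R) : is_derive x (1 : R) H2 (phi2 x).
  by have := is_deriveZ c (is_derive_id x (1 : R)); rewrite /GRing.scale/= mulr1.
have dH1 (x : R) : is_derive x (1 : R) H1 (phi1 x).
  suff d1 : is_derive x (1 : R) (fun y : R => y ^+ p) (p%:R * x ^+ p.-1) by exact: is_deriveD d1 (dH2 x).
  have := is_deriveX p (is_derive_id x (1 : R)); rewrite /GRing.scale/= mulr1.
  by rewrite (_ : id ^+ p = fun y => y ^+ p)//; apply/funext => y; rewrite exprfctE.
have cX n : continuous (fun x : R => x ^+ n) by exact: exprn_continuous.
have cphi2 : continuous phi2 by exact: cst_continuous.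
have cphi1 : continuous phi1.
  move=> x; apply: cvgD; last exact: cvg_cst.
  by apply: cvgM; [exact: cvg_cst|exact: cX].
have P1 x : `|x| <= K -> 0 <= phi1 x <= 2 * c.
  move=> xK; have : `|p%:R * x ^+ p.-1| <= c.
    by rewrite normrM normr_nat normrX ler_wpM2l// lerXn2r// nnegrE ltW.
  by rewrite ler_norml /phi1 => /andP[? ?]; apply/andP; split; lra.
have P2 x : `|x| <= K -> 0 <= phi2 x <= 2 * c by move=> _; rewrite /phi2 c0/=; lra.
have d20 : 0 < delta / 2 by rewrite divr_gt0.
have [k1 k10 T1] := test_function_emp K1 supp dH1 cphi1 P1 d20.
have [k2 k20 T2] := test_function_emp K1 supp dH2 cphi2 P2 d20.
have mE : moment sigma p = \int[sigma]_x (H1 x) - \int[sigma]_x (H2 x).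
  rewrite /H1 RintegralD//.
  - by rewrite addrK.
  - exact: (supported_integrable supp (cX p)).
  - apply: (supported_integrable supp (H := H2)).
    by move=> x; apply: cvgM; [exact: cvg_cst|exact: cvg_id].
exists (Num.min k1 k2); first by rewrite lt_min k10.
move=> N l Gfin; rewrite lt_min => /andP[G1 G2] S.
have N0 : 0 < N.+1%:R :> R by [].
have [m1 m2] : Num.min k1 k2 <= k1 /\ Num.min k1 k2 <= k2 by rewrite !ge_min !lexx orbT.
have {}T1 := T1 N l Gfin G1 (lt_le_trans S (ler_wpM2l (ltW N0) m1)).
have {}T2 := T2 N l Gfin G2 (lt_le_trans S (ler_wpM2l (ltW N0) m2)).
have -> : truncated_moment p l =
    N.+1%:R^-1 * (\sum_(i < N.+1) if `|tnth l i| <= K then H1 (tnth l i) else 0) -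
    N.+1%:R^-1 * (\sum_(i < N.+1) if `|tnth l i| <= K then H2 (tnth l i) else 0).
  rewrite -mulrBr -sumrB; congr (_ * _); apply: eq_bigr => i _.
  by case: ifP => _; rewrite ?subr0// addrK.
rewrite mE; move: T1 T2; set s1 := _ * (\sum_(i < N.+1) if _ then H1 _ else _).
set s2 := _ * \sum_(i < N.+1) _; move: s1 s2 (\int[sigma]_x _) (\int[sigma]_x _) => s1 s2 i1 i2.
rewrite !ltr_norml => /andP[? ?] /andP[? ?].
by apply/andP; split; lra.
Qed.

End TruncatedMoment.

(** * Concentration of the truncated moment at speed N^2 *)

Section Concentration.
Context {R : realType}.
Notation mR := (measurableTypeR R).
Notation leb := (@lebesgue_measure R).
Notation pow := (power_measure leb).
Variables (beta : R) (Vt V : R -> R) (c1 : R).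
Hypotheses (beta0 : (0 < beta)%R) (cVt : continuous Vt).
Hypothesis (Vt0 : forall x, (0 <= Vt x)%R).
Hypothesis growth : forall C : R, exists K : R, (0 < K)%R /\
  forall x, (K <= `|x|)%R -> (C * (1 + `|x|) <= Vt x)%R.
Hypothesis VE : forall x, (V x = Vt x + beta * clog x - c1)%R.
Variable sigma : probability mR R.
Hypothesis hmin : forall mu : probability mR R, (eng beta Vt sigma <= eng beta Vt mu)%E.

Definition outer_norm (K x : R) : R := if K <= `|x| then `|x| else 0.

Lemma outer_norm_ge0 K x : 0 <= outer_norm K x.
Proof. by rewrite /outer_norm; case: ifP. Qed.

Lemma measurable_outer_norm K : measurable_fun [set: mR] (outer_norm K : mR -> R).
Proof.
apply: measurable_fun_ifT => //.
by apply: measurable_fun_ler => //; exact: (@normr_measurable R setT).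
Qed.

Lemma integral_outer_norm K N : 0 <= K ->
  (\int[pow N]_l (expR (- \sum_(i < N) outer_norm K (tnth l i)))%:E <=
   (expR (N%:R * (K + 1)))%:E)%E.
Proof.
move=> K0; pose h (x : mR) := expR (- outer_norm K x).
have mh : measurable_fun [set: mR] h.
  apply: (measurableT_comp (@measurable_expR R)); apply: measurable_funN.
  exact: measurable_outer_norm.
under eq_integral do rewrite -sumrN expR_sum.
have -> := @integral_pow_prod R N h mh (fun x => expR_ge0 _).
have I : (\int[leb]_x (h x)%:E <= (expR (K + 1))%:E)%E.
  apply: (@le_trans _ _ (\int[leb]_x ((expR K)%:E * (expR (- (1 * `|x|)))%:E))%E).
    apply: ge0_le_integral => //.
    - by move=> x _; rewrite lee_fin expR_ge0.
    - exact/measurable_EFinP.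
    - by apply: measurable_funeM; apply/measurable_EFinP; exact: measurable_expR_norm.
    move=> x _; rewrite -EFinM lee_fin -expRD ler_expR mul1r /outer_norm.
    by case: ifPn => [_|]; [|rewrite -ltNge]; lra.
  rewrite ge0_integralZl_EFin ?expR_ge0//; last first.
    by apply/measurable_EFinP; exact: measurable_expR_norm.
  rewrite integral_expR_norm// -EFinM lee_fin expRD ler_wpM2l ?expR_ge0// divr1.
  by have := expR_ge1Dx (1 : R); lra.
have I0 : (0 <= \int[leb]_x (h x)%:E)%E.
  by apply: integral_ge0 => x _; rewrite lee_fin expR_ge0.
move: I I0; case: (\int[leb]_x (h x)%:E)%E => [u| |] // uK u0.
rewrite -EFin_expe lee_fin mulrC expRM_natr.
by rewrite lerXn2r// nnegrE// expR_ge0.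
Qed.

Lemma integral_weight_le R0 (A : R) N (B : set (N.-tuple mR)) : 0 <= R0 -> measurable B ->
  (forall l, B l -> beta_weight V beta l <= expR (A - \sum_(i < N) outer_norm R0 (tnth l i))) ->
  (\int[pow N]_(l in B) (beta_weight V beta l)%:E <= (expR (A + N%:R * (R0 + 1)))%:E)%E.
Proof.
move=> R00 mB HB.
have mE : measurable_fun [set: N.-tuple mR]
    (fun l : N.-tuple mR => (expR (- \sum_(i < N) outer_norm R0 (tnth l i)))%:E).
  apply/measurable_EFinP; apply: (measurableT_comp (@measurable_expR R)).
  apply: measurable_funN; apply: measurable_sum => i.
  exact: (measurableT_comp (measurable_outer_norm R0) (@measurable_tnth _ mR N i)).
rewrite expRD EFinM; apply: le_trans (lee_wpmul2l _ (integral_outer_norm N R00)); last first.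
  by rewrite lee_fin expR_ge0.
rewrite -ge0_integralZl_EFin ?expR_ge0//.
apply: (@le_trans _ _ (\int[pow N]_(l in B) ((expR A)%:E *
    (expR (- \sum_(i < N) outer_norm R0 (tnth l i)))%:E))%E).
  apply: ge0_le_integral => //.
  - by move=> l _; rewrite lee_fin beta_weight_ge0.
  - by apply: measurable_funTS; apply/measurable_EFinP; exact: (measurable_beta_weight cVt VE).
  - by apply: measurable_funTS; exact: measurable_funeM.
  by move=> l Bl; rewrite -EFinM lee_fin -expRD; exact: HB.
apply: ge0_subset_integral => //; first exact: measurable_funeM.
Qed.

Lemma partition_function_fin N : exists2 z : R, 0 < z & partition_function V beta N.+1 = z%:E.
Proof.
have [C Z0] := partition_function_ge beta0 cVt Vt0 growth VE hmin (ltr01 : 0 < 1 :> R).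
have {}Z0 : (0 < partition_function V beta N.+1)%E.
  by apply: lt_le_trans (Z0 _); rewrite lte_fin expR_gt0.
have [K0 HK] := exists_large_radius beta0 cVt Vt0 growth hmin.
have LR := HK K0 (lexx _); have [R01 _ _] := LR.
have R00 : 0 <= K0 by exact: le_trans R01.
have [C' W] := weight_le_gap beta0 cVt Vt0 growth VE hmin LR (ltr01 : 0 < 1 :> R).
have : (partition_function V beta N.+1 < +oo)%E.
  apply: (le_lt_trans (integral_weight_le R00 measurableT (A := N.+1%:R ^+ 2 *
    (c1 - min_energy beta Vt sigma + 1) + N.+1%:R * C') _)); last exact: ltry.
  move=> l _; have [Gf Wl] := W N l; apply: (le_trans Wl); rewrite ler_expR.
  set S := \sum_(i < N.+1) if _ then _ else _.
  have S0 : 0 <= S by apply: sumr_ge0 => i _; exact: (outer_norm_ge0 K0).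
  have h1 : S <= N.+1%:R * S by rewrite ler_peMl// ler1n.
  have h2 : 0 <= N.+1%:R ^+ 2 * (beta / (16 * K0) * fine (gap2 (4 * K0) (emp l) sigma)).
    rewrite mulr_ge0 ?sqr_ge0// mulr_ge0//; first by rewrite divr_ge0 ?mulr_ge0// ltW.
    by rewrite fine_ge0// gap2_ge0.
  by lra.
move: Z0; case: (partition_function V beta N.+1) => [z| |] // z0 _.
by exists z.
Qed.

End Concentration.

Section Concentration2.
Context {R : realType}.
Notation mR := (measurableTypeR R).
Notation leb := (@lebesgue_measure R).
Notation pow := (power_measure leb).

Lemma measurable_truncated_moment (K : R) (p N : nat) :
  measurable_fun [set: N.-tuple mR] (truncated_moment K p (N := N)).
Proof.
apply: measurable_funM => //; apply: measurable_sum => i.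
apply: (measurableT_comp (f := fun x : mR => if `|x| <= K then x ^+ p else 0 : R)
  _ (@measurable_tnth _ mR N i)).
apply: measurable_fun_ifT => //.
by apply: measurable_fun_ler => //; exact: (@normr_measurable R setT).
Qed.

Variables (beta : R) (Vt V : R -> R) (c1 : R).
Hypotheses (beta0 : (0 < beta)%R) (cVt : continuous Vt).
Hypothesis (Vt0 : forall x, (0 <= Vt x)%R).
Hypothesis growth : forall C : R, exists K : R, (0 < K)%R /\
  forall x, (K <= `|x|)%R -> (C * (1 + `|x|) <= Vt x)%R.
Hypothesis VE : forall x, (V x = Vt x + beta * clog x - c1)%R.
Variable sigma : probability mR R.
Hypothesis hmin : forall mu : probability mR R, (eng beta Vt sigma <= eng beta Vt mu)%E.

(** A deviation forces either a gap of at least kappa or an outer sum of at least N kappa. Both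
    lower the density by exp(-q N^2), which outweighs the errors q / 4 made in the density and in
    the partition function; c = q / 4 then leaves room for the terms linear in N. *)
Lemma truncated_moment_concentration (R0 : R) (p : nat) (delta : R) :
  large_radius beta Vt sigma R0 -> 0 < delta ->
  exists2 c : R, 0 < c & \forall N \near \oo,
    (\int[pow N]_(l in [set l : N.-tuple mR | (delta <= `|truncated_moment R0 p l - moment sigma p|)%R])
       (beta_weight V beta l)%:E <=
     (expR (- (c * N%:R ^+ 2)))%:E * partition_function V beta N)%E.
Proof.
move=> LR delta0; have [R01 supp _] := LR.
have R00 : 0 < R0 by exact: lt_le_trans R01.
have [kappa kappa0 T] := truncated_moment_near R01 supp p delta0.
pose a := beta / (16 * R0).
have a0 : 0 < a by rewrite divr_gt0// mulr_gt0.
pose q := Num.min (a * kappa) (kappa / 2).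
have q0 : 0 < q by rewrite lt_min divr_gt0// mulr_gt0.
have [qa qk] : q <= a * kappa /\ q <= kappa / 2 by rewrite !ge_min !lexx orbT.
have eta0 : 0 < q / 4 by rewrite divr_gt0.
have [C W] := weight_le_gap beta0 cVt Vt0 growth VE hmin LR eta0.
have [C' Z] := partition_function_ge beta0 cVt Vt0 growth VE hmin eta0.
pose E := c1 - min_energy beta Vt sigma.
exists (q / 4) => //.
near=> N.
have N2 : 2 <= N%:R :> R by near: N; exact: nbhs_infty_ger.
have N0 : 0 < N%:R :> R by exact: lt_le_trans N2.
have NC : 4 * (C + C' + R0 + 1) / q <= N%:R by near: N; exact: nbhs_infty_ger.
have NS : N = N.-1.+1 by rewrite prednK// -(ltr0n R).
pose B := [set l : N.-tuple mR | delta <= `|truncated_moment R0 p l - moment sigma p|].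
have mB : measurable B.
  rewrite /B -[X in measurable X]setTI.
  have mf : measurable_fun [set: N.-tuple mR]
      (fun l : N.-tuple mR => `|truncated_moment R0 p l - moment sigma p|).
    apply: (measurableT_comp (@normr_measurable R setT)).
    by apply: measurable_funB => //; exact: measurable_truncated_moment.
  have -> : [set l : N.-tuple mR | delta <= `|truncated_moment R0 p l - moment sigma p|] =
     (fun l : N.-tuple mR => `|truncated_moment R0 p l - moment sigma p|) @^-1` `[delta, +oo[.
    by apply/seteqP; split => l /=; rewrite in_itv/= andbT.
  exact: mf.
apply: (le_trans (integral_weight_le cVt VE (ltW R00) mB
  (A := N%:R ^+ 2 * (E + q / 4 - q) + N%:R * C) _)).
  move: (N) N2 NS @B mB => [//|n] N2 _ B _ l Bl.
  have [Gf Wl] := W n l; apply: (le_trans Wl); rewrite ler_expR -/E -/a.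
  set G := fine _; set S := \sum_(i < n.+1) _.
  have S0 : 0 <= S by apply: sumr_ge0 => i _; exact: (outer_norm_ge0 R0).
  have G0 : 0 <= G by rewrite fine_ge0// gap2_ge0.
  (* Half of N S can pay for the deviation; the other half keeps the factor exp(-S) that makes the
     bound integrable. *)
  have nS : 2 * S <= n.+1%:R * S by rewrite ler_wpM2r.
  suff h : n.+1%:R ^+ 2 * q + S <= n.+1%:R ^+ 2 * (a * G) + n.+1%:R * S.
    by move: h; rewrite /S; lra.
  have aG : 0 <= n.+1%:R ^+ 2 * (a * G) by rewrite mulr_ge0 ?sqr_ge0// mulr_ge0// ltW.
  have [Gk|Gk] := ltP G kappa; last first.
    have : n.+1%:R ^+ 2 * q <= n.+1%:R ^+ 2 * (a * G).
      by rewrite ler_wpM2l ?sqr_ge0// (le_trans qa)// ler_pM2l.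
    by lra.
  have [Sk|Sk] := ltP S (n.+1%:R * kappa).
    by have := T n l Gf Gk Sk; rewrite ltNge Bl.
  have : n.+1%:R ^+ 2 * q <= n.+1%:R * S / 2.
    rewrite expr2 -!mulrA ler_wpM2l// ler_pdivlMr//.
    apply: le_trans Sk; rewrite -mulrA ler_wpM2l//.
    by rewrite -ler_pdivlMr.
  by lra.
apply: le_trans (lee_wpmul2l _ (Z N)); last by rewrite lee_fin expR_ge0.
rewrite -EFinM lee_fin -expRD ler_expR -/E.
have : 4 * (C + C' + R0 + 1) * N%:R <= N%:R * (q * N%:R).
  by rewrite mulrC ler_pM2l// [q * _]mulrC -ler_pdivrMr.
by lra.
Unshelve. all: by end_near. Qed.

End Concentration2.

(** * Probabilities under the ensemble and the cost of distant particles *)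

Section EnsembleProbability.
Context {R : realType}.
Notation mR := (measurableTypeR R).
Notation leb := (@lebesgue_measure R).
Notation pow := (power_measure leb).
Variables (V : R -> R) (beta : R) (N : nat).
Hypothesis mw : measurable_fun [set: N.-tuple mR] (beta_weight V beta (N := N)).
Variable z : R.
Hypotheses (z0 : 0 < z) (Zz : partition_function V beta N = z%:E).
Local Open Scope ereal_scope.
Implicit Types A B : set (N.-tuple mR).

Let mEw : measurable_fun [set: N.-tuple mR] (fun l : N.-tuple mR => (beta_weight V beta l)%:E).
Proof. exact/measurable_EFinP. Qed.

Let w0 (l : N.-tuple mR) : 0 <= (beta_weight V beta l)%:E.
Proof. by rewrite lee_fin beta_weight_ge0. Qed.

Let zI : (0 <= z^-1)%R. Proof. by rewrite invr_ge0 ltW. Qed.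

Lemma ensembleE A : beta_ensemble V beta A =
  (z^-1)%:E * \int[pow N]_(l in A) (beta_weight V beta l)%:E.
Proof. by rewrite /beta_ensemble Zz inver gt_eqF// muleC. Qed.

Lemma ensemble_ge0 A : 0 <= beta_ensemble V beta A.
Proof. by rewrite ensembleE mule_ge0 ?lee_fin//; apply: integral_ge0. Qed.

Lemma le_ensemble A B : measurable A -> measurable B -> A `<=` B ->
  beta_ensemble V beta A <= beta_ensemble V beta B.
Proof.
move=> mA mB AB; rewrite !ensembleE; apply: lee_wpmul2l; first by rewrite lee_fin.
by apply: ge0_subset_integral => //; exact: measurable_funTS.
Qed.

Lemma ensembleU_le A B : measurable A -> measurable B ->
  beta_ensemble V beta (A `|` B) <= beta_ensemble V beta A + beta_ensemble V beta B.
Proof.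
move=> mA mB; have mBA : measurable (B `\` A) by exact: measurableD.
have -> : A `|` B = A `|` (B `\` A) by rewrite setDE setUIr setUv setIT.
apply: (@le_trans _ _ (beta_ensemble V beta A + beta_ensemble V beta (B `\` A))).
  rewrite !ensembleE ge0_integral_setU//.
  - by rewrite ge0_muleDr//; apply: integral_ge0.
  - exact: measurable_funTS.
  - by apply/disj_setPS => l [Al [_ nAl]].
by apply: leeD2l; apply: le_ensemble => // l [].
Qed.

Lemma ensembleT : beta_ensemble V beta [set: N.-tuple mR] = 1.
Proof.
by rewrite ensembleE -/(partition_function V beta N) Zz -EFinM mulVf// gt_eqF.
Qed.

Lemma ensemble_le A (e : R) :
  \int[pow N]_(l in A) (beta_weight V beta l)%:E <= e%:E * partition_function V beta N ->
  beta_ensemble V beta A <= e%:E.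
Proof.
move=> Ae; rewrite ensembleE; apply: (le_trans (lee_wpmul2l _ Ae)); first by rewrite lee_fin.
by rewrite Zz -!EFinM lee_fin mulrCA mulVf ?mulr1// gt_eqF.
Qed.

Lemma ensemble_ge A (e : R) :
  e%:E * partition_function V beta N <= \int[pow N]_(l in A) (beta_weight V beta l)%:E ->
  e%:E <= beta_ensemble V beta A.
Proof.
move=> Ae; rewrite ensembleE; apply: le_trans (lee_wpmul2l _ Ae); last by rewrite lee_fin.
by rewrite Zz -!EFinM lee_fin mulrCA mulVf ?mulr1// gt_eqF.
Qed.

End EnsembleProbability.

Section OuterTail.
Context {R : realType}.
Notation mR := (measurableTypeR R).
Notation leb := (@lebesgue_measure R).
Notation pow := (power_measure leb).
Variables (beta : R) (Vt V : R -> R) (c1 : R).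
Hypotheses (beta0 : (0 < beta)%R) (cVt : continuous Vt).
Hypothesis (Vt0 : forall x, (0 <= Vt x)%R).
Hypothesis VE : forall x, (V x = Vt x + beta * clog x - c1)%R.
Variables (K M : R) (h : R -> R).
Hypothesis VM : forall s, 0 <= s <= 1 -> V s <= M.
Hypothesis mh : measurable_fun [set: mR] (h : mR -> R).
Hypothesis hK : forall x, K < `|x| -> 7 * beta + M + 1 + `|x| + h x <= Vt x - c1.

(** Markov's inequality for the product of the outer weights, whose mean is at most 2^N <=
    exp(N). *)
Lemma outer_weight_tail N (A : set (N.-tuple mR)) (t : R) : measurable A ->
  (forall l, A l -> t <= \sum_(i < N) if `|tnth l i| <= K then 0 else h (tnth l i)) ->
  (\int[pow N]_(l in A) (beta_weight V beta l)%:E <=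
   (expR (N%:R * (1 - t)))%:E * partition_function V beta N)%E.
Proof.
move=> mA At.
have H := integral_outer_weights beta0 cVt VE VM mh hK N.
have mB := measurable_beta_weight cVt VE (N := N).
have mP : measurable_fun [set: N.-tuple mR] (fun l : N.-tuple mR =>
    (beta_weight V beta l * \prod_(i < N) outer_weight K h N (tnth l i))%:E).
  apply/measurable_EFinP; apply: measurable_funM => //; apply: measurable_prod => i _.
  exact: (measurableT_comp (measurable_outer_weight K mh N) (@measurable_tnth _ mR N i)).
have P0 (l : N.-tuple mR) : 0 <= \prod_(i < N) outer_weight K h N (tnth l i).
  by apply: prodr_ge0 => i _; exact: outer_weight_ge0.
have n0 (l : N.-tuple mR) : (0 <= (beta_weight V beta l *
    \prod_(i < N) outer_weight K h N (tnth l i))%:E)%E.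
  by rewrite lee_fin mulr_ge0 ?beta_weight_ge0.
have e0 : (0 <= (expR (- (N%:R * t)))%:E)%E by rewrite lee_fin expR_ge0.
apply: (@le_trans _ _ ((expR (- (N%:R * t)))%:E * ((2 ^+ N)%:E * partition_function V beta N))%E); last first.
  rewrite muleA -EFinM; apply: lee_wpmul2r.
    by apply: integral_ge0 => l _; rewrite lee_fin beta_weight_ge0.
  rewrite lee_fin mulrBr mulr1 expRD mulrC; apply: ler_wpM2r; first exact: expR_ge0.
  by rewrite -[in leRHS](mulr1 N%:R) expRM_natl lerXn2r ?nnegrE ?expR_ge0//; have := expR_ge1Dx (1 : R); lra.
apply: le_trans (lee_wpmul2l e0 H).
rewrite -ge0_integralZl_EFin ?expR_ge0//.
apply: (@le_trans _ _ (\int[pow N]_(l in A) ((expR (- (N%:R * t)))%:E *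
    (beta_weight V beta l * \prod_(i < N) outer_weight K h N (tnth l i))%:E))%E); last first.
  by apply: ge0_subset_integral => //; [exact: measurable_funeM|move=> l _; rewrite mule_ge0].
apply: ge0_le_integral => //.
- by move=> l _; rewrite lee_fin beta_weight_ge0.
- by apply: measurable_funTS; exact/measurable_EFinP.
- by apply: measurable_funTS; exact: measurable_funeM.
move=> l Al; rewrite -EFinM lee_fin mulrCA ler_peMr ?beta_weight_ge0//.
have -> : \prod_(i < N) outer_weight K h N (tnth l i) =
    expR (N%:R * \sum_(i < N) if `|tnth l i| <= K then 0 else h (tnth l i)).
  rewrite mulr_sumr expR_sum; apply: eq_bigr => i _; rewrite /outer_weight.
  by case: ifP => _ //; rewrite mulr0 expR0.
rewrite -expRD -expR0 ler_expR addrC subr_ge0 ler_wpM2l//.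
exact: At.
Qed.

End OuterTail.

(** * Subadditivity of powers, and comparison of N, N^(1+q) and N^2 *)

Section Powers.
Context {R : realType}.
Implicit Types (x y r a : R).

(** For u = x and u = y the fraction u / (x + y) is at most its r-th power; multiply by (x + y)^r
    and add. *)
Lemma powRD_le x y r : 0 <= x -> 0 <= y -> 0 < r <= 1 -> (x + y) `^ r <= x `^ r + y `^ r.
Proof.
move=> x0 y0 /andP[r0 r1].
have [->|nx] := eqVneq x 0; first by rewrite add0r lerDr powR_ge0.
have [->|ny] := eqVneq y 0; first by rewrite addr0 lerDl powR_ge0.
have {nx}x0 : 0 < x by rewrite lt_neqAle eq_sym nx.
have {ny}y0 : 0 < y by rewrite lt_neqAle eq_sym ny.
have s0 : 0 < x + y by rewrite addr_gt0.
have H u : 0 < u -> u <= x + y -> u / (x + y) * (x + y) `^ r <= u `^ r.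
  move=> u0 us; have sn : x + y != 0 by rewrite gt_eqF.
  rewrite -[in leRHS](divfK sn u).
  have d0 : 0 <= u / (x + y) by exact: divr_ge0 (ltW u0) (ltW s0).
  rewrite (powRM r d0 (ltW s0)); apply: ler_wpM2r; first exact: powR_ge0.
  by apply: ger1_powR => //; rewrite divr_gt0//= ler_pdivrMr// mul1r.
have := lerD (H x x0 _) (H y y0 _); rewrite -mulrDl -mulrDl divff ?gt_eqF// mul1r.
by apply; rewrite ?lerDl ?lerDr ltW.
Qed.

(** The reason why one distant particle is cheaper than several: splitting an excess of the moment
    does not lower the total cost. *)
Lemma powR_sum_le (I : Type) (s : seq I) (P : pred I) (F : I -> R) r : 0 < r <= 1 ->
  (forall i, 0 <= F i) ->
  (\sum_(i <- s | P i) F i) `^ r <= \sum_(i <- s | P i) F i `^ r.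
Proof.
move=> r01 F0; have /andP[r0 _] := r01.
elim: s => [|i s IH]; first by rewrite !big_nil powR0// gt_eqF.
rewrite !big_cons; case: ifP => // _; apply: le_trans (powRD_le _ _ r01) _ => //.
  exact: sumr_ge0.
by rewrite lerD2l.
Qed.

Lemma powR_exp_div x a (p : nat) : (0 < p)%N -> 0 <= x -> (x ^+ p) `^ (a / p%:R) = x `^ a.
Proof.
move=> p0 x0; rewrite -powR_mulrn// -powRrM mulrCA divff ?mulr1// pnatr_eq0.
by rewrite -lt0n.
Qed.

Lemma continuous_norm_powR a : 1 <= a -> continuous (fun x : R => `|x| `^ a).
Proof.
move=> a1 x; have [->|x0] := eqVneq x 0.
  apply/cvgrPdist_lt => e e0; near=> y.
  rewrite normr0 powR0 ?gt_eqF ?(lt_le_trans ltr01)// sub0r normrN ger0_norm ?powR_ge0//.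
  have y1 : `|y| < Num.min 1 e.
    by near: y; exists (Num.min 1 e) => /=; [rewrite lt_min ltr01|move=> z /=; rewrite sub0r normrN].
  move: y1; rewrite lt_min => /andP[y1 ye].
  apply: le_lt_trans ye; have [->|y0] := eqVneq y 0.
    by rewrite normr0 powR0// gt_eqF// (lt_le_trans ltr01).
  by apply: ge1r_powR => //; rewrite normr_gt0 y0 ltW.
have -> : (fun y : R => `|y| `^ a) = (fun y => y `^ a) \o Num.norm by [].
apply: continuous_comp; first exact: norm_continuous.
apply: differentiable_continuous; apply/derivable1_diffP.
by apply: derivable_powR; rewrite in_itv/= andbT normr_gt0.
Unshelve. all: by end_near. Qed.

End Powers.

Section Asymptotics.
Context {R : realType}.
Variable q : R.
Hypotheses (q0 : 0 < q) (q1 : q < 1).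

Definition moment_speed (N : nat) : R := N%:R `^ (1 + q).

Lemma powR_nat_ge (r X : R) : 0 < r -> \forall N \near \oo, X <= N%:R `^ r.
Proof.
move=> r0; pose Y := Num.max X 1.
have Y0 : 0 <= Y by rewrite le_max ler01 orbT.
near=> N; have NY : Y `^ r^-1 <= N%:R by near: N; exact: nbhs_infty_ger.
have : (Y `^ r^-1) `^ r <= N%:R `^ r by apply: ge0_ler_powR; rewrite ?nnegrE ?powR_ge0// ltW.
rewrite -powRrM mulVf ?gt_eqF// powRr1//; apply: le_trans.
by rewrite le_max lexx.
Unshelve. all: by end_near. Qed.

Lemma moment_speedE N : moment_speed N = N%:R * N%:R `^ q.
Proof.
rewrite /moment_speed powRD; first by rewrite powRr1.
by rewrite gt_eqF ?addr_gt0.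
Qed.

Lemma moment_speed_ge0 N : 0 <= moment_speed N. Proof. exact: powR_ge0. Qed.

Lemma linear_le_speed (A B e : R) : 0 < e ->
  \forall N \near \oo, A * N%:R + B <= e * moment_speed N.
Proof.
move=> e0; near=> N.
have N1 : 1 <= N%:R :> R by near: N; exact: nbhs_infty_ger.
have H : (`|A| + `|B|) / e <= N%:R `^ q by near: N; exact: powR_nat_ge.
rewrite moment_speedE; apply: (@le_trans _ _ ((`|A| + `|B|) * N%:R)).
  rewrite mulrDl lerD//; first by rewrite ler_wpM2r// ler_norm.
  by rewrite (le_trans (ler_norm B))// ler_peMr.
by rewrite mulrCA [leRHS]mulrC ler_wpM2r// mulrC -ler_pdivrMr.
Unshelve. all: by end_near. Qed.

(** With [linear_le_speed] this puts the speed strictly between N and N^2: linear errors are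
    negligible, and bulk deviations are rarer than any exponential at this speed. *)
Lemma speed_le_square (A B e : R) : 0 < e ->
  \forall N \near \oo, A * moment_speed N + B <= e * N%:R ^+ 2.
Proof.
move=> e0; have r0 : 0 < 1 - q by rewrite subr_gt0.
near=> N.
have N1 : 1 <= N%:R :> R by near: N; exact: nbhs_infty_ger.
have N0 : 0 < N%:R :> R by exact: lt_le_trans N1.
have H : (`|A| + `|B|) / e <= N%:R `^ (1 - q) by near: N; exact: powR_nat_ge.
have v1 : 1 <= moment_speed N.
  by rewrite -(powRr0 N%:R) ler_powR// addr_ge0// ltW.
have -> : N%:R ^+ 2 = moment_speed N * N%:R `^ (1 - q).
  rewrite -powRD; last by rewrite (gt_eqF N0) implybT.
  by rewrite (_ : 1 + q + (1 - q) = 2%:R) ?powR_mulrn//; ring.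
apply: (@le_trans _ _ ((`|A| + `|B|) * moment_speed N)).
  rewrite mulrDl lerD//; first by rewrite ler_wpM2r ?moment_speed_ge0// ler_norm.
  by rewrite (le_trans (ler_norm B))// ler_peMr.
rewrite mulrCA [leRHS]mulrC ler_wpM2r ?moment_speed_ge0//.
by rewrite mulrC -ler_pdivrMr.
Unshelve. all: by end_near. Qed.

End Asymptotics.

(** * Upper bounds for deviations of the moment *)

Section UpperBounds.
Context {R : realType}.
Notation mR := (measurableTypeR R).
Notation leb := (@lebesgue_measure R).
Notation pow := (power_measure leb).

Lemma measurable_empirical_moment (p N : nat) :
  measurable_fun [set: N.-tuple mR] (@empirical_moment R p N).
Proof.
apply: measurable_funM => //; apply: measurable_sum => i.
by apply: measurable_funX; exact: measurable_tnth.
Qed.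

Lemma empirical_truncated (K : R) p N (l : N.-tuple mR) :
  empirical_moment p l - truncated_moment K p l =
  N%:R^-1 * \sum_(i < N) if `|tnth l i| <= K then 0 else tnth l i ^+ p.
Proof.
rewrite -mulrBr -sumrB; congr (_ * _); apply: eq_bigr => i _.
by case: ifP => _; rewrite ?subrr ?subr0.
Qed.

Lemma measurable_ge_dist N (f : N.-tuple mR -> R) (c d : R) : measurable_fun setT f ->
  measurable [set l | d <= `|f l - c|].
Proof.
move=> mf; rewrite -[X in measurable X]setTI.
have mg : measurable_fun [set: N.-tuple mR] (fun l : N.-tuple mR => `|f l - c|).
  by apply: (measurableT_comp (@normr_measurable R setT)); exact: measurable_funB.
have -> : [set l : N.-tuple mR | d <= `|f l - c|] =
   (fun l : N.-tuple mR => `|f l - c|) @^-1` `[d, +oo[.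
  by apply/seteqP; split => l /=; rewrite in_itv/= andbT.
exact: mg.
Qed.

Variables (beta : R) (Vt V : R -> R) (c1 : R).
Hypotheses (beta0 : (0 < beta)%R) (cVt : continuous Vt).
Hypothesis (Vt0 : forall x, (0 <= Vt x)%R).
Hypothesis growth : forall C : R, exists K : R, (0 < K)%R /\
  forall x, (K <= `|x|)%R -> (C * (1 + `|x|) <= Vt x)%R.
Hypothesis VE : forall x, (V x = Vt x + beta * clog x - c1)%R.
Variable sigma : probability mR R.
Hypothesis hmin : forall mu : probability mR R, (eng beta Vt sigma <= eng beta Vt mu)%E.
Variables (alpha b : R) (p : nat).
Hypotheses (alpha1 : 1 <= alpha) (hp : alpha < p%:R) (b0 : 0 < b).
Hypothesis V_ge : forall b' C : R, b' < b -> exists K : R,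
  forall x, K < `|x| -> C + `|x| + b' * `|x| `^ alpha <= Vt x - c1.

Let q := alpha / p%:R.
Let m := moment sigma p.

Let alpha0 : 0 < alpha. Proof. exact: lt_le_trans alpha1. Qed.
Let p0 : 0 < p%:R :> R. Proof. exact: lt_trans alpha0 hp. Qed.
Let q0 : 0 < q. Proof. exact: divr_gt0. Qed.
Let q1 : q < 1. Proof. by rewrite ltr_pdivrMr// mul1r. Qed.

Lemma V_bounded01 : exists M : R, forall s, 0 <= s <= 1 -> V s <= M.
Proof.
have [M1 _ HM] := Vt_bounded cVt Vt0 1.
exists (M1 + beta * 1 - c1) => s /andP[s0 s1]; rewrite VE lerD2r.
have sN : `|s| <= 1 by rewrite ger0_norm.
rewrite lerD ?HM// ler_pM2l// (le_trans (clog_le_norm s))//.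
Qed.

(** [outer_weight_tail] with h = b' |x|^alpha. Subadditivity passes to the moment: the sum of
    |x|^alpha = (|x|^p)^q is at least the q-th power of the sum of |x|^p. *)
Lemma outer_moment_tail (b' : R) : 0 < b' < b -> exists K0 : R, forall K, K0 <= K ->
  forall s : R, 0 <= s -> forall N (A : set (N.-tuple mR)), measurable A ->
  (forall l, A l -> s <= \sum_(i < N) if `|tnth l i| <= K then 0 else `|tnth l i| ^+ p) ->
  (\int[pow N]_(l in A) (beta_weight V beta l)%:E <=
   (expR (N%:R * (1 - b' * s `^ q)))%:E * partition_function V beta N)%E.
Proof.
move=> /andP[b'0 b'b]; have [M HM] := V_bounded01.
have [K0 HK] := V_ge (7 * beta + M + 1) b'b.
exists K0 => K K0K s s0 N A mA As.
pose h (x : R) := b' * `|x| `^ alpha.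
have mh : measurable_fun [set: mR] (h : mR -> R).
  apply: measurable_funM => //; apply: (measurableT_comp (measurable_powR alpha)).
  exact: (@normr_measurable R setT).
apply: (outer_weight_tail beta0 cVt VE HM mh (K := K)) => //.
  by move=> x Kx; apply: HK; exact: le_lt_trans Kx.
move=> l Al; rewrite /h.
have -> : \sum_(i < N) (if `|tnth l i| <= K then 0 else b' * `|tnth l i| `^ alpha) =
    b' * \sum_(i < N) (if `|tnth l i| <= K then 0 else `|tnth l i| ^+ p) `^ q.
  rewrite mulr_sumr; apply: eq_bigr => i _; case: ifP => _.
    by rewrite powR0 ?gt_eqF// mulr0.
  by rewrite powR_exp_div// -(ltr0n R).
rewrite ler_pM2l//; apply: (le_trans _ (powR_sum_le _ _ _ _)).
- apply: ge0_ler_powR; rewrite ?nnegrE//; first exact: ltW.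
  + by apply: sumr_ge0 => i _; case: ifP => // _; rewrite exprn_ge0.
  + exact: As.
- by rewrite q0 ltW.
- by move=> i; case: ifP => // _; rewrite exprn_ge0.
Qed.

Local Notation Pr := (beta_ensemble V beta).

Lemma truncated_moment_superexp (R0 delta r : R) :
  large_radius beta Vt sigma R0 -> 0 < delta -> \forall N \near \oo,
  (Pr [set l : N.-tuple mR | (delta <= `|truncated_moment R0 p l - m|)%R] <=
   (expR (- (r * moment_speed q N)))%:E)%E.
Proof.
move=> LR delta0.
have [c c0 Hc] := truncated_moment_concentration beta0 cVt Vt0 growth VE hmin p LR delta0.
near=> N.
have N0 : (0 < N)%N by near: N; exact: nbhs_infty_gt.
have [z z0 Zz] : exists2 z : R, 0 < z & partition_function V beta N = z%:E.
  by rewrite -(prednK N0); exact: (partition_function_fin beta0 cVt Vt0 growth VE hmin).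
have sq : r * moment_speed q N + 0 <= c * N%:R ^+ 2.
  by near: N; exact: speed_le_square.
apply: (@le_trans _ _ (expR (- (c * N%:R ^+ 2)))%:E).
  by apply: (ensemble_le z0 Zz); near: N; exact: Hc.
by rewrite lee_fin ler_expR lerN2 -[leLHS]addr0.
Unshelve. all: by end_near. Qed.

(** Either the truncated moment deviates by s - s', which is negligible at this speed, or the
    particles outside a compact set contribute at least s', which [outer_moment_tail] bounds. *)
Lemma moment_deviation (r s : R) : 0 < s -> 0 <= r < b * s `^ q ->
  \forall N \near \oo,
  (Pr [set l : N.-tuple mR | (s <= `|empirical_moment p l - m|)%R] <=
   (expR (- (r * moment_speed q N)))%:E)%E.
Proof.
move=> s0 /andP[r0 rs].
have sq0 : 0 < s `^ q by exact: powR_gt0.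
have bs0 : 0 < b * s `^ q by exact: mulr_gt0.
(* The available slack is 1 - rho. Both b' = b theta and s'^q = theta s^q lose a factor theta, and
   theta^2 - rho is the square of (1 - rho) / 2. *)
pose rho := r / (b * s `^ q).
have rho1 : rho < 1 by rewrite ltr_pdivrMr// mul1r.
have rho0 : 0 <= rho by rewrite divr_ge0// ltW.
pose theta := (1 + rho) / 2.
have theta0 : 0 < theta by rewrite divr_gt0// ltr_pwDl.
have theta1 : theta < 1 by rewrite ltr_pdivrMr//; lra.
have theta2 : rho < theta ^+ 2.
  have : 0 < ((1 - rho) / 2) ^+ 2 by rewrite exprn_gt0// divr_gt0// subr_gt0.
  by rewrite /theta; lra.
pose s' := s * theta `^ q^-1.
have s'0 : 0 < s' by rewrite mulr_gt0// powR_gt0.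
have s's : s' < s.
  rewrite gtr_pMr//; have qV : 0 < q^-1 by rewrite invr_gt0.
  have := @gt0_ltr_powR R q^-1 qV theta 1; rewrite powR1.
  by apply; rewrite ?nnegrE// ltW.
have s'q : s' `^ q = s `^ q * theta.
  rewrite (powRM _ (ltW s0) (powR_ge0 _ _)); congr (_ * _).
  by rewrite -powRrM mulVf ?gt_eqF// powRr1// ltW.
pose b' := b * theta.
have b'b : 0 < b' < b by rewrite mulr_gt0//= gtr_pMr.
have rs' : r < b' * s' `^ q.
  rewrite s'q (_ : r = rho * (b * s `^ q)); last by rewrite divfK// gt_eqF.
  rewrite (_ : b' * _ = theta ^+ 2 * (b * s `^ q)); last by rewrite /b'; ring.
  by rewrite ltr_pM2r.
have [K1 HK1] := outer_moment_tail b'b.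
have [K2 HK2] := exists_large_radius beta0 cVt Vt0 growth hmin.
pose K := Num.max K1 K2.
have LR : large_radius beta Vt sigma K by apply: HK2; rewrite le_max lexx orbT.
have d0 : 0 < s - s' by rewrite subr_gt0.
have T := truncated_moment_superexp (r + 1) LR d0.
near=> N.
have N0 : (0 < N)%N by near: N; exact: nbhs_infty_gt.
have PA : (Pr [set l : N.-tuple mR | (s - s' <= `|truncated_moment K p l - m|)%R] <=
   (expR (- ((r + 1) * moment_speed q N)))%:E)%E by near: N; exact: T.
have v1 : 0 * N%:R + ln 2 <= 1 * moment_speed q N.
  by near: N; exact: linear_le_speed.
have v2 : 1 * N%:R + ln 2 <= (b' * s' `^ q - r) * moment_speed q N.
  by near: N; apply: linear_le_speed => //; rewrite subr_gt0.
have N0' : 0 < N%:R :> R by rewrite ltr0n.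
have [z z0 Zz] : exists2 z : R, 0 < z & partition_function V beta N = z%:E.
  by rewrite -(prednK N0); exact: (partition_function_fin beta0 cVt Vt0 growth VE hmin).
have mw := measurable_beta_weight cVt VE (N := N).
pose A := [set l : N.-tuple mR | s - s' <= `|truncated_moment K p l - m|].
pose B := [set l : N.-tuple mR | s' <= `|empirical_moment p l - truncated_moment K p l - 0|].
have mA : measurable A by apply: measurable_ge_dist; exact: measurable_truncated_moment.
have mB : measurable B.
  apply: (@measurable_ge_dist N (fun l => empirical_moment p l - truncated_moment K p l)).
  apply: measurable_funB; first exact: measurable_empirical_moment.
  exact: measurable_truncated_moment.
have mC : measurable [set l : N.-tuple mR | s <= `|empirical_moment p l - m|].
  by apply: measurable_ge_dist; exact: measurable_empirical_moment.
have PB : (Pr B <= (expR (N%:R * (1 - b' * (N%:R * s') `^ q)))%:E)%E.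
  apply: (ensemble_le z0 Zz); apply: (HK1 K _ (N%:R * s')) => //.
  - by rewrite le_max lexx.
  - by rewrite mulr_ge0// ltW.
  move=> l; rewrite /B/= subr0 empirical_truncated normrM ger0_norm ?invr_ge0//.
  rewrite ler_pdivlMl// => /le_trans; apply.
  apply: le_trans (ler_norm_sum _ _ _) _; apply: ler_sum => i _.
  by case: ifP => _; rewrite ?normr0// normrX.
apply: (@le_trans _ _ (Pr (A `|` B))).
  apply: (le_ensemble mw z0 Zz) => //; first exact: measurableU.
  move=> l /= sl; rewrite /A /B/= subr0.
  have [|h1] := leP (s - s') `|truncated_moment K p l - m|; first by left.
  right; have := ler_distD (truncated_moment K p l) (empirical_moment p l) m.
  by lra.
apply: (le_trans (ensembleU_le mw z0 Zz mA mB)).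
apply: (le_trans (leeD PA PB)); rewrite -EFinD lee_fin.
rewrite mul0r add0r mul1r in v1; rewrite mul1r in v2.
pose E := expR (- (r * moment_speed q N) - ln 2).
have -> : expR (- (r * moment_speed q N)) = E + E.
  have -> : E + E = 2 * E by ring.
  by rewrite /E expRD [expR (- ln 2)]expRN lnK ?posrE// mulrCA divff ?mulr1.
rewrite lerD// ler_expR.
  by lra.
rewrite (powRM _ (ltW N0') (ltW s'0)).
have -> : N%:R * (1 - b' * (N%:R `^ q * s' `^ q)) = N%:R - b' * s' `^ q * moment_speed q N.
  by rewrite moment_speedE//; ring.
by lra.
Unshelve. all: by end_near. Qed.

(** For even p the outer particles only add to the moment, so a deficit is already a deficit of the
    truncated moment. *)
Lemma moment_deviation_even (r s : R) : ~~ odd p -> 0 < s ->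
  \forall N \near \oo,
  (Pr [set l : N.-tuple mR | (empirical_moment p l <= m - s)%R] <=
   (expR (- (r * moment_speed q N)))%:E)%E.
Proof.
move=> pe s0.
have [K HK] := exists_large_radius beta0 cVt Vt0 growth hmin.
have LR := HK K (lexx _).
have T := truncated_moment_superexp r LR s0.
near=> N.
have N0 : (0 < N)%N by near: N; exact: nbhs_infty_gt.
have [z z0 Zz] : exists2 z : R, 0 < z & partition_function V beta N = z%:E.
  by rewrite -(prednK N0); exact: (partition_function_fin beta0 cVt Vt0 growth VE hmin).
have mw := measurable_beta_weight cVt VE (N := N).
apply: (@le_trans _ _ (Pr [set l : N.-tuple mR | s <= `|truncated_moment K p l - m|])).
  apply: (le_ensemble mw z0 Zz) => //.
  - rewrite -[X in measurable X]setTI.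
    have -> : [set l : N.-tuple mR | empirical_moment p l <= m - s] =
       (@empirical_moment R p N) @^-1` `]-oo, m - s].
      by apply/seteqP; split => l /=; rewrite in_itv.
    exact: measurable_empirical_moment.
  - by apply: measurable_ge_dist; exact: measurable_truncated_moment.
  move=> l /= lm; have := empirical_truncated K p l.
  have : 0 <= N%:R^-1 * (\sum_(i < N) if `|tnth l i| <= K then 0 else tnth l i ^+ p).
    rewrite mulr_ge0// sumr_ge0// => i _; case: ifP => // _.
    by rewrite exprn_even_ge0.
  move=> h1 h2; rewrite ler_normr; apply/orP; right; rewrite opprB.
  by move: h1; rewrite -h2; lra.
by near: N; exact: T.
Unshelve. all: by end_near. Qed.

End UpperBounds.

(** * Lower bound: moving one particle *)

Section MoveParticle.
Context {R : realType}.
Notation mR := (measurableTypeR R).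
Notation leb := (@lebesgue_measure R).
Notation pow := (power_measure leb).
Variables (beta : R) (Vt V : R -> R) (c1 : R).
Hypotheses (beta0 : (0 < beta)%R) (cVt : continuous Vt).
Hypothesis (Vt0 : forall x, (0 <= Vt x)%R).
Hypothesis growth : forall C : R, exists K : R, (0 < K)%R /\
  forall x, (K <= `|x|)%R -> (C * (1 + `|x|) <= Vt x)%R.
Hypothesis VE : forall x, (V x = Vt x + beta * clog x - c1)%R.

(** [A] does not constrain particle i and confines the others to [-K, K]. Hence the total mass of
    the one-particle density is at most exponential in N, while on [I], at distance at least 1 from
    the others, every interaction factor is at least 1 and the density at least exp(-N v). *)
Lemma move_particle (K : R) : 0 <= K -> exists C : R,
  forall N (i : 'I_N) (A : set (N.-tuple mR)) (I : set mR) (v : R),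
  measurable A -> measurable I -> leb I = 1%E ->
  (forall l x, A (upd l i x) <-> A l) ->
  (forall l j, A l -> j != i -> `|tnth l j| <= K) ->
  (forall x, I x -> K + 1 <= `|x| /\ V x <= v) ->
  ((expR (- (N%:R * (v + C))))%:E * \int[pow N]_(l in A) (beta_weight V beta l)%:E <=
   \int[pow N]_(l in A `&` [set l | I (tnth l i)]) (beta_weight V beta l)%:E)%E.
Proof.
move=> K0; have [K1 [K10 HK1]] := growth 1.
(* The final 1 absorbs the integral 2 of exp(-|x|), as 2 <= exp(N). *)
exists (beta * ln (1 + K) + `|c1| + K1 + 1) => N i A I v mA mI I1 Ai AK HI.
set rho := N%:R * _.
have N1 : 1 <= N%:R :> R by rewrite ler1n (leq_ltn_trans _ (ltn_ord i)).
have mw : measurable_fun [set: N.-tuple mR] (fun l : N.-tuple mR => (beta_weight V beta l)%:E).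
  by apply/measurable_EFinP; exact: (measurable_beta_weight cVt VE).
have w0 (l : N.-tuple mR) : (0 <= (beta_weight V beta l)%:E)%E by rewrite lee_fin beta_weight_ge0.
have e0 : 0 <= expR (- rho) by exact: expR_ge0.
have mAI : measurable (A `&` [set l : N.-tuple mR | I (tnth l i)]).
  apply: measurableI => //; rewrite -[X in measurable X]setTI.
  exact: (@measurable_tnth _ mR N i).
rewrite [X in (_ * X <= _)%E]integral_mkcond [leRHS]integral_mkcond.
have mF : measurable_fun [set: N.-tuple mR]
    ((fun l : N.-tuple mR => (beta_weight V beta l)%:E) \_ A).
  by apply/(measurable_restrictT _ _).1 => //; exact: measurable_funTS.
have mG : measurable_fun [set: N.-tuple mR]
    ((fun l : N.-tuple mR => (beta_weight V beta l)%:E) \_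
      (A `&` [set l : N.-tuple mR | I (tnth l i)])).
  by apply/(measurable_restrictT _ _).1 => //; exact: measurable_funTS.
have F0 (B : set (N.-tuple mR)) l : (0 <= ((fun l : N.-tuple mR => (beta_weight V beta l)%:E) \_ B) l)%E.
  by rewrite patchE; case: ifP.
rewrite -ge0_integralZl_EFin//.
apply: (@le_integral_coord R N i) => //; first exact: measurable_funeM.
  by move=> l; rewrite mule_ge0.
move=> l; have [D D0 DE] := beta_weight_upd beta V l i.
pose w (x : mR) := interaction beta l i x * expR (- (N%:R * V x)).
have wx0 x : 0 <= w x by exact: one_particle_ge0.
have mwx : measurable_fun [set: mR] (fun x => (w x)%:E).
  by apply/measurable_EFinP; exact: (measurable_one_particle cVt VE).
have [Al|nAl] := pselect (A l); last first.
  rewrite [leLHS]integral0_eq; last first.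
    by move=> x _; rewrite patchE memNset ?mule0// => /Ai; exact: nAl.
  by apply: integral_ge0.
rewrite [leLHS](_ : _ = (expR (- rho) * D)%:E * \int[leb]_x (w x)%:E)%E; last first.
  have wE0 x : (0 <= (w x)%:E)%E by rewrite lee_fin.
  rewrite -ge0_integralZl_EFin//; last by rewrite mulr_ge0.
  apply: eq_integral => x _; rewrite patchE mem_set; last exact/Ai.
  by rewrite DE -!EFinM; congr (_%:E); rewrite /w; ring.
rewrite [leRHS](_ : _ = \int[leb]_(x in I) (D * w x)%:E)%E; last first.
  rewrite [RHS]integral_mkcond; apply: eq_integral => x _; rewrite !patchE.
  rewrite [in LHS](_ : (_ \in _) = (x \in I)) ?DE//.
  by apply/idP/idP; rewrite !inE /= tnth_upd eqxx; [case|split => //; exact/Ai].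
have S_le : beta * \sum_(j < N | j != i) clog (tnth l j) <= N%:R * (beta * ln (1 + K)).
  rewrite mulrCA ler_pM2l// -sum_ord_const big_mkcond; apply: ler_sum => j _.
  case: ifPn => [ji|_]; last by rewrite ln_ge0// lerDl.
  by rewrite ler_ln ?posrE ?ltr_pwDl// lerD2l; exact: AK.
pose a := expR (N%:R * (beta * ln (1 + K) + `|c1| + K1)).
have upper : (\int[leb]_x (w x)%:E <= (a * 2)%:E)%E.
  apply: (@le_trans _ _ (\int[leb]_x (a%:E * (expR (- (1 * `|x|)))%:E))%E).
    apply: ge0_le_integral => //.
    - by move=> x _; rewrite lee_fin.
    - by apply: measurable_funeM; apply/measurable_EFinP; exact: measurable_expR_norm.
    move=> x _; rewrite -EFinM lee_fin; apply: (le_trans (one_particle_le beta0 VE l i x)).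
    rewrite -expRD ler_expR mul1r.
    have Vx : `|x| - K1 <= Vt x.
      have [|xK] := leP K1 `|x|; first by move=> /HK1; rewrite mul1r; lra.
      by apply: le_trans (Vt0 x); rewrite subr_le0 ltW.
    have h1 : `|x| <= N%:R * (Vt x + K1).
      apply: (@le_trans _ _ (Vt x + K1)); first by rewrite -lerBlDr.
      by rewrite ler_peMl// addr_ge0// ltW.
    have h2 : N%:R * c1 <= N%:R * `|c1| by rewrite ler_wpM2l// ler_norm.
    by lra.
  rewrite ge0_integralZl_EFin ?expR_ge0//; last first.
    by apply/measurable_EFinP; exact: measurable_expR_norm.
  by rewrite integral_expR_norm// divr1 EFinM.
apply: (le_trans (lee_wpmul2l _ upper)); first by rewrite lee_fin mulr_ge0.
pose c := D * expR (- (N%:R * v)).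
have c0 : 0 <= c by rewrite mulr_ge0 ?expR_ge0.
apply: (@le_trans _ _ (\int[leb]_(x in I) c%:E)%E); last first.
  apply: ge0_le_integral => //.
  - by apply: measurable_funTS; apply/measurable_EFinP; apply: measurable_funM => //; exact/measurable_EFinP.
  move=> x /HI[xK xv]; rewrite lee_fin ler_wpM2l//.
  have int1 : 1 <= interaction beta l i x.
    apply: (big_ind (fun y => 1 <= y)) => // [u u' *|j ji]; first exact: mulr_ege1.
    have lj := AK _ _ Al ji.
    have xl : 1 <= `|x - tnth l j| by have := lerB_dist x (tnth l j); lra.
    by rewrite -(powRr0 `|x - tnth l j|) ler_powR// ltW.
  apply: (@le_trans _ _ (expR (- (N%:R * V x)))); last by rewrite ler_peMl ?expR_ge0.
  by rewrite ler_expR lerN2 ler_wpM2l.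
rewrite integral_cst// [X in (_ <= _ * X)%E](_ : _ = 1%E); last exact: I1.
rewrite mule1 lee_fin /c.
rewrite mulrAC mulrC ler_wpM2l//.
have -> : expR (- rho) * (a * 2) = expR (- (N%:R * v)) * (2 * expR (- N%:R)).
  rewrite mulrA /a -expRD mulrC mulrCA -expRD; congr (_ * expR _).
  by rewrite /rho; ring.
rewrite ler_piMr ?expR_ge0// expRN ler_pdivrMr ?expR_gt0// mul1r.
by have := expR_ge1Dx (N%:R : R); lra.
Qed.

End MoveParticle.

Section GoodConfigurations.
Context {R : realType}.
Notation mR := (measurableTypeR R).
Notation leb := (@lebesgue_measure R).
Notation pow := (power_measure leb).

Definition box (K : R) N (P : pred 'I_N) : set (N.-tuple mR) :=
  [set l | forall j, P j -> `|tnth l j| <= K].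

Lemma measurable_box K N (P : pred 'I_N) : measurable (box K P).
Proof.
rewrite (_ : box K P = \bigcap_(j in [set j | P j]) [set l : N.-tuple mR | `|tnth l j| <= K]).
  apply: fin_bigcap_measurable => [|j _]; first exact: finite_finset.
  rewrite -[X in measurable X]setTI.
  by have := @measurable_tnth _ mR N j measurableT _ (measurable_abs_le K).
by apply/seteqP; split.
Qed.

Variables (beta : R) (Vt V : R -> R) (c1 : R).
Hypotheses (beta0 : (0 < beta)%R) (cVt : continuous Vt).
Hypothesis (Vt0 : forall x, (0 <= Vt x)%R).
Hypothesis growth : forall C : R, exists K : R, (0 < K)%R /\
  forall x, (K <= `|x|)%R -> (C * (1 + `|x|) <= Vt x)%R.
Hypothesis VE : forall x, (V x = Vt x + beta * clog x - c1)%R.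
Variable sigma : probability mR R.
Hypothesis hmin : forall mu : probability mR R, (eng beta Vt sigma <= eng beta Vt mu)%E.
Variables (alpha b : R) (p : nat).
Hypotheses (alpha1 : 1 <= alpha) (hp : alpha < p%:R) (b0 : 0 < b).
Hypothesis V_ge : forall b' C : R, b' < b -> exists K : R,
  forall x, K < `|x| -> C + `|x| + b' * `|x| `^ alpha <= Vt x - c1.

Let m := moment sigma p.
Let alpha0 : 0 < alpha. Proof. exact: lt_le_trans alpha1. Qed.
Let p0 : (0 < p)%N. Proof. by rewrite -(ltr0n R); exact: lt_trans alpha0 hp. Qed.
Local Notation Pr := (beta_ensemble V beta).

(** One particle beyond K already contributes K^p to the outer sum, and K is so large that (b / 2)
    K^alpha >= 2. *)
Lemma box_probability : exists K0 : R, forall K, K0 <= K -> forall N, (0 < N)%N ->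
  (Pr (~` box K (fun _ : 'I_N => true)) <= (expR (- N%:R))%:E)%E.
Proof.
have b2 : 0 < b / 2 < b by rewrite divr_gt0//= ltr_pdivrMr//; have := b0; lra.
have [K1 HK1] := outer_moment_tail beta0 cVt Vt0 VE alpha1 hp V_ge b2.
pose K0 := Num.max K1 (Num.max 1 (4 / b)).
exists K0 => K K0K N N0.
have [KK1 K1' K4] : [/\ K1 <= K, 1 <= K & 4 / b <= K].
  by split; apply: le_trans K0K; rewrite /K0 !le_max !lexx ?orbT.
have K0' : 0 <= K by exact: le_trans K1'.
have [z z0 Zz] : exists2 z : R, 0 < z & partition_function V beta N = z%:E.
  by rewrite -(prednK N0); exact: (partition_function_fin beta0 cVt Vt0 growth VE hmin).
have Ka : 2 <= b / 2 * (K ^+ p) `^ (alpha / p%:R).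
  rewrite powR_exp_div//; apply: (@le_trans _ _ (b / 2 * K)); last first.
    by rewrite ler_pM2l ?divr_gt0// le1r_powR.
  by move: K4; rewrite ler_pdivrMr//; lra.
have H := HK1 K KK1 (K ^+ p) (exprn_ge0 _ K0') N (~` box K (fun _ => true))
  (measurableC (measurable_box _ _)).
apply: (@le_trans _ _ (expR (N%:R * (1 - b / 2 * (K ^+ p) `^ (alpha / p%:R))))%:E); last first.
  rewrite lee_fin ler_expR.
  have : N%:R * 2 <= N%:R * (b / 2 * (K ^+ p) `^ (alpha / p%:R)) by rewrite ler_wpM2l.
  by lra.
apply: (ensemble_le z0 Zz); apply: H => l /existsNP[j /not_implyP[_ /negP]].
rewrite -ltNge => Kj; rewrite (bigD1 j)//= [in `|tnth l j| <= K]leNgt Kj/=.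
apply: ler_wpDr; first by apply: sumr_ge0 => i _; case: ifP => // _; rewrite exprn_ge0.
by rewrite lerXn2r ?nnegrE// ltW.
Qed.

(** Typical configurations of the other particles; coordinate i is left free so that it can be
    moved. *)
Definition good_set (K d : R) N (i : 'I_N) : set (N.-tuple mR) :=
  box K (fun j => j != i) `&`
  [set l | `|N%:R^-1 * (\sum_(j < N | j != i) tnth l j ^+ p) - m| <= d].

Lemma measurable_good_set K d N (i : 'I_N) : measurable (good_set K d i).
Proof.
apply: measurableI; first exact: measurable_box.
rewrite -[X in measurable X]setTI.
have mg : measurable_fun [set: N.-tuple mR]
    (fun l : N.-tuple mR => `|N%:R^-1 * (\sum_(j < N | j != i) tnth l j ^+ p) - m|).
  apply: (measurableT_comp (@normr_measurable R setT)); apply: measurable_funB => //.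
  apply: measurable_funM => //; under eq_fun do rewrite big_mkcond.
  apply: measurable_sum => j; case: (j != i) => //.
  by apply: measurable_funX; exact: measurable_tnth.
have -> : [set l : N.-tuple mR | `|N%:R^-1 * (\sum_(j < N | j != i) tnth l j ^+ p) - m| <= d] =
   (fun l : N.-tuple mR => `|N%:R^-1 * (\sum_(j < N | j != i) tnth l j ^+ p) - m|) @^-1` `]-oo, d].
  by apply/seteqP; split => l /=; rewrite in_itv.
exact: mg.
Qed.

(** The complement is covered by a deviation of the truncated moment and by the exit of some
    particle from the box, each of probability at most 1/4. Omitting particle i changes the mean by
    at most K^p / N <= d / 2. *)
Lemma good_set_probability : exists K0 : R, forall K, K0 <= K -> forall d : R, 0 < d ->
  \forall N \near \oo, forall i : 'I_N, ((2^-1)%:E <= Pr (good_set K d i))%E.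
Proof.
have [K1 HK1] := box_probability.
have [K2 HK2] := exists_large_radius beta0 cVt Vt0 growth hmin.
exists (Num.max K1 K2) => K; rewrite ge_max => /andP[K1K K2K] d d0.
have LR := HK2 K K2K; have [K1' _ _] := LR.
have K0 : 0 <= K by exact: le_trans K1'.
have d2 : 0 < d / 2 by rewrite divr_gt0.
have q1 : alpha / p%:R < 1 by rewrite ltr_pdivrMr ?ltr0n// mul1r.
have q0 : 0 < alpha / p%:R by rewrite divr_gt0 ?ltr0n.
have T := truncated_moment_superexp beta0 cVt Vt0 growth VE hmin alpha1 hp 2 LR d2.
near=> N.
have N0 : (0 < N)%N by near: N; exact: nbhs_infty_gt.
have N2 : 2 <= N%:R :> R by near: N; exact: nbhs_infty_ger.
have NK : 2 * K ^+ p / d <= N%:R by near: N; exact: nbhs_infty_ger.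
have TN : (Pr [set l : N.-tuple mR | (d / 2 <= `|truncated_moment K p l - m|)%R] <=
   (expR (- (2 * moment_speed (alpha / p%:R) N)))%:E)%E by near: N; exact: T.
have v1 : 0 * N%:R + 1 <= 1 * moment_speed (alpha / p%:R) N.
  by near: N; exact: linear_le_speed.
move=> i.
have [z z0 Zz] : exists2 z : R, 0 < z & partition_function V beta N = z%:E.
  by rewrite -(prednK N0); exact: (partition_function_fin beta0 cVt Vt0 growth VE hmin).
have mw := measurable_beta_weight cVt VE (N := N).
pose A := [set l : N.-tuple mR | d / 2 <= `|truncated_moment K p l - m|].
pose B := ~` box K (fun _ : 'I_N => true).
have mA : measurable A by apply: measurable_ge_dist; exact: measurable_truncated_moment.
have mB : measurable B by apply: measurableC; exact: measurable_box.
have mG := measurable_good_set K d i.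
have e4 : expR (- 2) <= 4^-1 :> R.
  rewrite expRN lef_pV2 ?posrE ?expR_gt0// (_ : 2 = 1 + 1 :> R)//.
  rewrite expRD; have := expR_ge1Dx (1 : R) => e1.
  by have := ler_pM _ _ e1 e1; rewrite (_ : (1 + 1) * (1 + 1) = 4 :> R); [apply|ring].
have PA : (Pr A <= (4^-1)%:E)%E.
  apply: (le_trans TN); rewrite lee_fin; apply: le_trans e4; rewrite ler_expR.
  by move: v1; rewrite mul0r add0r mul1r; lra.
have PB : (Pr B <= (4^-1)%:E)%E.
  apply: (le_trans (HK1 K K1K N N0)); rewrite lee_fin; apply: le_trans e4.
  by rewrite ler_expR lerN2.
have cover : [set: N.-tuple mR] `<=` good_set K d i `|` (A `|` B).
  move=> l _; have [Bl|] := pselect (B l); first by right; right.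
  rewrite /B /setC/= => /contrapT Bl.
  have [dA|Al] := leP (d / 2) `|truncated_moment K p l - m|; first by right; left.
  left; split; first by move=> j _; exact: Bl.
  rewrite /=.
  have -> : \sum_(j < N | j != i) tnth l j ^+ p =
     (\sum_(j < N) if `|tnth l j| <= K then tnth l j ^+ p else 0) - tnth l i ^+ p.
    rewrite [in RHS](bigD1 i)//= Bl// addrAC subrr add0r.
    by apply: eq_bigr => j _; rewrite Bl.
  rewrite mulrBr addrAC; apply: le_trans (ler_normB _ _) _.
  have lK : `|N%:R^-1 * tnth l i ^+ p| <= d / 2.
    rewrite normrM ger0_norm ?invr_ge0// ler_pdivrMl ?ltr0n//.
    apply: (@le_trans _ _ (K ^+ p)).
      by rewrite normrX lerXn2r ?nnegrE//; exact: Bl.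
    by move: NK; rewrite ler_pdivrMr//; lra.
  by move: Al lK; rewrite /truncated_moment; lra.
have P1 : (1 <= Pr (good_set K d i) + ((4^-1)%:E + (4^-1)%:E))%E.
  rewrite -(ensembleT z0 Zz); apply: (le_trans (le_ensemble mw z0 Zz measurableT _ cover)).
    by apply: measurableU => //; exact: measurableU.
  apply: (le_trans (ensembleU_le mw z0 Zz mG (measurableU _ _ mA mB))).
  apply: leeD2l; apply: (le_trans (ensembleU_le mw z0 Zz mA mB)).
  exact: leeD.
rewrite -EFinD in P1.
rewrite -(leeD2rE (x := (4^-1 + 4^-1)%:E))//; apply: le_trans P1.
by rewrite -EFinD lee_fin; lra.
Unshelve. all: by end_near. Qed.

End GoodConfigurations.

Section LowerBound.
Context {R : realType}.
Notation mR := (measurableTypeR R).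
Notation leb := (@lebesgue_measure R).
Notation pow := (power_measure leb).

(** Since (1 + 1/t)^p <= exp(p / t). The moved particle ranges over an interval of length 1, whose
    effect on its p-th power is thus relatively small. *)
Lemma succ_exp_le (e : R) (p : nat) : 0 < e -> exists2 X : R, 0 < X &
  forall t, X <= t -> (t + 1) ^+ p <= (1 + e) * t ^+ p.
Proof.
move=> e0; have l0 : 0 < ln (1 + e) by rewrite ln_gt0// ltrDl.
exists (p%:R / ln (1 + e) + 1).
  by rewrite ltr_wpDl// divr_ge0// ltW.
move=> t Xt; have t0 : 0 < t.
  by apply: lt_le_trans Xt; rewrite ltr_wpDl// divr_ge0// ltW.
have -> : t + 1 = (1 + t^-1) * t by rewrite mulrDl mul1r mulVf// gt_eqF.
rewrite exprMn ler_wpM2r ?exprn_ge0// ?(ltW t0)//.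
have t1 : 0 <= 1 + t^-1 by rewrite addr_ge0// invr_ge0 ltW.
apply: (@le_trans _ _ (expR t^-1 ^+ p)).
  by rewrite lerXn2r ?nnegrE ?expR_ge0//; exact: expR_ge1Dx.
rewrite -expRM_natl -[leRHS]lnK ?posrE ?addr_gt0// ler_expR ler_pdivrMr//.
rewrite mulrC -ler_pdivrMr//; apply: le_trans Xt.
by rewrite lerDl.
Qed.

Variables (beta : R) (Vt V : R -> R) (c1 : R).
Hypotheses (beta0 : (0 < beta)%R) (cVt : continuous Vt).
Hypothesis (Vt0 : forall x, (0 <= Vt x)%R).
Hypothesis growth : forall C : R, exists K : R, (0 < K)%R /\
  forall x, (K <= `|x|)%R -> (C * (1 + `|x|) <= Vt x)%R.
Hypothesis VE : forall x, (V x = Vt x + beta * clog x - c1)%R.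
Variable sigma : probability mR R.
Hypothesis hmin : forall mu : probability mR R, (eng beta Vt sigma <= eng beta Vt mu)%E.
Variables (alpha b : R) (p : nat).
Hypotheses (alpha1 : 1 <= alpha) (hp : alpha < p%:R) (b0 : 0 < b).
Hypothesis V_ge : forall b' C : R, b' < b -> exists K : R,
  forall x, K < `|x| -> C + `|x| + b' * `|x| `^ alpha <= Vt x - c1.
Hypothesis V_le : forall eta : R, 0 < eta -> exists K : R,
  forall x, K < `|x| -> V x <= (b + eta) * `|x| `^ alpha.

Let q := alpha / p%:R.
Let m := moment sigma p.
Let alpha0 : 0 < alpha. Proof. exact: lt_le_trans alpha1. Qed.
Let p0 : (0 < p)%N. Proof. by rewrite -(ltr0n R); exact: lt_trans alpha0 hp. Qed.
Let q0 : 0 < q. Proof. by rewrite divr_gt0 ?ltr0n. Qed.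
Let q1 : q < 1. Proof. by rewrite ltr_pdivrMr ?ltr0n// mul1r. Qed.
Local Notation Pr := (beta_ensemble V beta).

(* One particle is sent to the distance [(N s)^(1/p)], the others stay where
   they typically are. *)
Lemma moment_lower_bound (s delta zeta c : R) : 0 < s -> 0 < delta -> 0 < zeta ->
  c = 1 \/ c = -1 /\ odd p -> \forall N \near \oo,
  ((expR (- ((b * s `^ q + zeta) * moment_speed q N)))%:E <=
   Pr [set l : N.-tuple mR | (`|empirical_moment p l - (m + c * s)| < delta)%R])%E.
Proof.
move=> s0 delta0 zeta0 hc.
(* The sign c = -1 occurs only for odd p, which treats both directions at once. *)
have cX x : x ^+ p = c * (c * x) ^+ p.
  case: hc => [->|[-> op]]; first by rewrite !mul1r.
  by rewrite !mulN1r exprNn -signr_odd op expr1 mulN1r opprK.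
have c1' : `|c| = 1 by case: hc => [->|[-> _]]; rewrite ?normrN normr1.
pose S := s `^ q.
have S0 : 0 < S by exact: powR_gt0.
pose eta := zeta / (8 * S).
have eta0 : 0 < eta by rewrite divr_gt0// mulr_gt0.
have be0 : 0 < b + eta by exact: addr_gt0.
pose e := Num.min (eta / (b + eta)) (delta / (6 * s)).
have s60 : 0 < 6 * s by rewrite mulr_gt0.
have e0 : 0 < e by rewrite lt_min (divr_gt0 eta0 be0) (divr_gt0 delta0 s60).
have [ee1 ee2] : e <= eta / (b + eta) /\ e <= delta / (6 * s).
  by rewrite !ge_min !lexx orbT.
rewrite ler_pdivlMr// in ee1; rewrite ler_pdivlMr// in ee2.
have [X X0 HX] := succ_exp_le p e0.
have [KU HKU] := V_le eta0.
have [K0 HK0] := good_set_probability beta0 cVt Vt0 growth VE hmin alpha1 hp b0 V_ge.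
pose K := Num.max K0 0.
have [KK0 K00] : K0 <= K /\ 0 <= K by rewrite !le_max !lexx orbT.
have [C HC] := move_particle beta0 cVt Vt0 growth VE K00.
have d3 : 0 < delta / 3 by rewrite divr_gt0.
have G := HK0 K KK0 _ d3.
pose Y := Num.max (Num.max X 1) (Num.max (K + 1) (KU + 1)).
have z4 : 0 < zeta / 2 by rewrite divr_gt0.
near=> N.
have N0 : (0 < N)%N by near: N; exact: nbhs_infty_gt.
have NY : Y ^+ p / s <= N%:R by near: N; exact: nbhs_infty_ger.
have v1 : C * N%:R + ln 2 <= zeta / 2 * moment_speed q N.
  by near: N; exact: linear_le_speed.
have GN : forall i : 'I_N, ((2^-1)%:E <= Pr (good_set sigma p K (delta / 3) i))%E.
  by near: N; exact: G.
have N0' : 0 < N%:R :> R by rewrite ltr0n.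
have [z z0 Zz] : exists2 z : R, 0 < z & partition_function V beta N = z%:E.
  by rewrite -(prednK N0); exact: (partition_function_fin beta0 cVt Vt0 growth VE hmin).
have mw := measurable_beta_weight cVt VE (N := N).
pose t := (N%:R * s) `^ (p%:R^-1).
have Ns0 : 0 < N%:R * s by exact: mulr_gt0.
have t0 : 0 < t by exact: powR_gt0.
have tp : t ^+ p = N%:R * s.
  by rewrite -powR_mulrn ?ltW// -powRrM mulVf ?powRr1 ?ltW// pnatr_eq0 -lt0n.
have Y0 : 0 <= Y by rewrite !le_max ler01 !orbT.
have Yt : Y <= t.
  by rewrite -(ler_pXn2r p0) ?nnegrE ?(ltW t0)// tp -ler_pdivrMr.
have [tX t1 tK tKU] : [/\ X <= t, 1 <= t, K + 1 <= t & KU + 1 <= t].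
  by split; apply: le_trans Yt; rewrite /Y !le_max !lexx ?orbT.
have tpe := HX t tX.
(* As alpha <= p, ((t + 1) / t)^alpha <= ((t + 1) / t)^p <= 1 + e. *)
have ta : (t + 1) `^ alpha <= (1 + e) * (N%:R `^ q * S).
  have t10 : 0 < t + 1 by rewrite addr_gt0.
  have -> : N%:R `^ q * S = t `^ alpha.
    by rewrite /S -powRM ?ler0n ?(ltW s0)// -tp powR_exp_div// ltW.
  have r1 : 1 <= (t + 1) / t by rewrite ler_pdivlMr// mul1r lerDl.
  have -> : t + 1 = (t + 1) / t * t by rewrite divfK// gt_eqF.
  rewrite powRM ?(ltW t0)//; last by exact: le_trans r1.
  apply: ler_wpM2r; first exact: powR_ge0.
  apply: (@le_trans _ _ (((t + 1) / t) `^ p%:R)); first by rewrite ler_powR// ltW.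
  rewrite powR_mulrn; last exact: le_trans r1.
  by rewrite expr_div_n ler_pdivrMr// exprn_gt0.
pose v := (b + eta) * (t + 1) `^ alpha.
have vle : N%:R * v <= (b * S + zeta / 4) * moment_speed q N.
  rewrite moment_speedE// [leRHS]mulrCA ler_pM2l//.
  apply: (@le_trans _ _ ((b + eta) * ((1 + e) * (N%:R `^ q * S)))); first by rewrite ler_pM2l.
  rewrite mulrA (_ : (b * S + zeta / 4) * N%:R `^ q = (b + 2 * eta) * (N%:R `^ q * S)); last first.
    by rewrite /eta; field; rewrite gt_eqF.
  by apply: ler_wpM2r; [rewrite mulr_ge0 ?powR_ge0// ltW|lra].
pose I : set mR := [set x : mR | t <= c * x <= t + 1].
have mI1 : measurable I /\ leb I = 1%E.
  have [IE|IE] : I = `[t, t + 1]%classic \/ I = `[- (t + 1), - t]%classic.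
  - rewrite /I; case: hc => [->|[-> _]]; [left|right]; apply/seteqP; split => x /=.
    + by rewrite in_itv/= mul1r.
    + by rewrite in_itv/= mul1r.
    + by rewrite in_itv/= mulN1r lerNr lerNl andbC.
    + by rewrite in_itv/= mulN1r lerNr [- x <= _]lerNl andbC.
  - rewrite IE; split => //; etransitivity; first exact: lebesgue_measure_itv.
    by rewrite /= lte_fin ltrDl ltr01 -EFinB; congr (_%:E); ring.
  - rewrite IE; split => //; etransitivity; first exact: lebesgue_measure_itv.
    by rewrite /= lte_fin ltrN2 ltrDl ltr01 -EFinB; congr (_%:E); ring.
have [mI I1] := mI1.
pose i := Ordinal N0.
have mG := measurable_good_set sigma p K (delta / 3) i.
have M := HC N i (good_set sigma p K (delta / 3) i) I v mG mI I1.
have {}M : ((expR (- (N%:R * (v + C))))%:E *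
    \int[pow N]_(l in good_set sigma p K (delta / 3) i) (beta_weight V beta l)%:E <=
   \int[pow N]_(l in good_set sigma p K (delta / 3) i `&` [set l | I (tnth l i)])
     (beta_weight V beta l)%:E)%E.
  apply: M.
  - move=> l x.
    have sE : \sum_(j < N | j != i) tnth (upd l i x) j ^+ p = \sum_(j < N | j != i) tnth l j ^+ p.
      by apply: eq_bigr => j ji; rewrite tnth_upd (negbTE ji).
    rewrite /good_set /setI/= sE; split => -[h1 h2]; split => // j ji.
      by have := h1 j ji; rewrite tnth_upd (negbTE ji).
    by rewrite tnth_upd (negbTE ji); exact: h1.
  - by move=> l j [h1 _]; exact: h1.
  move=> x /andP[tx xt].
  have cx : `|x| = c * x.
    have cx0 : 0 <= c * x by apply: le_trans tx; exact: ltW.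
    by rewrite -[LHS]mul1r -c1' -normrM ger0_norm.
  split; first by rewrite cx (le_trans tK).
  apply: (le_trans (HKU x _)); first by rewrite cx (lt_le_trans _ tx)//; lra.
  rewrite /v ler_pM2l//; apply: ge0_ler_powR; rewrite ?nnegrE ?cx//; first exact: ltW.
  - by apply: le_trans tx; exact: ltW.
  - by rewrite addr_ge0// ltW.
pose GI := good_set sigma p K (delta / 3) i `&` [set l : N.-tuple mR | I (tnth l i)].
have mGI : measurable GI.
  apply: measurableI => //; rewrite -[X in measurable X]setTI.
  exact: (@measurable_tnth _ mR N i).
have mE : measurable [set l : N.-tuple mR | `|empirical_moment p l - (m + c * s)| < delta].
  rewrite (_ : [set l : N.-tuple mR | _] =
    ~` [set l : N.-tuple mR | delta <= `|empirical_moment p l - (m + c * s)|]).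
    apply: measurableC; apply: measurable_ge_dist; exact: measurable_empirical_moment.
  by apply/seteqP; split => l /=; rewrite ltNge => /negP.
apply: (@le_trans _ _ (Pr GI)); last first.
  apply: (le_ensemble mw z0 Zz) => // l [[_ /= hS] /= /andP[tl lt]].
  (* The other particles account for an error of at most delta / 3, the moved one for at most delta
     / 6. *)
  have -> : empirical_moment p l - (m + c * s) =
      (N%:R^-1 * (\sum_(j < N | j != i) tnth l j ^+ p) - m) +
      c * (N%:R^-1 * (c * tnth l i) ^+ p - s).
    rewrite /empirical_moment (bigD1 i)//= [in LHS]cX; ring.
  apply: (le_lt_trans (ler_normD _ _)); rewrite normrM c1' mul1r.
  have cl0 : 0 <= c * tnth l i by apply: le_trans tl; exact: ltW.
  have h1 : N%:R * s <= (c * tnth l i) ^+ p by rewrite -tp lerXn2r ?nnegrE// ltW.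
  have h2 : (c * tnth l i) ^+ p <= (1 + e) * (N%:R * s).
    by rewrite -tp; apply: le_trans tpe; rewrite lerXn2r ?nnegrE// addr_ge0// ltW.
  have h3 : `|N%:R^-1 * (c * tnth l i) ^+ p - s| <= delta / 6.
    have h4 : s <= N%:R^-1 * (c * tnth l i) ^+ p by rewrite ler_pdivlMl.
    have h5 : N%:R^-1 * (c * tnth l i) ^+ p <= (1 + e) * s.
      by rewrite ler_pdivrMl// mulrCA.
    by rewrite ger0_norm ?subr_ge0//; lra.
  by lra.
apply: (@le_trans _ _ ((expR (- (N%:R * (v + C))))%:E * (2^-1)%:E)%E).
  rewrite -EFinM lee_fin -[X in _ <= _ * X^-1]lnK ?posrE// -expRN -expRD ler_expR.
  by move: vle v1; rewrite -/S; have := moment_speed_ge0 q N; have := zeta0; nra.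
apply: (@le_trans _ _ ((expR (- (N%:R * (v + C))))%:E * Pr (good_set sigma p K (delta / 3) i))%E).
  by apply: lee_wpmul2l; [rewrite lee_fin expR_ge0|exact: GN].
rewrite !(ensembleE z0 Zz) muleCA; apply: lee_wpmul2l => //.
by rewrite lee_fin invr_ge0 ltW.
Unshelve. all: by end_near. Qed.

End LowerBound.

(** * From eventual bounds to lower and upper limits *)

Section LimSup.
Context {R : realType}.
Local Open Scope ereal_scope.
Implicit Types (u : nat -> \bar R).

Lemma limn_esup_le_near u (a : \bar R) : (\forall n \near \oo, u n <= a) -> limn_esup u <= a.
Proof.
move=> ua; apply: (@le_trans _ _ (ereal_sup (u @` [set n | u n <= a]))).
  by apply: ereal_inf_lbound; exists [set n | u n <= a].
by apply: ge_ereal_sup => _ [n /= un <-].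
Qed.

Lemma limn_einf_ge_near u (a : \bar R) : (\forall n \near \oo, a <= u n) -> a <= limn_einf u.
Proof.
move=> ua; rewrite /limn_einf leeNr; apply: limn_esup_le_near.
by apply: filterS ua => n; rewrite leeN2.
Qed.

Lemma le_scaled_lne (v r : R) (P : \bar R) : (0 < v)%R -> 0 <= P ->
  P <= (expR (- (r * v)))%:E -> (v^-1)%:E * lne P <= (- r)%:E.
Proof.
move=> v0 P0 Pr; have : lne P <= (- (r * v))%:E.
  have PI : P \in `[0, +oo] by rewrite in_itv/= P0 leey.
  by rewrite -[leRHS]expeRK (lee_lne PI)// in_itv/= lee_fin expR_ge0 leey.
move=> /(lee_wpmul2l (x := (v^-1)%:E)) => H; apply: le_trans (H _) _.
  by rewrite lee_fin invr_ge0 ltW.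
by rewrite -EFinM lee_fin mulrN mulrCA mulVf ?mulr1// gt_eqF.
Qed.

Lemma ge_scaled_lne (v r : R) (P : \bar R) : (0 < v)%R ->
  (expR (- (r * v)))%:E <= P -> (- r)%:E <= (v^-1)%:E * lne P.
Proof.
move=> v0 Pr; have : (- (r * v))%:E <= lne P.
  have PI : P \in `[0, +oo].
    by rewrite in_itv/= leey andbT (le_trans _ Pr)// lee_fin expR_ge0.
  by rewrite -[leLHS]expeRK lee_lne// in_itv/= lee_fin expR_ge0 leey.
move=> /(lee_wpmul2l (x := (v^-1)%:E)) => H; apply: le_trans _ (H _).
  by rewrite -EFinM lee_fin mulrN mulrCA mulVf ?mulr1// gt_eqF.
by rewrite lee_fin invr_ge0 ltW.
Qed.

End LimSup.

(** * The rate function *)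

Section RateFunction.
Context {R : realType}.
Variables (alpha b m : R) (p : nat).
Hypotheses (alpha1 : 1 <= alpha) (hp : alpha < p%:R) (b0 : 0 < b).
Let q := alpha / p%:R.
Let alpha0 : 0 < alpha. Proof. exact: lt_le_trans alpha1. Qed.
Let p0 : (0 < p)%N. Proof. by rewrite -(ltr0n R); exact: lt_trans alpha0 hp. Qed.
Let q0 : 0 < q. Proof. by rewrite divr_gt0 ?ltr0n. Qed.
Local Notation J := (moment_rate b alpha p m).

(** The inverse of u |-> b u^q. *)
Definition rate_radius (t : R) : R := (t / b) `^ q^-1.

Lemma rate_radius_ge0 t : 0 <= rate_radius t. Proof. exact: powR_ge0. Qed.

Lemma rate_radiusE t : 0 <= t -> b * rate_radius t `^ q = t.
Proof.
move=> t0; rewrite /rate_radius -powRrM mulVf ?gt_eqF// powRr1 ?divr_ge0 ?(ltW b0)//.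
by rewrite mulrC divfK// gt_eqF.
Qed.

Lemma le_rate_radius t u : 0 <= t -> 0 <= u -> (b * u `^ q <= t) = (u <= rate_radius t).
Proof.
move=> t0 u0; rewrite -{1}(rate_radiusE t0) ler_pM2l//.
have [ur|ru] := leP u (rate_radius t).
  by apply: ge0_ler_powR; rewrite ?nnegrE ?rate_radius_ge0// ltW.
apply/negbTE; rewrite -ltNge; apply: gt0_ltr_powR => //.
by rewrite nnegrE rate_radius_ge0.
Qed.

Lemma moment_rate_ge0 x : (0 <= J x)%E.
Proof.
rewrite /moment_rate; case: (odd p); first by rewrite lee_fin mulr_ge0 ?powR_ge0// ltW.
by case: ifP => _; rewrite ?leey// lee_fin mulr_ge0 ?powR_ge0// ltW.
Qed.

(** The level sets are segments, which yields both goodness and lower semicontinuity. *)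
Lemma moment_rate_le t : 0 <= t ->
  [set x | (J x <= t%:E)%E] =
  `[m - (if odd p then rate_radius t else 0), m + rate_radius t]%classic.
Proof.
move=> t0; apply/seteqP; split => x /=; rewrite in_itv/= /moment_rate; case: (odd p).
- by rewrite lee_fin le_rate_radius// ler_norml => /andP[? ?]; apply/andP; split; lra.
- case: ifPn => [mx|]; last by rewrite leye_eq.
  by rewrite lee_fin le_rate_radius ?subr_ge0// subr0 mx/= => ?; lra.
- rewrite lee_fin le_rate_radius// ler_norml => /andP[? ?]; apply/andP; split; lra.
- rewrite subr0 => /andP[mx xm]; rewrite mx lee_fin le_rate_radius ?subr_ge0//.
  by lra.
Qed.

Lemma moment_rate_good : good J.
Proof. by move=> t t0; rewrite moment_rate_le//; exact: segment_compact. Qed.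

Lemma moment_rate_lsc : lower_semicontinuous J.
Proof.
apply/lower_semicontinuousP => a; have [a0|a0] := ltP a 0.
  rewrite (_ : [set x | _] = setT); first exact: openT.
  apply/seteqP; split => // x _ /=.
  by apply: lt_le_trans (moment_rate_ge0 x); rewrite lte_fin.
rewrite (_ : [set x | _] = ~` [set x | (J x <= a%:E)%E]).
  by rewrite openC moment_rate_le//; exact: itv_closed.
by apply/seteqP; split => x /=; rewrite ltNge => /negP.
Qed.

Lemma moment_speed_speed : speed (moment_speed q).
Proof.
have q1 : 0 < 1 + q by rewrite addr_gt0.
split.
  move=> n k nk; apply: ge0_ler_powR; rewrite ?nnegrE ?ler0n ?ler_nat//.
  exact: ltW.
by apply/cvgryPge => A; exact: powR_nat_ge.
Qed.

End RateFunction.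

(** * Assembly of the large deviations principle *)

Section LDP.
Context {R : realType}.
Notation mR := (measurableTypeR R).
Notation leb := (@lebesgue_measure R).
Notation pow := (power_measure leb).
Variables (beta : R) (Vt V : R -> R) (c1 : R).
Hypotheses (beta0 : (0 < beta)%R) (cVt : continuous Vt).
Hypothesis (Vt0 : forall x, (0 <= Vt x)%R).
Hypothesis growth : forall C : R, exists K : R, (0 < K)%R /\
  forall x, (K <= `|x|)%R -> (C * (1 + `|x|) <= Vt x)%R.
Hypothesis VE : forall x, (V x = Vt x + beta * clog x - c1)%R.
Variable sigma : probability mR R.
Hypothesis hmin : forall mu : probability mR R, (eng beta Vt sigma <= eng beta Vt mu)%E.
Variables (alpha b : R) (p : nat).
Hypotheses (alpha1 : 1 <= alpha) (hp : alpha < p%:R) (b0 : 0 < b).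
Hypothesis V_ge : forall b' C : R, b' < b -> exists K : R,
  forall x, K < `|x| -> C + `|x| + b' * `|x| `^ alpha <= Vt x - c1.
Hypothesis V_le : forall eta : R, 0 < eta -> exists K : R,
  forall x, K < `|x| -> V x <= (b + eta) * `|x| `^ alpha.

Let q := alpha / p%:R.
Let m := moment sigma p.
Let alpha0 : 0 < alpha. Proof. exact: lt_le_trans alpha1. Qed.
Let p0 : (0 < p)%N. Proof. by rewrite -(ltr0n R); exact: lt_trans alpha0 hp. Qed.
Let q0 : 0 < q. Proof. by rewrite divr_gt0 ?ltr0n. Qed.
Let q1 : q < 1. Proof. by rewrite ltr_pdivrMr ?ltr0n// mul1r. Qed.
Local Notation Pr := (beta_ensemble V beta).
Local Notation J := (moment_rate b alpha p m).
Local Notation v := (moment_speed q).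
Local Notation Zp := (@empirical_moment R p).

Let dev := moment_deviation beta0 cVt Vt0 growth VE hmin alpha1 hp b0 V_ge.
Let dev_even := moment_deviation_even beta0 cVt Vt0 growth VE hmin alpha1 hp.
Let lower := moment_lower_bound beta0 cVt Vt0 growth VE hmin alpha1 hp b0 V_ge V_le.

Let Zfin N : (0 < N)%N -> exists2 z : R, 0 < z & partition_function V beta N = z%:E.
Proof.
by move=> N0; rewrite -(prednK N0); exact: (partition_function_fin beta0 cVt Vt0 growth VE hmin).
Qed.

Let mw N := measurable_beta_weight cVt VE (N := N).

Lemma moment_rate_center : J m = 0%E.
Proof.
rewrite /moment_rate subrr normr0 lexx powR0 ?mulr0 ?gt_eqF//.
by case: (odd p).
Qed.

Lemma measurable_preimage_moment (B : set R) N : <<s open >> B -> measurable (@empirical_moment R p N @^-1` B).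
Proof.
move=> sB; have mB : measurable (B : set mR).
  apply: (smallest_sub _ _ sB); first exact: sigma_algebra_measurable.
  by move=> U; exact: open_measurable.
by rewrite -[X in measurable X]setTI; exact: measurable_empirical_moment.
Qed.

(** With b s^q = t, the points of B have distance at least s from m, except, for even p, those on
    the left of m. The latter stay at a positive distance from m, since the rate vanishes at m and
    so the closure of B avoids it, and [moment_deviation_even] makes them negligible. *)
Lemma Pr_upper (B : set R) (r t : R) : <<s open >> B -> 0 <= r < t ->
  (forall x, closure B x -> (t%:E <= J x)%E) ->
  \forall N \near \oo, (Pr (@empirical_moment R p N @^-1` B) <= (expR (- (r * v N)))%:E)%E.
Proof.
move=> sB /andP[r0 rt] Bt.
have t0 : 0 < t by exact: le_lt_trans rt.
pose s := rate_radius alpha b p t.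
have sE : b * s `^ q = t by rewrite rate_radiusE// ltW.
have s0 : 0 < s.
  rewrite lt_neqAle rate_radius_ge0 andbT eq_sym; apply: contraTneq t0 => s0.
  by rewrite -sE s0 powR0 ?mulr0 ?ltxx// gt_eqF.
have Jm : (J m < t%:E)%E by rewrite moment_rate_center lte_fin.
have nBm : ~ closure B m by move=> /Bt; rewrite leNgt Jm.
have [d d0 Hd] : exists2 d : R, 0 < d & forall x, B x -> d <= `|x - m|.
  have : open (~` closure B) by rewrite openC; exact: closed_closure.
  move=> /(_ m nBm)/nbhs_ballP[d /= d0 Hd]; exists d => // x Bx.
  rewrite leNgt; apply/negP => xd; have := Hd x; rewrite /ball/= distrC => /(_ xd).
  by apply; exact: subset_closure.
(* The gain r' - r absorbs the factor 2 of the union bound. *)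
pose r' := (r + t) / 2.
have r't : 0 <= r' < b * s `^ q by rewrite sE /r'; apply/andP; split; lra.
have D1 := dev s0 r't.
have D2 : \forall N \near \oo, (~~ odd p ->
    (Pr [set l : N.-tuple mR | (Zp l <= m - d)%R] <= (expR (- (r' * v N)))%:E)%E).
  have [op|ep] := boolP (odd p); first by apply: nearW.
  by have := dev_even r' ep d0; apply: filterS.
near=> N.
have N0 : (0 < N)%N by near: N; exact: nbhs_infty_gt.
have D1N : (Pr [set l : N.-tuple mR | (s <= `|Zp l - m|)%R] <= (expR (- (r' * v N)))%:E)%E.
  by near: N; exact: D1.
have D2N : ~~ odd p ->
    (Pr [set l : N.-tuple mR | (Zp l <= m - d)%R] <= (expR (- (r' * v N)))%:E)%E.
  by near: N; exact: D2.
have v1 : 0 * N%:R + ln 2 <= (r' - r) * v N.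
  by near: N; apply: linear_le_speed => //; rewrite /r'; lra.
have [z z0 Zz] := Zfin N0.
have mA : measurable [set l : N.-tuple mR | s <= `|Zp l - m|].
  by apply: measurable_ge_dist; exact: measurable_empirical_moment.
have mB := @measurable_preimage_moment B N sB.
have rr' : r <= r' by rewrite /r'; lra.
have JB l : B (Zp l) -> (t%:E <= J (Zp l))%E by move=> Bl; apply: Bt; exact: subset_closure.
have Jge x : (t%:E <= J x)%E -> (odd p \/ m <= x) -> s <= `|x - m|.
  move=> Jx xm; rewrite leNgt; apply/negP => xs.
  have : b * `|x - m| `^ q < t.
    rewrite -sE ltr_pM2l//; apply: gt0_ltr_powR => //.
    by rewrite nnegrE ltW.
  move: Jx; rewrite /moment_rate; case: xm => [->|mx].
    by rewrite lee_fin leNgt => /negP.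
  rewrite mx; case: (odd p) => //; first by rewrite lee_fin leNgt => /negP.
  by rewrite ger0_norm ?subr_ge0// lee_fin leNgt => /negP.
have [op|ep] := boolP (odd p).
  apply: (@le_trans _ _ (Pr [set l : N.-tuple mR | s <= `|Zp l - m|])).
    apply: (le_ensemble (@mw N) z0 Zz) => // l /= /JB Jl.
    by apply: Jge => //; left.
  apply: (le_trans D1N); rewrite lee_fin ler_expR lerN2.
  by rewrite ler_wpM2r// moment_speed_ge0.
have mE : measurable [set l : N.-tuple mR | Zp l <= m - d].
  rewrite -[X in measurable X]setTI.
  have -> : [set l : N.-tuple mR | Zp l <= m - d] = @empirical_moment R p N @^-1` `]-oo, m - d].
    by apply/seteqP; split => l /=; rewrite in_itv.
  exact: measurable_empirical_moment.
apply: (@le_trans _ _ (Pr ([set l : N.-tuple mR | s <= `|Zp l - m|] `|`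
    [set l : N.-tuple mR | Zp l <= m - d]))).
  apply: (le_ensemble (@mw N) z0 Zz) => //; first exact: measurableU.
  move=> l /= Bl; have [mx|xm] := leP m (Zp l).
    by left; apply: Jge; [exact: JB|right].
  by right; have := Hd _ Bl; rewrite ltr0_norm ?subr_lt0//; lra.
apply: (le_trans (ensembleU_le (@mw N) z0 Zz mA mE)).
apply: (le_trans (leeD D1N (D2N ep))); rewrite -EFinD lee_fin.
have -> : expR (- (r' * v N)) + expR (- (r' * v N)) = expR (ln 2 - r' * v N).
  by rewrite expRD lnK ?posrE//; ring.
by rewrite ler_expR; lra.
Unshelve. all: by end_near. Qed.

(** At x = m the rate is 0 and the ball has probability at least 1/2. Elsewhere this is
    [moment_lower_bound] with s = |x - m|; a point on the left of m has a finite rate only for odd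
    p, as the sign -1 requires. *)
Lemma Pr_lower (x delta zeta : R) : 0 < delta -> 0 < zeta -> (J x < +oo)%E ->
  \forall N \near \oo, ((expR (- ((fine (J x) + zeta) * v N)))%:E <=
    Pr [set l : N.-tuple mR | (`|Zp l - x| < delta)%R])%E.
Proof.
move=> d0 z0 Jx.
have [xm|xm] := eqVneq x m.
  have r0 : 0 < b * delta `^ q by rewrite mulr_gt0// powR_gt0.
  pose r := b * delta `^ q / 2.
  have hr : 0 <= r < b * delta `^ q by rewrite /r; apply/andP; split; lra.
  have r0' : 0 < r by rewrite /r; lra.
  have D1 := dev d0 hr.
  near=> N.
  have N0 : (0 < N)%N by near: N; exact: nbhs_infty_gt.
  have D1N : (Pr [set l : N.-tuple mR | (delta <= `|Zp l - m|)%R] <=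
      (expR (- (r * v N)))%:E)%E by near: N; exact: D1.
  have v1 : 0 * N%:R + ln 2 <= r * v N by near: N; exact: linear_le_speed.
  have v2 : 0 * N%:R + ln 2 <= zeta * v N by near: N; exact: linear_le_speed.
  have [z z0' Zz] := Zfin N0.
  rewrite xm moment_rate_center add0r.
  have mA : measurable [set l : N.-tuple mR | delta <= `|Zp l - m|].
    by apply: measurable_ge_dist; exact: measurable_empirical_moment.
  have BE : [set l : N.-tuple mR | `|Zp l - m| < delta] =
      ~` [set l : N.-tuple mR | delta <= `|Zp l - m|].
    by apply/seteqP; split => l /=; rewrite ltNge => /negP.
  rewrite BE; set A := [set l : N.-tuple mR | _] in mA D1N *.
  have H : (1 <= Pr (~` A) + (2^-1)%:E)%E.
    rewrite -(ensembleT z0' Zz) -(setvU A).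
    apply: (le_trans (ensembleU_le (@mw N) z0' Zz (measurableC mA) mA)); apply: leeD2l.
    apply: (le_trans D1N); rewrite lee_fin -[leRHS]lnK ?posrE// ler_expR lnV ?posrE// lerN2.
    by move: v1; rewrite mul0r add0r.
  rewrite -(leeD2rE (x := (2^-1)%:E))//; apply: le_trans H.
  rewrite -EFinD lee_fin.
  have : expR (- (zeta * v N)) <= 2^-1.
    rewrite -[leRHS]lnK ?posrE// ler_expR lnV ?posrE// lerN2.
    by move: v2; rewrite mul0r add0r.
  by lra.
pose s := `|x - m|.
have s0 : 0 < s by rewrite normr_gt0 subr_eq0.
pose c : R := if m <= x then 1 else -1.
have hc : c = 1 \/ c = -1 /\ odd p.
  rewrite /c; case: ifPn => mx; [by left|right; split => //].
  by move: Jx; rewrite /moment_rate (negbTE mx); case: (odd p) => //; rewrite ltxx.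
have xE : m + c * s = x.
  rewrite /c /s; case: (leP m x) => mx.
    by rewrite mul1r ger0_norm ?subr_ge0// addrC subrK.
  by rewrite ltr0_norm ?subr_lt0// mulN1r opprK addrC subrK.
have JE : fine (J x) = b * s `^ q.
  move: Jx; rewrite /moment_rate; case: (odd p) => //.
  case: (leP m x) => [mx _|]; last by rewrite ltxx.
  by rewrite /= /s ger0_norm// subr_ge0.
by have := lower s0 d0 z0 hc; rewrite xE JE.
Unshelve. all: by end_near. Qed.

(** Lower bound: every point of finite rate in the interior of B is the centre of a ball inside B,
    to which [Pr_lower] applies; zeta is then sent to 0. Upper bound: [Pr_upper] for every r below
    the infimum of the rate over the closure. *)
Theorem moment_LDP : satisfies_LDP Pr (@empirical_moment R p) (fun N => v N) J.
Proof.
split.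
- exact: moment_speed_speed.
- split; first exact: moment_rate_ge0.
  exact: moment_rate_lsc.
have mT n : measurable (@empirical_moment R p n @^-1` setT).
  by rewrite preimage_setT; exact: measurableT.
move=> B sB; split.
- rewrite leeNl; apply: le_ereal_inf_tmp => _ [x Bx <-]; rewrite leeNl.
  have [Jx|] := ltP (J x) +oo%E; last by rewrite leye_eq => /eqP ->; exact: leNye.
  have Jfin : J x \is a fin_num by rewrite ge0_fin_numE//; exact: moment_rate_ge0.
  apply/lee_subgt0Pr => zeta zeta0; apply: limn_einf_ge_near.
  have /nbhs_ballP[d /= d0 dB] : nbhs x B by exact: Bx.
  have L := Pr_lower d0 zeta0 Jx.
  near=> N.
  have N0 : (0 < N)%N by near: N; exact: nbhs_infty_gt.
  have v0 : 0 < v N by apply: powR_gt0; rewrite ltr0n.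
  have LN : ((expR (- ((fine (J x) + zeta) * v N)))%:E <=
      Pr [set l : N.-tuple mR | (`|Zp l - x| < d)%R])%E by near: N; exact: L.
  have [z z0 Zz] := Zfin N0.
  rewrite -[in leLHS](fineK Jfin) -EFinN -EFinB -opprD; apply: ge_scaled_lne => //.
  apply: (le_trans LN); apply: (le_ensemble (@mw N) z0 Zz).
  + rewrite (_ : [set l : N.-tuple mR | _] = ~` [set l : N.-tuple mR | d <= `|Zp l - x|]).
      by apply: measurableC; apply: measurable_ge_dist; exact: measurable_empirical_moment.
    by apply/seteqP; split => l /=; rewrite ltNge => /negP.
  + exact: measurable_preimage_moment.
  + by move=> l /= lx; apply: dB; rewrite /ball/= distrC.
- exact: limn_einf_sup.
set I := ereal_inf _.
have I0 : (0 <= I)%E by apply: le_ereal_inf_tmp => _ [x _ <-]; exact: moment_rate_ge0.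
have IJ x : closure B x -> (I <= J x)%E by move=> Bx; apply: ereal_inf_lbound; exists x.
set L := limn_esup _.
have HL r t : (r < t)%R -> (t%:E <= I)%E -> (L <= (- r)%:E)%E.
  move=> rt tI.
  have U : \forall N \near \oo,
      (Pr (@empirical_moment R p N @^-1` B) <= (expR (- (r * v N)))%:E)%E.
    (* For r < 0 a probability being at most 1 is enough. *)
    have [r0|r0] := leP 0 r.
      apply: (@Pr_upper B r t sB); first by rewrite r0.
      by move=> x /IJ; exact: le_trans.
    near=> N; have N0 : (0 < N)%N by near: N; exact: nbhs_infty_gt.
    have [z z0 Zz] := Zfin N0.
    apply: (@le_trans _ _ 1%E).
      rewrite -(ensembleT z0 Zz); apply: (le_ensemble (@mw N) z0 Zz) => //.
      exact: measurable_preimage_moment.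
    rewrite lee_fin -[leLHS]expR0 ler_expR oppr_ge0 mulr_le0_ge0 ?moment_speed_ge0//.
    exact: ltW.
  apply: limn_esup_le_near; near=> N.
  have N0 : (0 < N)%N by near: N; exact: nbhs_infty_gt.
  have UN : (Pr (@empirical_moment R p N @^-1` B) <= (expR (- (r * v N)))%:E)%E.
    by near: N; exact: U.
  have [z z0 Zz] := Zfin N0.
  apply: le_scaled_lne => //; first by apply: powR_gt0; rewrite ltr0n.
  exact: (ensemble_ge0 z0 Zz).
move: I0 HL; case: I IJ => [i| |] // _ _ HL /=.
  apply/lee_addgt0Pr => e e0; rewrite -EFinD -[X in (_ <= X%:E)%E]opprK opprD opprK.
  by apply: (HL _ i) => //; lra.
(* With an infinite infimum the upper limit lies below every real number, so it is -oo. *)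
case: L HL => [l| |] // HL.
  have := HL (1 - l) (2 - l) _ (leey _); rewrite lee_fin => H.
  have h : l <= - (1 - l) by apply: H; lra.
  by exfalso; lra.
by have := HL 0 1 ltr01 (leey _).
Unshelve. all: by end_near. Qed.

End LDP.

(** * Properties of the potential *)

Section Potential.
Context {R : realType}.

Lemma linear_le_powR (alpha A B c : R) : 2 <= alpha -> 0 < c -> exists K : R,
  forall x : R, K < `|x| -> A + B * `|x| <= c * `|x| `^ alpha.
Proof.
move=> a2 c0; exists (Num.max 1 ((`|A| + `|B|) / c)) => x; rewrite gt_max => /andP[x1 xK].
have x0 : 0 < `|x| by exact: lt_trans x1.
apply: (@le_trans _ _ (c * `|x| ^+ 2)); last first.
  by rewrite ler_pM2l// -powR_mulrn// ler_powR// ltW.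
rewrite ltr_pdivrMr// in xK.
apply: (@le_trans _ _ ((`|A| + `|B|) * `|x|)).
  rewrite mulrDl lerD//; last by rewrite ler_wpM2r// ler_norm.
  by rewrite (le_trans (ler_norm A))// ler_peMr// ltW.
by rewrite expr2 mulrA ler_wpM2r// mulrC ltW// mulrC [c * _]mulrC.
Qed.

Lemma continuous_clog : continuous (@clog R).
Proof.
move=> x; rewrite /clog; apply: (@continuous_comp _ _ _ (fun y : R => 1 + `|y|) (@ln R)).
  by apply: cvgD; [exact: cvg_cst|exact: norm_continuous].
by apply: continuous_ln; rewrite ltr_pwDl.
Qed.

Variables (alpha beta b : R) (V w : R -> R).
Hypotheses (alpha2 : 2 <= alpha) (beta0 : 0 < beta) (b0 : 0 < b).
Hypothesis VE : forall x, V x = b * `|x| `^ alpha + w x.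
Hypothesis cw : continuous w.
Hypothesis w_pinfty : w =o_ (+oo_R) (fun x => `|x| `^ alpha).
Hypothesis w_ninfty : w =o_ (-oo_R) (fun x => `|x| `^ alpha).

Lemma perturbation_small (eta : R) : 0 < eta -> exists K : R,
  forall x, K < `|x| -> `|w x| <= eta * `|x| `^ alpha.
Proof.
move=> eta0.
have /eqoP/(_ eta eta0)[M1 [_ H1]] := w_pinfty.
have /eqoP/(_ eta eta0)[M2 [_ H2]] := w_ninfty.
exists (Num.max `|M1| `|M2|) => x; rewrite gt_max => /andP[x1 x2].
have nE : `| `|x| `^ alpha | = `|x| `^ alpha by rewrite ger0_norm// powR_ge0.
have [x0|x0] := leP 0 x.
  rewrite -[in leRHS]nE; apply: H1; apply: le_lt_trans (ler_norm _) _.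
  by rewrite -(ger0_norm x0).
rewrite -[in leRHS]nE; apply: H2.
rewrite (ltr0_norm x0) in x2; have := ler_norm (- M2); rewrite normrN; lra.
Qed.

Lemma potential_le (eta : R) : 0 < eta -> exists K : R,
  forall x, K < `|x| -> V x <= (b + eta) * `|x| `^ alpha.
Proof.
move=> /perturbation_small[K HK]; exists K => x /HK h.
by rewrite VE mulrDl lerD2l (le_trans (ler_norm _)).
Qed.

(** Half of b - b' absorbs w, the other half the constant, |x| and beta [clog]. *)
Lemma potential_ge (b' C : R) : b' < b -> exists K : R,
  forall x, K < `|x| -> C + `|x| + b' * `|x| `^ alpha <= V x - beta * clog x.
Proof.
move=> b'b; have e0 : 0 < (b - b') / 2 by rewrite divr_gt0// subr_gt0.
have [K1 HK1] := perturbation_small e0.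
have [K2 HK2] := linear_le_powR C (1 + beta) alpha2 e0.
exists (Num.max K1 K2) => x; rewrite gt_max => /andP[/HK1 h1 /HK2 h2].
have h3 : beta * clog x <= beta * `|x| by rewrite ler_pM2l// clog_le_norm.
move: h1; rewrite ler_norml => /andP[h1 _].
by rewrite VE; move: (`|x| `^ alpha) h1 h2 => y h1 h2; lra.
Qed.

Lemma continuous_potential : continuous V.
Proof.
rewrite (_ : V = fun x => b * `|x| `^ alpha + w x); last exact/funext.
move=> x; apply: cvgD; last exact: cw.
apply: cvgM; first exact: cvg_cst.
by apply: continuous_norm_powR; apply: le_trans alpha2; rewrite ler1n.
Qed.

(** V - beta [clog] is nonnegative outside a compact set and bounded on it; c1 is this bound. The
    growth exceeds every linear function because alpha >= 2. *)
Lemma exists_confinement : exists c1 : R, 0 <= c1 /\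
  let Vt x := V x - beta * clog x + c1 in
  [/\ continuous Vt, forall x, 0 <= Vt x & forall C : R, exists K : R, 0 < K /\
    forall x, K <= `|x| -> C * (1 + `|x|) <= Vt x].
Proof.
have cU : continuous (fun x => V x - beta * clog x).
  move=> x; apply: cvgB; first exact: continuous_potential.
  by apply: cvgM; [exact: cvg_cst|exact: continuous_clog].
have cN : continuous (fun x => `|V x - beta * clog x|).
  by move=> x; apply: cvg_norm; exact: cU.
have [K HK] := potential_ge 0 b0.
have [M M0 HM] := Vt_bounded cN (fun x => normr_ge0 _) K.
exists M; split=> // Vt; split.
- by move=> x; apply: cvgD; [exact: cU|exact: cvg_cst].
- move=> x; rewrite /Vt; have [xK|/HK] := leP `|x| K; last first.
    by have := normr_ge0 x; lra.
  by have := HM x xK; rewrite ler_norml => /andP[h _]; lra.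
move=> C; have b2 : 0 < b / 2 by rewrite divr_gt0.
have b2b : b / 2 < b by rewrite ltr_pdivrMr//; have := b0; lra.
have [K1 HK1] := potential_ge 0 b2b.
have [K2 HK2] := linear_le_powR C C alpha2 b2.
exists (Num.max 0 (Num.max K1 K2) + 1); split; first by rewrite ltr_wpDl// le_max lexx.
move=> x xK; have {xK} : Num.max 0 (Num.max K1 K2) < `|x| by apply: lt_le_trans xK; rewrite ltrDl.
rewrite !gt_max => /and3P[x0 /HK1 h1 /HK2 h2].
by rewrite /Vt; move: M0 x0 h1 h2; lra.
Qed.

End Potential.

Theorem theorem1p1 (R : realType) (alpha beta b : R) (V w : R -> R)
    (sigma : probability (measurableTypeR R) R) (p : nat)
    (halpha : 2 <= alpha) (hbeta : 0 < beta) (hb : 0 < b)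
    (hV : forall x, V x = b * `|x| `^ alpha + w x)
    (hwcont : continuous w)
    (hwconv : convex_function (setT : set R^o) w)
    (hwpinfty : w =o_ (+oo_R) (fun x => `|x| `^ alpha))
    (hwninfty : w =o_ (-oo_R) (fun x => `|x| `^ alpha))
    (hsigma : equilibrium_measure V beta sigma)
    (hp : alpha < p%:R) :
  satisfies_LDP (beta_ensemble V beta) (@empirical_moment R p)
    (fun N => N%:R `^ (1 + alpha / p%:R))
    (moment_rate b alpha p (moment sigma p)) /\
  good (moment_rate b alpha p (moment sigma p)).
Proof.
have alpha1 : 1 <= alpha by apply: le_trans halpha; rewrite ler1n.
have [c1 [c10 [cVt Vt0 growth]]] := exists_confinement halpha hbeta hb hV hwcont hwpinfty hwninfty.
pose Vt x := V x - beta * clog x + c1.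
have VE x : V x = Vt x + beta * clog x - c1 by rewrite /Vt; ring.
(* The two energies differ by the constant c1, so they have the same minimisers. *)
have hmin mu : (eng beta Vt sigma <= eng beta Vt mu)%E.
  have := hsigma.1 mu.
  by rewrite !(energyE hbeta (measurable_cVt cVt) Vt0 growth _ c10 VE) leeD2rE.
split; last exact: moment_rate_good.
apply: (moment_LDP hbeta cVt Vt0 growth VE hmin alpha1 hp hb).
- move=> b' C b'b.
  have [K HK] := potential_ge halpha hbeta hV hwpinfty hwninfty C b'b.
  by exists K => x /HK; rewrite /Vt addrK.
- exact: (potential_le hV hwpinfty hwninfty).
Qed.
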